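(* Let $\chi$ be a function whose Fourier transform $\tilde\chi\in C^\infty(\mathbb R)$ satisfies $\tilde\chi(0)\ne0$, tends to $0$ at infinity, and has all its derivatives vanishing at the origin and at infinity. For $\alpha>0$ let $f_\alpha$ be defined by $\tilde f_\alpha(p)=\theta(p)p^\alpha\tilde\chi(p)$ ($p\in\mathbb R$), and assume $f_\alpha$ is normalised, i.e. $\int_0^\infty \frac{dp}{2p}|\tilde f_\alpha(p)|^2=1$. Then (1) $\bar N[f_\alpha]<\infty$ if and only if $\alpha>1/2$; (2) $\bar N^{Th}_{2\pi}[f_\alpha]<\infty$ if and only if $\alpha>1/2$; (3) the integral $\int_0^\infty\frac{dk}{2k}\big(|\widetilde{\check f_\alpha}(-k)|^2-|\widetilde{\check f_\alpha}^{\,Th}(-k)|^2\big)$ (which represents $\bar N[f_\alpha]-\bar N^{Th}_{2\pi}[f_\alpha]$) converges absolutely if and only if $\alpha>1/2$. Moreover, if $\alpha\le1/2$: $\int_0^1\frac{dk}{2k}|\widetilde{\check f_\alpha}(-k)|^2<\infty$ while $\int_1^\infty\frac{dk}{2k}|\widetilde{\check f_\alpha}(-k)|^2=\infty$; both $\int_0^1\frac{dk}{2k}|\widetilde{\check f_\alpha}^{\,Th}(-k)|^2$ and $\int_1^\infty\frac{dk}{2k}|\widetilde{\check f_\alpha}^{\,Th}(-k)|^2$ are infinite; and the integral of $\frac{1}{2k}\big||\widetilde{\check f_\alpha}(-k)|^2-|\widetilde{\check f_\alpha}^{\,Th}(-k)|^2\big|$ is finite over $[1,\infty)$ but infinite over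 $(0,1]$.
   Context: $\theta$ is the Heaviside step function. Fourier transforms are $\tilde g(p)=(2\pi)^{-1/2}\int g(y)e^{-ipy}dy$. With $x(y)=-\log(1+e^{-y})$, define for $k\ge0$: $\widetilde{\check f}(-k)=(2\pi)^{-1/2}\int_{\mathbb R} f(y)e^{ikx(y)}dy$ and $\widetilde{\check f}^{\,Th}(-k)=(2\pi)^{-1/2}\int_{\mathbb R} f(y)e^{-ike^{-y}}dy$. The mean number of created particles is $\bar N[f]=\int_0^\infty\frac{dk}{2k}|\widetilde{\check f}(-k)|^2\in[0,\infty]$, and the thermal average at inverse temperature $\beta$ is $\bar N^{Th}_\beta[f]=\int_0^\infty\frac{dp}{2p}\frac{|\tilde f(p)|^2}{e^{\beta p}-1}$; one has $\bar N^{Th}_{2\pi}[f]=\int_0^\infty\frac{dk}{2k}|\widetilde{\check f}^{\,Th}(-k)|^2$. *)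

(* Defs.v *)
(* over an abstract R : realType.
   Complex-valued functions R -> C are represented by their real and imaginary
   parts (two functions R -> R); all integrals are Lebesgue integrals. *)
From HB Require Import structures.
From mathcomp Require Import all_boot all_order all_algebra.
From mathcomp Require Import all_classical all_reals all_analysis.
Set Implicit Arguments. Unset Strict Implicit. Unset Printing Implicit Defensive.
Import Order.TTheory GRing.Theory Num.Theory.
Import numFieldNormedType.Exports.
Local Open Scope classical_set_scope.
Local Open Scope ring_scope.

Section Defs.
Variable R : realType.

Definition leb := (@lebesgue_measure R).

(* (2 pi)^{-1/2} \int_R g(y) e^{i phi(y)} dy, real and imaginary parts,
   for g = gr + i gi *)
Definition twist_re (phi gr gi : R -> R) : R :=
  (Num.sqrt (2 * pi))^-1 *
  Rintegral leb setT (fun y => gr y * cos (phi y) - gi y * sin (phi y)).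
Definition twist_im (phi gr gi : R -> R) : R :=
  (Num.sqrt (2 * pi))^-1 *
  Rintegral leb setT (fun y => gr y * sin (phi y) + gi y * cos (phi y)).

Definition FT_re (gr gi : R -> R) (p : R) := twist_re (fun y => - (p * y)) gr gi.
Definition FT_im (gr gi : R -> R) (p : R) := twist_im (fun y => - (p * y)) gr gi.
Definition FT_sqnorm (gr gi : R -> R) (p : R) :=
  FT_re gr gi p ^+ 2 + FT_im gr gi p ^+ 2.

Definition xcoord (y : R) : R := - ln (1 + expR (- y)).

(* |check f~(-k)|^2  with  check f~(-k) = (2pi)^{-1/2} \int f(y) e^{i k x(y)} dy *)
Definition check_sqnorm (fr fi : R -> R) (k : R) : R :=
  twist_re (fun y => k * xcoord y) fr fi ^+ 2 +
  twist_im (fun y => k * xcoord y) fr fi ^+ 2.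

(* |check f~^Th(-k)|^2 with check f~^Th(-k) = (2pi)^{-1/2} \int f(y) e^{-i k e^{-y}} dy *)
Definition checkTh_sqnorm (fr fi : R -> R) (k : R) : R :=
  twist_re (fun y => - (k * expR (- y))) fr fi ^+ 2 +
  twist_im (fun y => - (k * expR (- y))) fr fi ^+ 2.

Definition Nbar (fr fi : R -> R) : \bar R :=
  (\int[leb]_(k in [set` `]0, +oo[%R]) ((check_sqnorm fr fi k / (2 * k))%:E))%E.

Definition NbarTh (beta : R) (fr fi : R -> R) : \bar R :=
  (\int[leb]_(p in [set` `]0, +oo[%R])
     ((FT_sqnorm fr fi p / (2 * p) / (expR (beta * p) - 1))%:E))%E.

Definition Npart (D : set R) (fr fi : R -> R) : \bar R :=
  (\int[leb]_(k in D) ((check_sqnorm fr fi k / (2 * k))%:E))%E.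
Definition NThpart (D : set R) (fr fi : R -> R) : \bar R :=
  (\int[leb]_(k in D) ((checkTh_sqnorm fr fi k / (2 * k))%:E))%E.
Definition Ndiffabs (D : set R) (fr fi : R -> R) : \bar R :=
  (\int[leb]_(k in D)
     ((`|check_sqnorm fr fi k - checkTh_sqnorm fr fi k| / (2 * k))%:E))%E.

Definition smooth (g : R -> R) : Prop :=
  forall (n : nat) (x : R), derivable (derive1n n g) x 1.

Definition derivs_vanish_at_infty (g : R -> R) : Prop :=
  forall n : nat,
    derive1n n g x @[x --> +oo] --> (0 : R) /\
    derive1n n g x @[x --> -oo] --> (0 : R).

Definition derivs_vanish_at_0 (g : R -> R) : Prop :=
  forall n : nat, (0 < n)%N -> derive1n n g 0 = 0.

End Defs.

(* Main.v *)
(* Write F for f_alpha.  Since its Fourier transform vanishes on the negative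
   axis, F extends holomorphically to the upper half plane, the extension on the
   line Im = s being its Poisson integral.  Rotating the line of integration to
   Im = pi/2 turns the oscillating phase exp (-i k e^-y) into the damped factor
   exp (- k e^-y), and exp (i k x(y)) into a bounded factor phiX that
   - differs from exp (- k e^-y) by O(1/k), which compares the two amplitudes for
     large k;
   - differs from exp (i k min(y, 0)) by O(k), which gives the amplitude the size
     O(k^(alpha/2)) for small k.
   With k = e^u and dk/k = du, the thermal amplitude is the Fourier transform of
   a spectrum Z supported on p > 0 and asymptotic to c p^(alpha - 1) at 0.
   If alpha > 1/2, Z is square integrable, hence so is its transform (Schur's
   test with the Poisson kernel).  If alpha <= 1/2, the Laplace transform at
   sigma of either half of the transform grows at least like sigma^(-1/2),
   whereas square integrability would force o(sigma^(-1/2)). *)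
Require Import Defs.
From HB Require Import structures.
From mathcomp Require Import all_boot all_order all_algebra.
From mathcomp Require Import all_classical all_reals all_analysis.
From mathcomp Require Import measurable_realfun complex ring lra.
Import Order.TTheory GRing.Theory Num.Theory.
Import numFieldNormedType.Exports.
Import ComplexField.Normc.
Local Open Scope classical_set_scope.
Local Open Scope ring_scope.
Local Open Scope complex_scope.
Set Implicit Arguments. Unset Strict Implicit. Unset Printing Implicit Defensive.

(** * Integration of real and complex functions on the line *)

(** The obstacle is that [F] is merely integrable on the line: it has no regularity there, and a
    single Cauchy kernel is not integrable, so the line of integration cannot be moved by a direct
    appeal to Cauchy's theorem. The choice of kernel removes both defects. Against [F] the lower
    Cauchy kernel integrates to 0 whatever its width; with the width 2 s - tau the sum of the upper
    and lower kernels is holomorphic in the strip and decays quadratically. Poisson averages are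
    moved from [F] to the phase, which is bounded by 1, and this gives the limits at both edges. The
    height pi/2 is where e^-z becomes - i e^-y. The threshold 1/2 is that of the square
    integrability of p^(alpha - 1) at 0. The thermal mean [NbarTh] is given by Planck's integral and
    is treated directly on the spectrum: near 0 the integrand has the size p^(2 alpha - 2), and for
    large p the normalisation bounds it. Upper bounds use the exponent min (alpha, 1), so that the
    singularity p^(a - 1) is never increasing. Complex integrals are bounded by components, hence
    spare factors 2 in the constants; only finiteness and orders of growth matter. *)

Section RealIntegrals.
Variable R : realType.
Local Notation mu := (@lebesgue_measure R).
Implicit Types f g h : R -> R.

Definition L1 f := mu.-integrable setT (EFin \o f).
Definition Rint f := \int[mu]_x f x.

Lemma L1_meas f : L1 f -> measurable_fun setT f.
Proof. by move=> /(measurable_int mu)/measurable_EFinP. Qed.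

Lemma L1_le f g : measurable_fun setT f -> (forall x, `|f x| <= g x) ->
  L1 g -> L1 f.
Proof.
move=> mf fg; apply: le_integrable => //; first exact/measurable_EFinP.
by move=> x _ /=; rewrite lee_fin (le_trans (fg x))// ler_norm.
Qed.

Lemma L1_norm f : L1 f -> L1 (fun x => `|f x|).
Proof. exact: integrable_norm. Qed.

Lemma L1D f g : L1 f -> L1 g -> L1 (fun x => f x + g x).
Proof.
move=> lf lg; have := integrableD measurableT lf lg.
by apply: eq_integrable.
Qed.

Lemma L1Z a f : L1 f -> L1 (fun x => a * f x).
Proof.
move=> lf; have := integrableZl measurableT a lf.
by apply: eq_integrable.
Qed.

Lemma L1N f : L1 f -> L1 (fun x => - f x).
Proof. by move=> /(L1Z (-1)); under eq_fun do rewrite mulN1r. Qed.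

Lemma L1B f g : L1 f -> L1 g -> L1 (fun x => f x - g x).
Proof. by move=> lf /L1N; exact: L1D. Qed.

Lemma L1P f : measurable_fun setT f ->
  (\int[mu]_x `|f x|%:E < +oo)%E <-> L1 f.
Proof.
move=> mf; split => [h|/integrableP[_]//].
by apply/integrableP; split => //; exact/measurable_EFinP.
Qed.

Lemma RintE f : L1 f -> (\int[mu]_x (f x)%:E)%E = (Rint f)%:E.
Proof. by move=> lf; rewrite /Rint /Rintegral fineK//; exact: integrable_fin_num. Qed.

Lemma RintD f g : L1 f -> L1 g -> Rint (fun x => f x + g x) = Rint f + Rint g.
Proof. by move=> lf lg; rewrite /Rint RintegralD. Qed.

Lemma RintZ a f : L1 f -> Rint (fun x => a * f x) = a * Rint f.
Proof. by move=> lf; rewrite /Rint RintegralZl. Qed.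

Lemma RintN f : L1 f -> Rint (fun x => - f x) = - Rint f.
Proof. by move=> lf; rewrite -mulN1r -RintZ//; congr Rint; apply/funext => x; rewrite mulN1r. Qed.

Lemma RintB f g : L1 f -> L1 g -> Rint (fun x => f x - g x) = Rint f - Rint g.
Proof. by move=> lf lg; rewrite RintD ?RintN//; exact: L1N. Qed.

Lemma le_Rint f g : L1 f -> L1 g -> (forall x, f x <= g x) -> Rint f <= Rint g.
Proof. by move=> lf lg fg; apply: le_Rintegral => // x _. Qed.

Lemma Rint_ge0 f : (forall x, 0 <= f x) -> 0 <= Rint f.
Proof. by move=> f0; apply: Rintegral_ge0. Qed.

Lemma normr_Rint f : L1 f -> `|Rint f| <= Rint (fun x => `|f x|).
Proof. by move=> lf; exact: le_normr_Rintegral. Qed.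

Lemma dominated_Rint (f_ : nat -> R -> R) f g :
  (forall n, measurable_fun setT (f_ n)) -> measurable_fun setT f -> L1 g ->
  (forall x, f_ n x @[n --> \oo] --> f x) ->
  (forall n x, `|f_ n x| <= g x) ->
  L1 f /\ Rint (f_ n) @[n --> \oo] --> Rint f.
Proof.
move=> mf_ mf lg ff fg.
have [|||||i1 _ i2] := @dominated_convergence _ _ R mu setT measurableT
  (fun n => EFin \o f_ n) (EFin \o f) (EFin \o g).
- by move=> n /=; apply/measurable_EFinP; exact: mf_.
- exact/measurable_EFinP.
- by apply/nearW => x _; apply: cvg_EFin; [exact: nearW|exact: ff].
- exact: lg.
- by apply/nearW => x n _; rewrite /= lee_fin.
split => //.
by apply: fine_cvg; rewrite -/(Rintegral _ _ _) fineK//; exact: integrable_fin_num.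
Qed.

Let affine (a b : R) : R -> measurableTypeR R := fun x => a + b * x.

Lemma measurable_affine (a b : R) : measurable_fun setT (fun x : R => a + b * x).
Proof. by apply: measurable_funD => //; exact: mulrl_measurable. Qed.

(** Uniqueness of Lebesgue measure: the scaled pushforward gives every half-open interval its
    length. *)
Lemma lebesgue_affine (a b : R) (b0 : 0 < b) A : measurable A ->
  mu A = (b%:E * pushforward mu (affine a b) A)%E.
Proof.
have ma : measurable_fun setT (affine a b) by exact: measurable_affine.
move=> mA.
pose pa : {measure set (measurableTypeR R) -> \bar R} :=
  mscale (NngNum (ltW b0)) (@measure_function_pushforward__canonical__measure_function_Measure _ _ _ _ _ mu _ ma).
rewrite (lebesgue_measure_unique (mu := pa))// => _ [[x y]] _ <-.
rewrite /pa /= /mscale /= /pushforward.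
rewrite (_ : affine a b @^-1` _ = `]((x - a) / b), ((y - a) / b)]%classic); last first.
  apply/seteqP; split => z /=; rewrite !in_itv/= /affine => /andP[h1 h2]; apply/andP; split.
  - by rewrite ltr_pdivrMr// ltrBlDr; lra.
  - by rewrite ler_pdivlMr//; lra.
  - by move: h1; rewrite ltr_pdivrMr//; lra.
  - by move: h2; rewrite ler_pdivlMr//; lra.
rewrite !lebesgue_measure_itv/= !lte_fin ltr_pM2r ?invr_gt0// ltrD2r.
case: ifP => _; last by rewrite mule0.
by rewrite -!EFinD -EFinM; congr EFin; field; rewrite gt_eqF.
Qed.

End RealIntegrals.

(** * Affine changes of variable *)

Section Substitution.
Variable R : realType.
Local Notation mu := (@lebesgue_measure R).
Implicit Types f : R -> R.

Lemma ge0_integral_affine (a b : R) (f : R -> \bar R) : 0 < b ->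
  measurable_fun setT f -> (forall x, (0 <= f x)%E) ->
  (\int[mu]_x f x = b%:E * \int[mu]_x f (a + b * x)%R)%E.
Proof.
move=> b0 mf f0.
have ma : measurable_fun setT ((fun x => a + b * x) : measurableTypeR R -> measurableTypeR R).
  exact: measurable_affine.
have := @ge0_integral_pushforward _ _ (measurableTypeR R) (measurableTypeR R) R _ ma mu setT f measurableT mf.
rewrite preimage_setT => <- //.
set pf := pushforward _ _.
pose nb : {nonneg R} := NngNum (ltW b0).
rewrite -(ge0_integral_mscale _ measurableT nb)//.
by apply: eq_measure_integral => A mA _; exact: lebesgue_affine.
Qed.

Lemma ge0_integral_opp (f : R -> \bar R) :
  measurable_fun setT f -> (forall x, (0 <= f x)%E) ->
  (\int[mu]_x f x = \int[mu]_x f (- x)%R)%E.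
Proof.
move=> mf f0.
have ma : measurable_fun setT ((fun x => - x) : measurableTypeR R -> measurableTypeR R).
  exact: oppr_measurable.
have := @ge0_integral_pushforward _ _ (measurableTypeR R) (measurableTypeR R) R _ ma mu setT f measurableT mf.
rewrite preimage_setT => <- //.
by apply: eq_measure_integral => A mA _; apply/esym; exact: lebesgue_measureN.
Qed.

Lemma L1_affine (a b : R) f : 0 < b -> L1 f -> L1 (fun x => f (a + b * x)).
Proof.
move=> b0 lf; have mf := L1_meas lf.
have ma := measurable_affine a b.
apply/L1P; first exact: measurableT_comp mf ma.
move/L1P : (lf) => /(_ mf).
rewrite (@ge0_integral_affine a b)//; last first.
  by apply/measurable_EFinP; exact: measurableT_comp.
move=> h; rewrite ltNge leye_eq; apply/negP => /eqP e.
by move: h; rewrite e mulry gtr0_sg// mul1e ltxx.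
Qed.

Lemma L1_opp f : L1 f -> L1 (fun x => f (- x)).
Proof.
move=> lf; have mf := L1_meas lf.
apply/L1P; first exact: measurableT_comp mf (@oppr_measurable R setT).
move/L1P : (lf) => /(_ mf).
rewrite ge0_integral_opp//.
by apply/measurable_EFinP; exact: measurableT_comp.
Qed.

Lemma Rint_affine (a b : R) f : 0 < b -> L1 f ->
  Rint f = b * Rint (fun x => f (a + b * x)).
Proof.
move=> b0 lf; have mf := L1_meas lf.
have la := L1_affine a b0 lf.
apply: EFin_inj; rewrite EFinM -!RintE// integralE [in RHS]integralE.
have -> : ((fun x => (f (a + b * x)%R)%:E)^\+ = (fun x => (EFin \o f)^\+ (a + b * x)%R))%E by apply/funext => x; rewrite ?funeposE ?funenegE.
have -> : ((fun x => (f (a + b * x)%R)%:E)^\- = (fun x => (EFin \o f)^\- (a + b * x)%R))%E by apply/funext => x; rewrite ?funeposE ?funenegE.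
have mEf : measurable_fun setT (EFin \o f) by exact/measurable_EFinP.
rewrite (@ge0_integral_affine a b (EFin \o f)^\+%E)//; last exact: measurable_funepos.
rewrite (@ge0_integral_affine a b (EFin \o f)^\-%E)//; last exact: measurable_funeneg.
have fn : (\int[mu]_x (EFin \o f)^\- (a + b * x)%R \is a fin_num)%E.
  have := integrable_neg_fin_num measurableT la.
  by under eq_integral do rewrite funenegE; under [in X in _ -> X]eq_integral do rewrite funenegE.
by rewrite [in RHS]muleBr//; apply: fin_num_adde_defl; rewrite fin_numN.
Qed.

Lemma Rint_opp f : L1 f -> Rint f = Rint (fun x => f (- x)).
Proof.
move=> lf; have mf := L1_meas lf.
have la := L1_opp lf.
apply: EFin_inj; rewrite -!RintE// integralE [in RHS]integralE.
have -> : ((fun x => (f (- x)%R)%:E)^\+ = (fun x => (EFin \o f)^\+ (- x)%R))%E by apply/funext => x; rewrite ?funeposE ?funenegE.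
have -> : ((fun x => (f (- x)%R)%:E)^\- = (fun x => (EFin \o f)^\- (- x)%R))%E by apply/funext => x; rewrite ?funeposE ?funenegE.
have mEf : measurable_fun setT (EFin \o f) by exact/measurable_EFinP.
rewrite (@ge0_integral_opp (EFin \o f)^\+%E)//; last exact: measurable_funepos.
by rewrite (@ge0_integral_opp (EFin \o f)^\-%E)//; exact: measurable_funeneg.
Qed.

End Substitution.

(** * Complex numbers, modulus and exponential *)

Section ComplexNumbers.
Variable R : realType.
Local Notation C := R[i].
Implicit Types (z w : C) (x : R).

Definition re z : R := complex.Re z.
Definition im z : R := complex.Im z.

Lemma reD z w : re (z + w) = re z + re w. Proof. by case: z w => [a b] [c d]. Qed.
Lemma imD z w : im (z + w) = im z + im w. Proof. by case: z w => [a b] [c d]. Qed.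
Lemma reN z : re (- z) = - re z. Proof. by case: z. Qed.
Lemma imN z : im (- z) = - im z. Proof. by case: z. Qed.
Lemma reM z w : re (z * w) = re z * re w - im z * im w. Proof. by case: z w => [a b] [c d]. Qed.
Lemma imM z w : im (z * w) = re z * im w + im z * re w. Proof. by case: z w => [a b] [c d]. Qed.
Lemma reR x : re x%:C = x. Proof. by []. Qed.
Lemma imR x : im x%:C = 0. Proof. by []. Qed.
Lemma rei : re 'i%C = 0. Proof. by []. Qed.
Lemma imi : im 'i%C = 1. Proof. by []. Qed.
Lemma reC x y : re (x +i* y) = x. Proof. by []. Qed.
Lemma imC x y : im (x +i* y) = y. Proof. by []. Qed.
Lemma reV z : re z^-1 = re z / (re z ^+ 2 + im z ^+ 2). Proof. by case: z. Qed.
Lemma imV z : im z^-1 = - (im z / (re z ^+ 2 + im z ^+ 2)). Proof. by case: z. Qed.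
Lemma re1 : re 1 = 1. Proof. by []. Qed.
Lemma im1 : im 1 = 0. Proof. by []. Qed.
Lemma re0 : re 0 = 0. Proof. by []. Qed.
Lemma im0 : im 0 = 0. Proof. by []. Qed.
(** The rules [reV] and [imV] for inverses stay out, so that denominators are expanded only on
    request. *)
Definition reimE := (reD, imD, reN, imN, reM, imM, reR, imR, rei, imi, reC, imC, re1, im1, re0, im0).

Lemma Cext z w : re z = re w -> im z = im w -> z = w.
Proof. by case: z w => [a b] [c d] /= -> ->. Qed.

Lemma CE z : z = (re z)%:C + 'i%C * (im z)%:C.
Proof. by apply: Cext; rewrite !reimE; ring. Qed.

Lemma normcE z : normc z = Num.sqrt (re z ^+ 2 + im z ^+ 2).
Proof. by case: z. Qed.

Lemma sqr_normc z : normc z ^+ 2 = re z ^+ 2 + im z ^+ 2.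
Proof. by rewrite normcE sqr_sqrtr// addr_ge0// sqr_ge0. Qed.

Lemma normc_ge0 z : 0 <= normc z.
Proof. by rewrite normcE sqrtr_ge0. Qed.

Lemma normcR x : normc x%:C = `|x|.
Proof. by rewrite normcE !reimE expr0n addr0 sqrtr_sqr. Qed.

Lemma normci : normc ('i%C : C) = 1.
Proof. by rewrite normcE !reimE expr0n add0r expr1n sqrtr1. Qed.

Lemma normc_re z : `|re z| <= normc z.
Proof. by rewrite normcE -sqrtr_sqr ler_wsqrtr// lerDl sqr_ge0. Qed.

Lemma normc_im z : `|im z| <= normc z.
Proof. by rewrite normcE -sqrtr_sqr ler_wsqrtr// lerDr sqr_ge0. Qed.

Lemma ler_normcD z w : normc (z + w) <= normc z + normc w.
Proof. exact: le_normcD. Qed.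

Lemma ler_normcB z w : normc (z - w) <= normc z + normc w.
Proof. by rewrite -(normcN w); exact: le_normcD. Qed.

Lemma normc_le z : normc z <= `|re z| + `|im z|.
Proof.
rewrite {1}[z]CE (le_trans (ler_normcD _ _))// normcM normcR normci mul1r.
by rewrite normcR.
Qed.

Lemma normc_eq0 z : normc z = 0 -> z = 0.
Proof. exact: eq0_normc. Qed.

Lemma ler_dist_sqr_normc z w :
  `|normc z ^+ 2 - normc w ^+ 2| <= normc (z - w) * (normc z + normc w).
Proof.
rewrite subr_sqr normrM (ger0_norm (addr_ge0 (normc_ge0 z) (normc_ge0 w))).
rewrite ler_wpM2r ?addr_ge0 ?normc_ge0//.
rewrite ler_norml; apply/andP; split.
  have := ler_normcD (w - z) z; rewrite subrK -(normcN (w - z)) opprB; lra.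
have := ler_normcD (z - w) w; rewrite subrK; lra.
Qed.

Definition cis x : C := cos x +i* sin x.
Definition cexp z : C := (expR (re z))%:C * cis (im z).

Lemma cisD x y : cis (x + y) = cis x * cis y.
Proof. by apply: Cext; rewrite !reimE; [rewrite cosD|rewrite sinD; ring]. Qed.

Lemma cis0 : cis 0 = 1.
Proof. by apply: Cext; rewrite !reimE ?cos0 ?sin0. Qed.

Lemma normc_cis x : normc (cis x) = 1.
Proof. by rewrite normcE !reimE cos2Dsin2 sqrtr1. Qed.

Lemma normc_cexp z : normc (cexp z) = expR (re z).
Proof. by rewrite normcM normcR normc_cis mulr1 ger0_norm// expR_ge0. Qed.

Lemma cisE x : cis x = cexp ('i%C * x%:C).
Proof. by rewrite /cexp !reimE !(mul0r,mul1r,subr0,addr0,mulr0) expR0 rmorph1 mul1r add0r. Qed.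

Lemma cexpR x : cexp x%:C = (expR x)%:C.
Proof. by rewrite /cexp !reimE cis0 mulr1. Qed.

End ComplexNumbers.

(** * Measurability of complex functions *)

Section ComplexMeasurable.
Context d (T : measurableType d) (R : realType).
Implicit Types (f g : T -> R[i]).

Definition mC f := measurable_fun setT (fun x => re (f x)) /\ measurable_fun setT (fun x => im (f x)).

Lemma mC_cst (c : R[i]) : mC (fun _ => c).
Proof. by split; exact: measurable_cst. Qed.

Lemma mCD f g : mC f -> mC g -> mC (fun x => f x + g x).
Proof.
by move=> [a b] [c d0]; split; under eq_fun do rewrite !reimE; apply: measurable_funD.
Qed.

Lemma mCN f : mC f -> mC (fun x => - f x).
Proof.
by move=> [a b]; split; under eq_fun do rewrite !reimE; apply: measurableT_comp.
Qed.

Lemma mCB f g : mC f -> mC g -> mC (fun x => f x - g x).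
Proof. by move=> mf mg; apply: mCD => //; exact: mCN. Qed.

Lemma mCM f g : mC f -> mC g -> mC (fun x => f x * g x).
Proof.
move=> [a b] [c d0]; split; under eq_fun do rewrite !reimE.
  by apply: measurable_funB; apply: measurable_funM.
by apply: measurable_funD; apply: measurable_funM.
Qed.

Lemma measurable_inv : measurable_fun setT (fun x : R => x^-1).
Proof.
(* The square is nonnegative, so off 0 its inverse is [expR (- ln (x ^+ 2))]; at 0 the convention
   0^-1 = 0 applies. *)
rewrite (_ : (fun x => x^-1) = (fun x : R => x / (x ^+ 2))); last first.
  apply/funext => x; have [->|x0] := eqVneq x 0; first by rewrite mul0r invr0.
  by field.
apply: measurable_funM => //.
rewrite (_ : (fun x : R => (x ^+ 2)^-1) = (fun x : R => if x == 0 then 0 else expR (- ln (x ^+ 2)))); last first.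
  apply/funext => x; case: eqP => [->|/eqP x0]; first by rewrite expr0n invr0.
  by rewrite expRN lnK// posrE exprn_even_gt0.
apply: measurable_fun_ifT => //.
  by apply: measurable_fun_eqr.
apply: (measurableT_comp (@measurable_expR R)).
apply: (measurableT_comp (@oppr_measurable R setT)).
apply: (measurableT_comp (@measurable_ln R)).
exact: exprn_measurable.
Qed.

Lemma mCV f : mC f -> mC (fun x => (f x)^-1).
Proof.
move=> [a b].
have mN : measurable_fun setT (fun x => (re (f x) ^+ 2 + im (f x) ^+ 2)^-1).
  apply: (measurableT_comp measurable_inv).
  by apply: measurable_funD; apply: measurable_funX.
split.
- under eq_fun do rewrite reV; exact: measurable_funM.
- under eq_fun do rewrite imV; apply: measurableT_comp => //; exact: measurable_funM.
Qed.

Lemma mC_real (h : T -> R) : measurable_fun setT h -> mC (fun x => (h x)%:C).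
Proof. by move=> mh; split => //; exact: measurable_cst. Qed.

Lemma mC_cis (h : T -> R) : measurable_fun setT h -> mC (fun x => cis (h x)).
Proof.
move=> mh; split.
- apply: (@measurableT_comp _ _ _ _ _ _ (@cos R)) => //.
  by apply: continuous_measurable_fun; exact: continuous_cos.
- apply: (@measurableT_comp _ _ _ _ _ _ (@sin R)) => //.
  by apply: continuous_measurable_fun; exact: continuous_sin.
Qed.

Lemma mC_cexp f : mC f -> mC (fun x => cexp (f x)).
Proof.
move=> [a b]; apply: mCM; last exact: mC_cis.
by apply: mC_real; apply: measurableT_comp => //; exact: measurable_expR.
Qed.

Lemma m_normc f : mC f -> measurable_fun setT (fun x => normc (f x)).
Proof.
move=> [a b]; under eq_fun do rewrite normcE.
rewrite (_ : (fun x => _) = (fun x => (re (f x) ^+ 2 + im (f x) ^+ 2) `^ 2^-1)); last first.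
  by apply/funext => x; rewrite powR12_sqrt// addr_ge0// sqr_ge0.
apply: (measurableT_comp (@measurable_powR R _)).
by apply: measurable_funD; apply: measurable_funX.
Qed.

End ComplexMeasurable.

(** * Lipschitz bounds for the exponential *)

Section Lipschitz.
Variable R : realType.

Lemma lipschitz_derive (f df : R -> R) (K : R) :
  (forall x, is_derive x (1:R) f (df x)) -> (forall x, `|df x| <= K) ->
  forall x y, `|f x - f y| <= K * `|x - y|.
Proof.
move=> fdf dfK x y.
wlog xy : x y / x <= y.
  move=> H; have [|/ltW] := leP x y; first exact: H.
  by rewrite distrC (distrC x); exact: H.
have [|c _ e] := @MVT_segment R f df x y xy (fun z _ => fdf z).
  by apply: derivable_within_continuous => z _; have [] := fdf z.
by rewrite distrC e normrM (distrC x) ler_wpM2r.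
Qed.

Lemma normc_cisB (x y : R) : normc (cis x - cis y) <= 2 * `|x - y|.
Proof.
rewrite (le_trans (normc_le _))// !reimE mulr_natl mulr2n lerD//.
- rewrite -[leRHS]mul1r; apply: (@lipschitz_derive cos (fun z => - sin z) 1) => z.
  by rewrite normrN sin_max.
- rewrite -[leRHS]mul1r; apply: (@lipschitz_derive sin cos 1) => z.
  by rewrite cos_max.
Qed.

(** In the closed left half plane the exponential has modulus at most 1. The constant 3 is 2 for the
    change of phase ([normc_cisB]) plus 1 for the change of modulus. *)
Lemma normc_cexpB (z w : R[i]) : re z <= 0 -> re w <= 0 ->
  normc (cexp z - cexp w) <= 3 * normc (z - w).
Proof.
move=> z0 w0.
have -> : cexp z - cexp w = (expR (re z))%:C * (cis (im z) - cis (im w))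
    + (expR (re z) - expR (re w))%:C * cis (im w).
  by rewrite /cexp rmorphB/=; ring.
rewrite (le_trans (ler_normcD _ _))// !normcM !normcR normc_cis mulr1.
have h1 : expR (re z) * normc (cis (im z) - cis (im w)) <= 2 * normc (z - w).
  rewrite (le_trans (ler_piMl (normc_ge0 _) _)) ?expR_le1//.
  rewrite (le_trans (normc_cisB _ _))// ler_wpM2l//.
  by rewrite (le_trans _ (normc_im _))// !reimE.
have -> : 3 * normc (z - w) = 2 * normc (z - w) + normc (z - w) by ring.
rewrite (ger0_norm (expR_ge0 _)) lerD//.
apply: le_trans (normc_re _); rewrite !reimE.
have [xy|/ltW xy] := leP (re w) (re z).
  rewrite !ger0_norm ?subr_ge0 ?ler_expR//.
  have := expR_ge1Dx (re w - re z); have := expRB (re w) (re z).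
  have := expR_gt0 (re z); have : expR (re z) <= 1 by rewrite expR_le1.
  by move=> a b -> ; rewrite ler_pdivlMr//; nra.
rewrite distrC (distrC (re z)) !ger0_norm ?subr_ge0 ?ler_expR//.
have := expR_ge1Dx (re z - re w); have := expRB (re z) (re w).
have := expR_gt0 (re w); have : expR (re w) <= 1 by rewrite expR_le1.
by move=> a b -> ; rewrite ler_pdivlMr//; nra.
Qed.

End Lipschitz.

(** * Integration of complex functions *)

Section ComplexIntegral.
Variable R : realType.
Local Notation mu := (@lebesgue_measure R).
Local Notation C := R[i].
Implicit Types (f g : R -> C) (h : R -> R).

Definition L1C f := L1 (fun x => re (f x)) /\ L1 (fun x => im (f x)).
Definition Cint f : C := Rint (fun x => re (f x)) +i* Rint (fun x => im (f x)).

Lemma L1C_meas f : L1C f -> mC f.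
Proof. by move=> [a b]; split; exact: L1_meas. Qed.

Lemma L1C_le f h : mC f -> L1 h -> (forall x, normc (f x) <= h x) -> L1C f.
Proof.
move=> [a b] lh fh; split; apply: L1_le lh => // x.
  exact: le_trans (normc_re _) (fh x).
exact: le_trans (normc_im _) (fh x).
Qed.

Lemma L1C_norm f : L1C f -> L1 (fun x => normc (f x)).
Proof.
move=> lf; have [a b] := lf.
apply: L1_le (L1D (L1_norm a) (L1_norm b)); first exact/m_normc/L1C_meas.
by move=> x; rewrite ger0_norm ?normc_ge0 ?normc_le.
Qed.

Lemma L1C_mul f g M : mC f -> L1C g -> (forall x, normc (f x) <= M) ->
  L1C (fun x => f x * g x).
Proof.
move=> mf lg fM; apply: (@L1C_le _ (fun x => M * normc (g x))).
- by apply: mCM => //; exact: L1C_meas.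
- by apply: L1Z; exact: L1C_norm.
- by move=> x; rewrite normcM ler_wpM2r ?normc_ge0.
Qed.

Lemma L1CD f g : L1C f -> L1C g -> L1C (fun x => f x + g x).
Proof.
move=> [a b] [c d]; split; under eq_fun do rewrite !reimE; exact: L1D.
Qed.

Lemma L1CZ c f : L1C f -> L1C (fun x => c * f x).
Proof.
move=> lf; apply: (@L1C_mul (fun=> c) _ (normc c)) => //.
Qed.

Lemma L1CN f : L1C f -> L1C (fun x => - f x).
Proof. by move=> /(L1CZ (-1)); under eq_fun do rewrite mulN1r. Qed.

Lemma L1CB f g : L1C f -> L1C g -> L1C (fun x => f x - g x).
Proof. by move=> lf /L1CN; exact: L1CD. Qed.

Lemma L1C_real h : L1 h -> L1C (fun x => (h x)%:C).
Proof.
move=> lh; apply: L1C_le (L1_norm lh) _.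
- by apply: mC_real; exact: L1_meas.
- by move=> x; rewrite normcR.
Qed.

Lemma CintD f g : L1C f -> L1C g -> Cint (fun x => f x + g x) = Cint f + Cint g.
Proof.
move=> [a b] [c d]; apply: Cext; rewrite !reimE -RintD//; congr Rint.
- by apply/funext => x; rewrite reD.
- by apply/funext => x; rewrite imD.
Qed.

Lemma CintZ c f : L1C f -> Cint (fun x => c * f x) = c * Cint f.
Proof.
move=> [a b]; apply: Cext; rewrite !reimE -!RintZ//.
- rewrite -RintB; try exact: L1Z.
  by congr Rint; apply/funext => x; rewrite reM.
- rewrite -RintD; try exact: L1Z.
  by congr Rint; apply/funext => x; rewrite imM.
Qed.

Lemma CintZr c f : L1C f -> Cint (fun x => f x * c) = Cint f * c.
Proof. by move=> lf; rewrite mulrC -CintZ//; congr Cint; apply/funext => x; rewrite mulrC. Qed.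

Lemma CintN f : L1C f -> Cint (fun x => - f x) = - Cint f.
Proof. by move=> lf; rewrite -mulN1r -CintZ//; congr Cint; apply/funext => x; rewrite mulN1r. Qed.

Lemma CintB f g : L1C f -> L1C g -> Cint (fun x => f x - g x) = Cint f - Cint g.
Proof. by move=> lf lg; rewrite CintD ?CintN//; exact: L1CN. Qed.

Lemma Cint_real h : Cint (fun x => (h x)%:C) = (Rint h)%:C.
Proof.
by apply: Cext; rewrite ?reimE//= /Rint /Rintegral integral0.
Qed.

Lemma Cint0 : Cint (fun=> 0) = 0.
Proof. by rewrite (Cint_real (fun=> 0)) /Rint /Rintegral integral0. Qed.

(** The real and imaginary parts are bounded separately, which costs the factor 2. It recurs in most
    constants below and is harmless there. *)
Lemma normc_Cint f : L1C f -> normc (Cint f) <= 2 * Rint (fun x => normc (f x)).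
Proof.
move=> lf; have [a b] := lf; have ln := L1C_norm lf.
rewrite (le_trans (normc_le _))// mulr_natl mulr2n lerD//.
- rewrite (le_trans (normr_Rint a))// le_Rint//; first exact: L1_norm.
  by move=> x; exact: normc_re.
- rewrite (le_trans (normr_Rint b))// le_Rint//; first exact: L1_norm.
  by move=> x; exact: normc_im.
Qed.

Lemma normc_Cint_le f h : mC f -> L1 h -> (forall x, normc (f x) <= h x) ->
  normc (Cint f) <= 2 * Rint h.
Proof.
move=> mf lh fh; have lf := L1C_le mf lh fh.
rewrite (le_trans (normc_Cint lf))// ler_wpM2l// le_Rint//.
exact: L1C_norm.
Qed.

Lemma L1C_affine a b f : 0 < b -> L1C f -> L1C (fun x => f (a + b * x)).
Proof. by move=> b0 [u v]; split; [exact: (L1_affine a b0 u)|exact: (L1_affine a b0 v)]. Qed.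

Lemma L1C_opp f : L1C f -> L1C (fun x => f (- x)).
Proof. by move=> [u v]; split; [exact: (L1_opp u)|exact: (L1_opp v)]. Qed.

Lemma Cint_affine a b f : 0 < b -> L1C f -> Cint f = b%:C * Cint (fun x => f (a + b * x)).
Proof.
move=> b0 [u v]; rewrite /Cint (Rint_affine a b0 u) (Rint_affine a b0 v).
by apply: Cext; rewrite !reimE; ring.
Qed.

Lemma Cint_opp f : L1C f -> Cint f = Cint (fun x => f (- x)).
Proof. by move=> [u v]; rewrite /Cint (Rint_opp u) (Rint_opp v). Qed.

(** Convergence is sequential and componentwise, the form in which dominated convergence delivers
    it; [cvgC_continuous] turns it back into continuity. *)
Definition cvgC (u : nat -> C) (l : C) :=
  (re (u n) @[n --> \oo] --> re l) /\ (im (u n) @[n --> \oo] --> im l).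

Lemma dominated_Cint (f_ : nat -> R -> C) f h :
  (forall n, mC (f_ n)) -> mC f -> L1 h ->
  (forall x, cvgC (f_^~ x) (f x)) ->
  (forall n x, normc (f_ n x) <= h x) ->
  L1C f /\ cvgC (fun n => Cint (f_ n)) (Cint f).
Proof.
move=> mf_ [a b] lh ff fh.
have [|||||r1 r2] := @dominated_Rint R (fun n x => re (f_ n x)) (fun x => re (f x)) h.
- by move=> n; have [] := mf_ n.
- exact: a.
- exact: lh.
- by move=> x; have [] := ff x.
- by move=> n x; exact: le_trans (normc_re _) (fh n x).
have [|||||i1 i2] := @dominated_Rint R (fun n x => im (f_ n x)) (fun x => im (f x)) h.
- by move=> n; have [] := mf_ n.
- exact: b.
- exact: lh.
- by move=> x; have [] := ff x.
- by move=> n x; exact: le_trans (normc_im _) (fh n x).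
by split; split.
Qed.

Lemma cvgC_unique u l l' : cvgC u l -> cvgC u l' -> l = l'.
Proof.
move=> [a b] [c d]; apply: Cext; [exact: cvg_unique a c|exact: cvg_unique b d].
Qed.

Lemma cvgC_cst l : cvgC (fun=> l) l.
Proof. by split; exact: cvg_cst. Qed.

Lemma cvgCD u v l m : cvgC u l -> cvgC v m -> cvgC (fun n => u n + v n) (l + m).
Proof.
by move=> [a b] [c d]; split; rewrite !reimE; under eq_fun do rewrite !reimE; exact: cvgD.
Qed.

Lemma cvgCM u v l m : cvgC u l -> cvgC v m -> cvgC (fun n => u n * v n) (l * m).
Proof.
move=> [a b] [c d]; split; rewrite !reimE; under eq_fun do rewrite !reimE.
  by apply: cvgB; apply: cvgM.
by apply: cvgD; apply: cvgM.
Qed.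

Lemma cvgCV u l : l != 0 -> cvgC u l -> cvgC (fun n => (u n)^-1) l^-1.
Proof.
move=> l0 [a b].
have n0 : re l ^+ 2 + im l ^+ 2 != 0.
  by rewrite -sqr_normc expf_neq0//; apply: contra_neq l0; exact: normc_eq0.
have cN : (re (u n) ^+ 2 + im (u n) ^+ 2)^-1 @[n --> \oo] --> (re l ^+ 2 + im l ^+ 2)^-1.
  apply: cvgV => //; rewrite !expr2.
  by apply: cvgD; apply: cvgM.
split.
- by rewrite reV; under eq_fun do rewrite reV; exact: cvgM.
- by rewrite imV; under eq_fun do rewrite imV; apply: cvgN; exact: cvgM.
Qed.

Lemma cvgC_real (u : nat -> R) (l : R) : u n @[n --> \oo] --> l ->
  cvgC (fun n => (u n)%:C) l%:C.
Proof. by move=> ul; split => //; exact: cvg_cst. Qed.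

Lemma cvgC_cis (u : nat -> R) (l : R) : u n @[n --> \oo] --> l ->
  cvgC (fun n => cis (u n)) (cis l).
Proof.
by move=> ul; split; apply: continuous_cvg ul; [exact: continuous_cos|exact: continuous_sin].
Qed.

Lemma cvgC_cexp u l : cvgC u l -> cvgC (fun n => cexp (u n)) (cexp l).
Proof.
move=> [a b]; apply: cvgCM; last exact: cvgC_cis.
by apply: cvgC_real; apply: continuous_cvg a; exact: continuous_expR.
Qed.

End ComplexIntegral.

(** * Exchange of integrals *)

Section Fubini.
Variable R : realType.
Local Notation mu := (@lebesgue_measure R).
Local Notation C := R[i].

(** An integrable function is finite almost everywhere, so [fine] changes it on a null set only.
    This brings the partial integrals of Fubini's theorem back to real values. *)
Lemma L1_fine (F : R -> \bar R) : mu.-integrable setT F ->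
  L1 (fun x => fine (F x)) /\ (\int[mu]_x F x)%E = (Rint (fun x => fine (F x)))%:E.
Proof.
move=> iF; have mF := measurable_int _ iF.
have lF : L1 (fun x => fine (F x)).
  apply: (le_integrable measurableT _ _ iF) => //.
    apply/measurable_EFinP; apply: (measurableT_comp _ mF).
    by apply: fine_measurable.
  by move=> x _ /=; case: (F x) => [r||] //=; rewrite normr0 leey.
split => //; rewrite -RintE//; apply: ae_eq_integral => //.
- by apply/measurable_EFinP; exact: L1_meas.
- have := integrable_ae measurableT iF; apply: filterS => x h _.
  by rewrite fineK// h.
Qed.

Lemma fubini_Rint (K : R -> R -> R) (u : R -> R) :
  measurable_fun setT (fun z : R * R => K z.1 z.2) -> L1 u ->
  (forall x, (\int[mu]_y `|K x y|%:E <= (u x)%:E)%E) ->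
  [/\ L1 (fun x => Rint (K x)), L1 (fun y => Rint (K^~ y)) &
    Rint (fun x => Rint (K x)) = Rint (fun y => Rint (K^~ y))].
Proof.
move=> mK lu Ku.
pose f := fun z : measurableTypeR R * measurableTypeR R => (K z.1 z.2)%:E.
have mf : measurable_fun setT f by apply/measurable_EFinP.
have intf : (mu \x mu)%E.-integrable setT f.
  apply/(integrable12ltyP mu mu mf) => /=.
  apply: (@le_lt_trans _ _ (\int[mu]_x (u x)%:E)%E).
    apply: ge0_le_integral => //=.
    - by move=> x _; exact: integral_ge0.
    - apply: (@measurable_fun_fubini_tonelli_F _ _ (measurableTypeR R) (measurableTypeR R) R mu (abse \o f)) => //=.
      by apply: measurableT_comp => //.
    - by apply/measurable_EFinP; exact: L1_meas.
  by rewrite (RintE lu); exact: ltry.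
have [l1 e1] := L1_fine (integrable_fubini_F intf).
have mfy y : measurable_fun setT (fun x => f (x, y)).
  have h : measurable_fun setT (fun x : measurableTypeR R => (x, y : measurableTypeR R)) by [].
  exact: (measurableT_comp mf h).
have iG : mu.-integrable setT (fubini_G mu f).
  apply/integrableP; split; first exact: (measurable_fubini_G intf).
  move/(integrable21ltyP mu mu mf) : (intf); apply: le_lt_trans.
  apply: ge0_le_integral => //=.
  - by apply: measurableT_comp => //; exact: (measurable_fubini_G intf).
  - apply: (@measurable_fun_fubini_tonelli_G _ _ (measurableTypeR R) (measurableTypeR R) R mu (abse \o f)) => //=.
    by apply: measurableT_comp => //.
  - by move=> y _; apply: le_abse_integral => //.
have [l2 e2] := L1_fine iG.
split; [exact: l1|exact: l2|].
by apply: EFin_inj; rewrite -e1 -e2; exact: Fubini intf.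
Qed.

Lemma fubini_Cint (k : R -> R -> C) (u : R -> R) :
  mC (fun z : R * R => k z.1 z.2) -> L1 u ->
  (forall x, (\int[mu]_y (normc (k x y))%:E <= (u x)%:E)%E) ->
  [/\ L1C (fun x => Cint (k x)), L1C (fun y => Cint (k^~ y)) &
    Cint (fun x => Cint (k x)) = Cint (fun y => Cint (k^~ y))].
Proof.
move=> mk lu ku; have [mr mi] := mk.
have mkx x : mC (k x).
  have h : measurable_fun setT (fun y : R => (x, y)) by apply: measurable_fun_pair.
  by split; [exact: (measurableT_comp mr h)|exact: (measurableT_comp mi h)].
have [|r1 r2 r3] := @fubini_Rint (fun x y => re (k x y)) u mr lu.
  move=> x; apply: le_trans (ku x); apply: ge0_le_integral => //=.
  - by apply/measurable_EFinP; apply: (measurableT_comp (@normr_measurable R setT)); case: (mkx x).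
  - by apply/measurable_EFinP; exact: (m_normc (mkx x)).
  - by move=> y _; rewrite lee_fin normc_re.
have [|i1 i2 i3] := @fubini_Rint (fun x y => im (k x y)) u mi lu.
  move=> x; apply: le_trans (ku x); apply: ge0_le_integral => //=.
  - by apply/measurable_EFinP; apply: (measurableT_comp (@normr_measurable R setT)); case: (mkx x).
  - by apply/measurable_EFinP; exact: (m_normc (mkx x)).
  - by move=> y _; rewrite lee_fin normc_im.
split; [split; [exact: r1|exact: i1]|split; [exact: r2|exact: i2]|].
by apply: Cext; [exact: r3|exact: i3].
Qed.

Lemma fubini_Cint_prod (k : R -> R -> C) (u v : R -> R) :
  mC (fun z : R * R => k z.1 z.2) -> L1 u -> L1 v ->
  (forall x y, normc (k x y) <= u x * v y) ->
  [/\ L1C (fun x => Cint (k x)), L1C (fun y => Cint (k^~ y)) &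
    Cint (fun x => Cint (k x)) = Cint (fun y => Cint (k^~ y))].
Proof.
move=> mk lu lv kuv; have [mr mi] := mk.
have mkx x : mC (k x).
  have h : measurable_fun setT (fun y : R => (x, y)) by apply: measurable_fun_pair.
  by split; [exact: (measurableT_comp mr h)|exact: (measurableT_comp mi h)].
apply: (@fubini_Cint k (fun x => Rint v * u x)) => //; first exact: L1Z.
move=> x; rewrite mulrC -RintZ// -RintE; last exact: L1Z.
apply: ge0_le_integral => //=.
- by move=> y _; rewrite lee_fin normc_ge0.
- by apply/measurable_EFinP; exact: (m_normc (mkx x)).
- by apply/measurable_EFinP; apply: L1_meas (L1Z (u x) lv).
- by move=> y _; rewrite lee_fin.
Qed.

End Fubini.

(** * Derivatives of real functions *)

Section RealDerivatives.
Variable R : realType.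
Implicit Types (f g : R -> R) (x a b : R).

Definition der1 f x a := is_derive x (1:R) f a.

Lemma der1_eq f x a b : der1 f x a -> a = b -> der1 f x b.
Proof. by move=> h <-. Qed.

Lemma der1_id x : der1 (fun y => y) x 1.
Proof. exact: is_derive_id. Qed.

Lemma der1_cst c x : der1 (fun=> c) x 0.
Proof. exact: is_derive_cst. Qed.

Lemma der1D f g x a b : der1 f x a -> der1 g x b -> der1 (fun y => f y + g y) x (a + b).
Proof. exact: is_deriveD. Qed.

Lemma der1N f x a : der1 f x a -> der1 (fun y => - f y) x (- a).
Proof. exact: is_deriveN. Qed.

Lemma der1B f g x a b : der1 f x a -> der1 g x b -> der1 (fun y => f y - g y) x (a - b).
Proof. by move=> h /der1N; exact: der1D. Qed.

Lemma der1M f g x a b : der1 f x a -> der1 g x b ->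
  der1 (fun y => f y * g y) x (a * g x + f x * b).
Proof.
move=> h k; have := is_deriveM h k => /der1_eq; apply.
by rewrite /GRing.scale/= addrC [g x * a]mulrC.
Qed.

Lemma der1_comp f g x a b : der1 f (g x) a -> der1 g x b -> der1 (fun y => f (g y)) x (a * b).
Proof. by move=> h k; exact: (is_derive1_comp h k). Qed.

Lemma der1_exp f x a : der1 f x a -> der1 (fun y => expR (f y)) x (expR (f x) * a).
Proof. by apply: der1_comp; exact: is_derive_expR. Qed.

Lemma der1_cos f x a : der1 f x a -> der1 (fun y => cos (f y)) x (- sin (f x) * a).
Proof. by apply: der1_comp; exact: is_derive_cos. Qed.

Lemma der1_sin f x a : der1 f x a -> der1 (fun y => sin (f y)) x (cos (f x) * a).
Proof. by apply: der1_comp; exact: is_derive_sin. Qed.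

Lemma der1_inv f x a : f x != 0 -> der1 f x a -> der1 (fun y => (f y)^-1) x (- a / f x ^+ 2).
Proof.
move=> f0 h; have := is_deriveV f0 h => /der1_eq; apply.
by rewrite /GRing.scale/=; field.
Qed.

Lemma der1_ln f x a : 0 < f x -> der1 f x a -> der1 (fun y => ln (f y)) x (a / f x).
Proof.
move=> f0 h; rewrite mulrC.
by apply: der1_comp h; exact: is_derive1_ln.
Qed.

Lemma der1_atan f x a : der1 f x a -> der1 (fun y => atan (f y)) x (a / (1 + f x ^+ 2)).
Proof.
move=> h; rewrite mulrC.
by apply: der1_comp h; exact: is_derive1_atan.
Qed.

Lemma der1_continuous f df : (forall x, der1 f x (df x)) -> continuous f.
Proof. by move=> h x; apply/differentiable_continuous/derivable1_diffP; have [] := h x. Qed.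

End RealDerivatives.

Ltac der1 := repeat first
  [ apply: der1_cst | apply: der1_id | apply: der1B | apply: der1D | apply: der1N
  | apply: der1M | apply: der1_exp | apply: der1_cos | apply: der1_sin ].

(** * Fundamental theorem of calculus on unbounded sets *)

Section ImproperIntegrals.
Variable R : realType.
Local Notation mu := (@lebesgue_measure R).
Implicit Types (f g : R -> R) (D : set R).

Lemma indic_in D x : D x -> \1_D x = 1 :> R.
Proof. by move=> Dx; rewrite indicE mem_set. Qed.

Lemma indic_out D x : ~ D x -> \1_D x = 0 :> R.
Proof. by move=> Dx; rewrite indicE memNset. Qed.

Lemma indic_le1 D x : `|\1_D x| <= 1 :> R.
Proof. by rewrite indicE; case: (_ \in _); rewrite ?normr1 ?normr0. Qed.

Lemma indic_ge0 D x : 0 <= \1_D x :> R.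
Proof. by rewrite indicE; case: (_ \in _). Qed.

Lemma Rint_indic D f : Rint (fun x => \1_D x * f x) = \int[mu]_(x in D) f x.
Proof.
rewrite Rintegral_mkcond; congr Rint; apply/funext => x.
by rewrite patchE indicE; case: (x \in D); rewrite ?mul1r ?mul0r.
Qed.

Lemma integral_indic_mul D (f : R -> R) :
  (\int[mu]_(x in D) (f x)%:E = \int[mu]_x (\1_D x * f x)%:E)%E.
Proof.
rewrite integral_mkcond; apply: eq_integral => x _.
by rewrite patchE indicE; case: (x \in D); rewrite ?mul1r ?mul0r.
Qed.

Lemma L1_indic D f : measurable D -> L1 f -> L1 (fun x => \1_D x * f x).
Proof.
move=> mD lf; apply: L1_le (L1_norm lf).
  by apply: measurable_funM; [exact: measurable_indic|exact: L1_meas].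
by move=> x; rewrite normrM ler_piMl// indic_le1.
Qed.

Lemma L1_indicP D f : measurable D -> measurable_fun setT f ->
  (\int[mu]_(x in D) `|f x|%:E < +oo)%E -> L1 (fun x => \1_D x * f x).
Proof.
move=> mD mf h; apply/L1P.
  by apply: measurable_funM => //; exact: measurable_indic.
apply: le_lt_trans h; rewrite [leRHS]integral_indic_mul.
rewrite le_eqVlt; apply/orP; left; apply/eqP; apply: eq_integral => x _.
rewrite normrM ger0_norm//; exact: indic_ge0.
Qed.

(** The segments exhaust [D], and the integrals over them converge by dominated convergence, with
    [dg] restricted to [D] as its own majorant. Half line and full line are both instances. *)
Lemma FTC_lim g dg D (a b : nat -> R) l :
  measurable D -> (forall n, a n < b n) ->
  (forall x, der1 g x (dg x)) -> continuous dg ->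
  L1 (fun x => \1_D x * dg x) ->
  (forall n, `[a n, b n] `<=` D) ->
  (forall x, D x -> \forall n \near \oo, x \in `[a n, b n]) ->
  (g (b n) - g (a n)) @[n --> \oo] --> l ->
  Rint (fun x => \1_D x * dg x) = l.
Proof.
move=> mD ab gdg cdg lD abD Dab gl.
have mdg : measurable_fun setT dg by exact: continuous_measurable_fun.
have [|||||_ h] := @dominated_Rint R (fun n x => \1_(`[a n, b n]) x * dg x)
   (fun x => \1_D x * dg x) (fun x => `|\1_D x * dg x|).
- by move=> n; apply: measurable_funM => //; exact: measurable_indic.
- exact: L1_meas.
- exact: L1_norm.
- move=> x; have [Dx|nDx] := pselect (D x).
    apply: cvg_near_cst; have := Dab _ Dx; apply: filterS => n xn.
    by rewrite (indic_in Dx) indic_in.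
  rewrite (indic_out nDx) mul0r; apply: cvg_near_cst; apply: nearW => n.
  by rewrite indic_out ?mul0r// => /abD.
- move=> n x; rewrite !normrM ler_wpM2r//.
  have [abx|nabx] := pselect (`[a n, b n]%classic x).
    by rewrite (indic_in abx) (indic_in (abD _ _ abx)).
  by rewrite (indic_out nabx) normr0.
have e n : Rint (fun x => \1_(`[a n, b n]) x * dg x) = g (b n) - g (a n).
  rewrite Rint_indic /Rintegral (@continuous_FTC2 R dg g)//.
  - by apply: continuous_subspaceT.
  - split.
    + by move=> x _; have [] := gdg x.
    + apply: cvg_at_right_filter; apply: differentiable_continuous.
      by apply/derivable1_diffP; have [] := gdg (a n).
    + apply: cvg_at_left_filter; apply: differentiable_continuous.
      by apply/derivable1_diffP; have [] := gdg (b n).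
  - by move=> x _; rewrite derive1E; have [] := gdg x.
move: h; under eq_fun do rewrite e; move=> h.
exact: (cvg_unique _ h gl).
Qed.

Lemma near_natS_ge (A : R) : \forall n \near \oo, A <= n.+1%:R.
Proof.
have := @nbhs_infty_ger R A; apply: filterS => n h.
by rewrite (le_trans h)// ler_nat.
Qed.

Lemma cvg_natSr : (n.+1%:R : R) @[n --> \oo] --> +oo.
Proof. by apply/cvgryPge => A; exact: near_natS_ge. Qed.

Lemma cvg_natSV : (n.+1%:R^-1 : R) @[n --> \oo] --> 0.
Proof. by apply/gtr0_cvgV0; [exact: nearW|exact: cvg_natSr]. Qed.

Lemma FTC_halfline g dg l :
  (forall x, der1 g x (dg x)) -> continuous dg ->
  L1 (fun x => \1_(`[0, +oo[%classic : set R) x * dg x) -> g x @[x --> +oo] --> l ->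
  Rint (fun x => \1_(`[0, +oo[%classic : set R) x * dg x) = l - g 0.
Proof.
move=> gdg cdg ldg gl.
apply: (@FTC_lim g dg _ (fun=> 0) (fun n => n.+1%:R)) => //.
- by move=> n x /=; rewrite !in_itv/= andbT => /andP[].
- move=> x /=; rewrite in_itv/= andbT => x0.
  near=> n; rewrite in_itv/= x0/=; near: n.
  exact: near_natS_ge.
- apply: cvgB; last exact: cvg_cst.
  exact: (cvg_comp (fun n => n.+1%:R) g cvg_natSr gl).
Unshelve. all: by end_near. Qed.

Lemma FTC_line g dg : 
  (forall x, der1 g x (dg x)) -> continuous dg ->
  L1 dg -> g x @[x --> +oo] --> 0 -> g x @[x --> -oo] --> 0 ->
  Rint dg = 0.
Proof.
move=> gdg cdg ldg gy gNy.
rewrite -[LHS](_ : Rint (fun x => \1_(setT : set R) x * dg x) = _); last first.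
  by congr Rint; apply/funext => x; rewrite indic_in// mul1r.
apply: (@FTC_lim g dg _ (fun n => - n.+1%:R) (fun n => n.+1%:R)) => //.
- by move=> n; rewrite -subr_gt0 opprK addr_gt0.
- by apply: L1_indic.
- move=> x _; near=> n; rewrite in_itv/= -ler_norml; near: n.
  exact: near_natS_ge.
- have sn : (n.+1%:R : R) @[n --> \oo] --> +oo.
    exact: cvg_natSr.
  rewrite -[X in _ --> X](subrr 0); apply: cvgB.
    exact: (cvg_comp (fun n => n.+1%:R) g sn gy).
  apply: (cvg_comp (fun n => - n.+1%:R) g); last exact: gNy.
  exact/cvgNrNy.
Unshelve. all: by end_near. Qed.

End ImproperIntegrals.

(** * Poisson kernel and Poisson extension *)

Section Kernels.
Variable R : realType.
Local Notation mu := (@lebesgue_measure R).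
Local Notation C := R[i].
Local Notation pos := (`[0, +oo[%classic : set R).

Lemma cvg_expRN (s : R) : 0 < s -> expR (- (s * x)) @[x --> +oo] --> (0 : R).
Proof.
move=> s0; apply: (cvg_comp (fun x : R => s * x) (fun y => expR (- y))); last exact: cvgr_expR.
apply/cvgryPge => A; near=> x; rewrite -ler_pdivrMl//.
Unshelve. all: by end_near. Qed.

Lemma L1_expN (s : R) : 0 < s -> L1 (fun p => \1_pos p * expR (- (s * p))).
Proof.
move=> s0.
have cF : continuous (fun p : R => expR (- (s * p))).
  by apply: der1_continuous => p; der1.
have dF x : der1 (fun p => - s^-1 * expR (- (s * p))) x (expR (- (s * x))).
  apply: der1_eq; first by der1.
  by rewrite /=; field; rewrite gt_eqF.
apply: L1_indicP => //; first exact: continuous_measurable_fun.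
under eq_integral do rewrite ger0_norm ?expR_ge0//.
rewrite (@ge0_continuous_FTC2y R _ (fun p => - s^-1 * expR (- (s * p))) 0 0) ?ltry//.
- exact: continuous_subspaceT.
- by rewrite -(mulr0 (- s^-1)); apply: cvgM; [exact: cvg_cst|exact: cvg_expRN].
- apply: cvg_at_right_filter; apply: cvgM; [exact: cvg_cst|exact: cF].
- by move=> x _; rewrite derive1E; have [] := dF x.
Qed.

Lemma L1_expN_abs (s : R) : 0 < s -> L1 (fun p => expR (- (s * `|p|))).
Proof.
move=> s0; have l := L1_expN s0.
apply: L1_le (L1D l (L1_opp l)).
  apply: (measurableT_comp (@measurable_expR R)); apply: (measurableT_comp (@oppr_measurable R setT)).
  by apply: measurable_funM => //; exact: normr_measurable.
move=> x; rewrite ger0_norm ?expR_ge0//.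
have [x0|/ltW x0] := leP 0 x.
  have -> : \1_pos x = 1 :> R by apply: indic_in; rewrite /= in_itv/= x0.
  by rewrite ger0_norm// mul1r lerDl mulr_ge0 ?indic_ge0 ?expR_ge0.
have -> : \1_pos (- x) = 1 :> R by apply: indic_in; rewrite /= in_itv/= oppr_ge0 x0.
by rewrite ler0_norm// mul1r lerDr mulr_ge0 ?indic_ge0 ?expR_ge0.
Qed.

Lemma Cint_halfline (s x : R) : 0 < s ->
  Cint (fun p => (\1_pos p * expR (- (s * p)))%:C * cis (x * p)) = (s%:C - 'i%C * x%:C)^-1.
Proof.
move=> s0.
have n0 : s ^+ 2 + x ^+ 2 != 0.
  by rewrite gt_eqF// ltr_wpDr ?sqr_ge0// exprn_gt0.
have l := L1_expN s0.
have cE : continuous (fun p : R => expR (- (s * p))) by apply: der1_continuous => p; der1.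
have cC : continuous (fun p : R => cos (x * p)) by apply: der1_continuous => p; der1.
have cS : continuous (fun p : R => sin (x * p)) by apply: der1_continuous => p; der1.
have bnd (h : R -> R) : (forall p, `|h p| <= `|s| + `|x|) ->
    expR (- (s * p)) * (h p / (s ^+ 2 + x ^+ 2)) @[p --> +oo] --> (0 : R).
  move=> hb.
  apply: (@squeeze_cvgr _ _ _ _ (fun p => - (expR (- (s * p)) * ((`|s| + `|x|) / (s ^+ 2 + x ^+ 2))))
     (fun p => expR (- (s * p)) * ((`|s| + `|x|) / (s ^+ 2 + x ^+ 2)))).
  - apply: nearW => p; rewrite -ler_norml normrM (ger0_norm (expR_ge0 _)).
    rewrite ler_wpM2l ?expR_ge0// normrM ler_pM// ger0_norm// invr_ge0 addr_ge0 ?sqr_ge0//.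
  - rewrite -oppr0 -(mul0r ((`|s| + `|x|) / (s ^+ 2 + x ^+ 2))).
    by apply: cvgN; apply: cvgM; [exact: cvg_expRN|exact: cvg_cst].
  - rewrite -(mul0r ((`|s| + `|x|) / (s ^+ 2 + x ^+ 2))).
    by apply: cvgM; [exact: cvg_expRN|exact: cvg_cst].
apply: Cext; rewrite ?reV ?imV !reimE.
- rewrite (_ : (fun p => _) = (fun p => \1_pos p * (expR (- (s * p)) * cos (x * p)))); last first.
    by apply/funext => p; rewrite !reimE; ring.
  (* The primitive is the real part of exp ((- s + i x) p) / (- s + i x); its imaginary part serves
     for the other component. *)
  rewrite (@FTC_halfline R (fun p => expR (- (s * p)) * ((- s * cos (x * p) + x * sin (x * p)) / (s ^+ 2 + x ^+ 2))) _ 0).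
  + rewrite !(mulr0,mul0r,mul1r,subr0,sub0r,addr0,add0r) oppr0 expR0 cos0 sin0 ?subr0 ?sqrrN.
    by field.
  + move=> p.
    apply: der1_eq; first by der1.
    by rewrite /=; field.
  + by move=> p; apply: cvgM; [exact: cE|exact: cC].
  + apply: L1_le (l).
      apply: measurable_funM; first exact: measurable_indic.
      by apply: measurable_funM => //; exact: continuous_measurable_fun.
    move=> p; rewrite mulrA normrM ger0_norm ?mulr_ge0 ?indic_ge0 ?expR_ge0// ler_piMr ?mulr_ge0 ?indic_ge0 ?expR_ge0//.
    exact: cos_max.
  + apply: bnd => p; rewrite (le_trans (ler_normD _ _))// !normrM normrN.
    by rewrite lerD// ler_piMr// ?cos_max ?sin_max.
- rewrite (_ : (fun p => _) = (fun p => \1_pos p * (expR (- (s * p)) * sin (x * p)))); last first.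
    by apply/funext => p; rewrite !reimE; ring.
  rewrite (@FTC_halfline R (fun p => expR (- (s * p)) * ((- s * sin (x * p) - x * cos (x * p)) / (s ^+ 2 + x ^+ 2))) _ 0).
  + rewrite !(mulr0,mul0r,mul1r,subr0,sub0r,addr0,add0r) oppr0 expR0 cos0 sin0 ?subr0 ?sqrrN.
    by field.
  + move=> p.
    apply: der1_eq; first by der1.
    by rewrite /=; field.
  + by move=> p; apply: cvgM; [exact: cE|exact: cS].
  + apply: L1_le (l).
      apply: measurable_funM; first exact: measurable_indic.
      by apply: measurable_funM => //; exact: continuous_measurable_fun.
    move=> p; rewrite mulrA normrM ger0_norm ?mulr_ge0 ?indic_ge0 ?expR_ge0// ler_piMr ?mulr_ge0 ?indic_ge0 ?expR_ge0//.
    exact: sin_max.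
  + apply: bnd => p; rewrite (le_trans (ler_normB _ _))// !normrM normrN.
    by rewrite lerD// ler_piMr// ?cos_max ?sin_max.
Qed.

Definition poisson (s x : R) : R := s / (pi * (s ^+ 2 + x ^+ 2)).

Lemma poisson_gt0 (s x : R) : 0 < s -> 0 < poisson s x.
Proof.
move=> s0; apply: divr_gt0 => //; apply: mulr_gt0; first exact: pi_gt0.
by rewrite ltr_wpDr ?sqr_ge0// exprn_gt0.
Qed.

Lemma poisson_ge0 (s x : R) : 0 < s -> 0 <= poisson s x.
Proof. by move=> s0; exact/ltW/poisson_gt0. Qed.

Lemma le_poisson0 (s x : R) : 0 < s -> poisson s x <= poisson s 0.
Proof.
move=> s0; apply: ler_wpM2l; first exact: ltW.
have a0 : 0 < s ^+ 2 by rewrite exprn_gt0.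
have b0 : 0 <= x ^+ 2 by rewrite sqr_ge0.
rewrite lef_pV2 ?posrE.
- by apply: ler_wpM2l; [exact: pi_ge0|rewrite expr0n addr0 lerDl].
- by apply: mulr_gt0; [exact: pi_gt0|lra].
- by apply: mulr_gt0; [exact: pi_gt0|rewrite expr0n addr0].
Qed.

Lemma measurable_poisson (s : R) : measurable_fun setT (poisson s).
Proof.
apply: measurable_funM => //; apply: (measurableT_comp (@measurable_inv R)).
by apply: measurable_funM => //; apply: measurable_funD => //; exact: exprn_measurable.
Qed.

Lemma poisson1_int : L1 (poisson 1) /\ Rint (poisson 1) = 1.
Proof.
have H : (\int[mu]_x (poisson 1 x)%:E = 1%:E)%E.
  transitivity (\int[mu]_x ((pi^-1)%:E * ((oneDsqr x)^-1)%:E))%E.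
    apply: eq_integral => x _; rewrite -EFinM; congr EFin.
    by rewrite /poisson /oneDsqr expr1n invfM mul1r.
  have co : continuous (fun x : R => (oneDsqr x)^-1) by exact: continuous_oneDsqrV.
  have o0 (x : R) : 0 <= (oneDsqr x)^-1 by rewrite invr_ge0 (le_trans ler01)// oneDsqr_ge1.
  rewrite ge0_integralZl//.
  - rewrite ge0_symfun_integralT//; last by move=> x; rewrite /= /oneDsqr sqrrN.
    rewrite (_ : [set x : R | 0 <= x] = pos); last first.
      by apply/seteqP; split => x /=; rewrite in_itv/= andbT.
    rewrite integral0y_oneDsqr -!EFinM; congr EFin.
    by rewrite mulrC (mulrC 2) divfK// divff// gt_eqF ?pi_gt0.
  - by apply/measurable_EFinP; exact: continuous_measurable_fun.
  - by rewrite lee_fin invr_ge0 pi_ge0.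
have l : L1 (poisson 1).
  apply/L1P; first exact: measurable_poisson.
  under eq_integral do rewrite ger0_norm ?poisson_ge0//.
  by rewrite H ltry.
by split => //; apply: EFin_inj; rewrite -RintE.
Qed.

Lemma poisson_scale (s x : R) : 0 < s -> s * poisson s (s * x) = poisson 1 x.
Proof.
move=> s0; rewrite /poisson.
have p0 : (pi : R) != 0 by rewrite gt_eqF ?pi_gt0.
have x0 : 1 + x ^+ 2 != 0 by rewrite gt_eqF// ltr_wpDr// sqr_ge0.
have -> : s ^+ 2 + (s * x) ^+ 2 = s ^+ 2 * (1 + x ^+ 2) by ring.
rewrite expr1n; move: (pi) p0 => q q0; field.
by rewrite q0 x0 gt_eqF.
Qed.

Lemma twopi_gt0 : 0 < 2 * pi :> R.
Proof. by rewrite mulr_gt0// pi_gt0. Qed.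

Lemma sDi_neq0 (s x : R) : 0 < s -> s%:C + 'i%C * x%:C != 0 :> C.
Proof.
move=> s0; apply/eqP => /(congr1 (@re R)); rewrite !reimE.
by rewrite mul0r mulr0 subr0 addr0 => /eqP; rewrite gt_eqF.
Qed.

Lemma sBi_neq0 (s x : R) : 0 < s -> s%:C - 'i%C * x%:C != 0 :> C.
Proof. by move=> s0; rewrite -mulrN -rmorphN; exact: sDi_neq0. Qed.

(** With x = y - t the two terms are, up to factors i and - i, the Cauchy kernels at y + i s and at
    the conjugate point y - i s. *)
Lemma poissonE (s x : R) : 0 < s ->
  (poisson s x)%:C = ((2 * pi)^-1)%:C * ((s%:C - 'i%C * x%:C)^-1 + (s%:C + 'i%C * x%:C)^-1).
Proof.
move=> s0.
have p0 : (pi : R) != 0 by rewrite gt_eqF ?pi_gt0.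
have n0 : s ^+ 2 + x ^+ 2 != 0 by rewrite gt_eqF// ltr_wpDr ?sqr_ge0// exprn_gt0.
rewrite /poisson; move: (pi) p0 => q q0.
apply: Cext; rewrite !(reM,imM,reD,imD,reN,imN,reV,imV) !reimE
   !(mul0r,mulr0,mul1r,subr0,sub0r,addr0,add0r,oppr0,sqrrN).
- by field; rewrite n0.
- by ring.
Qed.

Lemma inv_sqrD_poisson (u x : R) : 0 < u -> (u ^+ 2 + x ^+ 2)^-1 = (pi / u) * poisson u x.
Proof.
move=> u0; rewrite /poisson.
have p0 : (pi : R) != 0 by rewrite gt_eqF ?pi_gt0.
have n0 : u ^+ 2 + x ^+ 2 != 0 by rewrite gt_eqF// ltr_wpDr ?sqr_ge0// exprn_gt0.
move: (pi) p0 => q q0; field.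
by rewrite n0 q0 gt_eqF.
Qed.

End Kernels.
#[global] Opaque poisson.

(** * Complex-valued functions of a real variable: derivatives *)

Section ComplexDerivatives.
Variable R : realType.
Local Notation C := R[i].
Implicit Types (f g : R -> C) (x : R) (a b : C).

Definition cder f x a := der1 (fun y => re (f y)) x (re a) /\ der1 (fun y => im (f y)) x (im a).

Lemma cder_eq f x a b : cder f x a -> a = b -> cder f x b.
Proof. by move=> h <-. Qed.

Lemma cder_cst c x : cder (fun=> c) x 0.
Proof. by split; exact: der1_cst. Qed.

Lemma cder_real (h : R -> R) x (d : R) : der1 h x d -> cder (fun y => (h y)%:C) x d%:C.
Proof. by move=> hd; split; [exact: hd|exact: der1_cst]. Qed.

Lemma cderD f g x a b : cder f x a -> cder g x b -> cder (fun y => f y + g y) x (a + b).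
Proof.
by move=> [fa fa'] [gb gb']; split; under eq_fun do rewrite !reimE; rewrite !reimE; exact: der1D.
Qed.

Lemma cderN f x a : cder f x a -> cder (fun y => - f y) x (- a).
Proof.
by move=> [fa fa']; split; under eq_fun do rewrite !reimE; rewrite !reimE; exact: der1N.
Qed.

Lemma cderB f g x a b : cder f x a -> cder g x b -> cder (fun y => f y - g y) x (a - b).
Proof. by move=> h /cderN; exact: cderD. Qed.

Lemma cderM f g x a b : cder f x a -> cder g x b ->
  cder (fun y => f y * g y) x (a * g x + f x * b).
Proof.
move=> [fa fa'] [gb gb']; split; under eq_fun do rewrite !reimE.
  apply: der1_eq; first by apply: der1B; apply: der1M; eassumption.
  by rewrite !reimE /=; ring.
apply: der1_eq; first by apply: der1D; apply: der1M; eassumption.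
by rewrite !reimE /=; ring.
Qed.

Lemma cder_cexp f x a : cder f x a -> cder (fun y => cexp (f y)) x (cexp (f x) * a).
Proof.
move=> [fa fa']; split; under eq_fun do rewrite /cexp !reimE.
  apply: der1_eq; first by apply: der1B; apply: der1M; first [apply: der1_cst|apply: der1_exp; eassumption| apply: der1_cos; eassumption|apply: der1_sin; eassumption].
  by rewrite /cexp !reimE /=; ring.
apply: der1_eq; first by apply: der1D; apply: der1M; first [apply: der1_cst|apply: der1_exp; eassumption| apply: der1_cos; eassumption|apply: der1_sin; eassumption].
by rewrite /cexp !reimE /=; ring.
Qed.

Lemma normc_sqr_neq0 (z : C) : z != 0 -> re z ^+ 2 + im z ^+ 2 != 0.
Proof.
by move=> z0; rewrite -sqr_normc expf_neq0//; apply: contra_neq z0; exact: normc_eq0.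
Qed.

Lemma cder_inv f x a : f x != 0 -> cder f x a -> cder (fun y => (f y)^-1) x (- a / f x ^+ 2).
Proof.
move=> f0 [fa fa']; have n0 := normc_sqr_neq0 f0.
have dN : der1 (fun y => (re (f y) * re (f y) + im (f y) * im (f y))^-1) x
   (- (re a * re (f x) + re (f x) * re a + (im a * im (f x) + im (f x) * im a))
     / (re (f x) * re (f x) + im (f x) * im (f x)) ^+ 2).
  by apply: der1_inv; [rewrite -!expr2|apply: der1D; apply: der1M].
split.
- under eq_fun do rewrite reV !expr2.
  apply: der1_eq; first by apply: der1M; eassumption.
  rewrite !expr2 in n0 *; rewrite /= !(reM,reV,imV,reN,imN,imM).
  field; rewrite n0/=.
  rewrite (_ : _ + _ = (re (f x) * re (f x) + im (f x) * im (f x)) ^+ 2); last by ring.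
  by rewrite expf_neq0.
- under eq_fun do rewrite imV !expr2.
  apply: der1_eq; first by apply: der1N; apply: der1M; eassumption.
  rewrite !expr2 in n0 *; rewrite /= !(reM,reV,imV,reN,imN,imM).
  field; rewrite n0/=.
  rewrite (_ : _ + _ = (re (f x) * re (f x) + im (f x) * im (f x)) ^+ 2); last by ring.
  by rewrite expf_neq0.
Qed.

Lemma cvgC_continuous (h : R -> C) :
  (forall x (u : nat -> R), u n @[n --> \oo] --> x -> cvgC (fun n => h (u n)) (h x)) ->
  continuous (fun x => re (h x)) /\ continuous (fun x => im (h x)).
Proof.
move=> H; split => x; apply/(@cvg_nbhsP _ R^o) => u ux; by have [] := H x u ux.
Qed.

Lemma cder_cvgC f df : (forall x, cder f x (df x)) ->
  forall x (u : nat -> R), u n @[n --> \oo] --> x -> cvgC (fun n => f (u n)) (f x).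
Proof.
move=> fdf x u ux.
have c1 := @der1_continuous R _ _ (fun x => (fdf x).1) x.
have c2 := @der1_continuous R _ _ (fun x => (fdf x).2) x.
by split; [exact: (cvg_comp u _ ux c1)|exact: (cvg_comp u _ ux c2)].
Qed.

End ComplexDerivatives.

Section MeasurabilityTools.
Context d (T : measurableType d) (R : realType).

Lemma mC_comp d2 (T2 : measurableType d2) (f : T2 -> R[i]) (g : T -> T2) :
  mC f -> measurable_fun setT g -> mC (fun x => f (g x)).
Proof. by move=> [a b] mg; split; [exact: (measurableT_comp a mg)|exact: (measurableT_comp b mg)]. Qed.

Lemma measurable_comp_expR (h : T -> R) : measurable_fun setT h ->
  measurable_fun setT (fun x => expR (h x)).
Proof. exact: (measurableT_comp (@measurable_expR R)). Qed.

Lemma measurable_comp_indic (D : set R) (h : T -> R) : measurable D -> measurable_fun setT h ->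
  measurable_fun setT (fun x => \1_D (h x) : R).
Proof. by move=> mD; apply: measurableT_comp; exact: measurable_indic. Qed.

Lemma measurable_comp_inv (h : T -> R) : measurable_fun setT h ->
  measurable_fun setT (fun x => (h x)^-1).
Proof. exact: (measurableT_comp (@measurable_inv R)). Qed.

Lemma measurable_comp_opp (h : T -> R) : measurable_fun setT h ->
  measurable_fun setT (fun x => - h x).
Proof. exact: (measurableT_comp (@oppr_measurable R setT)). Qed.

Lemma measurable_comp_norm (h : T -> R) : measurable_fun setT h ->
  measurable_fun setT (fun x => `|h x|).
Proof. exact: (measurableT_comp (@normr_measurable R setT)). Qed.

Lemma measurable_comp_poisson s (h : T -> R) : measurable_fun setT h ->
  measurable_fun setT (fun x => poisson s (h x)).
Proof. exact: (measurableT_comp (measurable_poisson s)). Qed.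

End MeasurabilityTools.

Ltac mea := repeat first
  [ assumption | apply: mC_cst | apply: measurable_cst | apply: measurable_id
  | apply: measurable_fst | apply: measurable_snd
  | apply: mCB | apply: mCD | apply: mCN | apply: mCM | apply: mCV | apply: mC_real | apply: mC_cis | apply: mC_cexp
  | apply: measurable_funB | apply: measurable_funD | apply: measurable_comp_opp | apply: measurable_funM
  | apply: measurable_comp_expR
  | (apply: measurable_comp_indic; [by []|])
  | apply: measurable_comp_inv | apply: measurable_comp_poisson | apply: measurable_comp_norm
  | apply: measurable_funX ].

(** * Fourier transform and Cauchy kernels *)

Section FourierTransform.
Variable R : realType.
Local Notation mu := (@lebesgue_measure R).
Local Notation C := R[i].
Local Notation pos := (`[0, +oo[%classic : set R).
Implicit Types (F : R -> C).

(** The normalising factor (2 pi)^(-1/2) is left out; [cFT_cfunE] makes the link with [FT_re] and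
    [FT_im]. *)
Definition cFT F (p : R) : C := Cint (fun t => F t * cis (- (p * t))).

Lemma cvgC_Cint_param (k : R -> R -> C) (h : R -> R) x (u : nat -> R) :
  (forall x, mC (k x)) -> L1 h -> (forall x t, normc (k x t) <= h t) ->
  (forall t, cvgC (fun n => k (u n) t) (k x t)) ->
  cvgC (fun n => Cint (k (u n))) (Cint (k x)).
Proof.
move=> mk lh kh ku.
have [] // := @dominated_Cint R (fun n => k (u n)) (k x) h.
Qed.

Lemma mC_continuous (h : R -> C) :
  (forall x (u : nat -> R), u n @[n --> \oo] --> x -> cvgC (fun n => h (u n)) (h x)) ->
  mC h.
Proof. by move=> /cvgC_continuous[a b]; split; exact: continuous_measurable_fun. Qed.

Lemma L1C_cis F h : L1C F -> measurable_fun setT h -> L1C (fun t => F t * cis (h t)).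
Proof.
move=> lF mh; apply: (L1C_le _ (L1C_norm lF)).
  by apply: mCM; [exact: L1C_meas|exact: mC_cis].
by move=> t; rewrite normcM normc_cis mulr1.
Qed.

Lemma cvgC_cFT F : L1C F -> forall x (u : nat -> R), u n @[n --> \oo] --> x ->
  cvgC (fun n => cFT F (u n)) (cFT F x).
Proof.
move=> lF x u ux; have mF := L1C_meas lF.
apply: (@cvgC_Cint_param (fun p t => F t * cis (- (p * t))) _ x u _ (L1C_norm lF)).
- by move=> p; mea.
- by move=> p t; rewrite normcM normc_cis mulr1.
- move=> t; apply: cvgCM; first exact: cvgC_cst.
  by apply: cvgC_cis; apply: cvgN; apply: cvgM => //; exact: cvg_cst.
Qed.

Lemma mC_cFT F : L1C F -> mC (cFT F).
Proof. by move=> lF; apply: mC_continuous; exact: cvgC_cFT. Qed.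

Lemma normc_cFT F p : L1C F -> normc (cFT F p) <= 2 * Rint (fun t => normc (F t)).
Proof.
move=> lF; apply: normc_Cint_le; last by move=> t; rewrite normcM normc_cis mulr1.
- by apply: L1C_meas; apply: L1C_cis => //; mea.
- exact: L1C_norm.
Qed.

(** [Cint_halfline] writes the Cauchy kernel as a superposition of characters over a half line;
    after Fubini only one half of the spectrum of [F] is left, and the sign of [a] decides which. *)
Lemma halfline_transform F (a b s : R) : L1C F -> 0 < s ->
  Cint (fun t => F t * (s%:C - 'i%C * (a * t + b)%:C)^-1) =
  Cint (fun p => (\1_pos p * expR (- (s * p)))%:C * cis (b * p) * cFT F (- (a * p))).
Proof.
move=> lF s0; have mF := L1C_meas lF.
have mF1 : mC (fun z : R * R => F z.1) by apply: (mC_comp mF); exact: measurable_fst.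
pose k t p := F t * ((\1_pos p * expR (- (s * p)))%:C * cis ((a * t + b) * p)).
have le := L1_expN s0.
have [||_ _] := @fubini_Cint_prod R k (fun t => normc (F t)) _ _ (L1C_norm lF) le.
- by rewrite /k; mea.
- move=> t p; rewrite /k !normcM normc_cis mulr1 normcR.
  by rewrite (ger0_norm (mulr_ge0 (indic_ge0 _ _) (expR_ge0 _))).
have li x : L1C (fun p => (\1_pos p * expR (- (s * p)))%:C * cis (x * p)).
  apply: L1C_cis; first exact: L1C_real.
  by mea.
rewrite (_ : (fun x => Cint (k x)) = (fun t => F t * (s%:C - 'i%C * (a * t + b)%:C)^-1)); last first.
  by apply/funext => t; rewrite /k CintZ// Cint_halfline.
move=> ->; congr Cint; apply/funext => p.
rewrite /k /cFT -CintZ; last by apply: L1C_cis => //; mea.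
congr Cint; apply/funext => t.
rewrite (_ : (a * t + b) * p = b * p + - (- (a * p) * t)); last by ring.
by rewrite cisD; ring.
Qed.

End FourierTransform.

(** * Poisson extension of a function with positive spectrum *)

Section PoissonExtension.
Variable R : realType.
Local Notation mu := (@lebesgue_measure R).
Local Notation C := R[i].
Local Notation pos := (`[0, +oo[%classic : set R).
Variable F : R -> C.
Hypothesis lF : L1C F.
Hypothesis F_pos : forall p, p <= 0 -> cFT F p = 0.

(** The kernel of the lower half plane sees the frequencies p <= 0 only, where the transform of [F]
    vanishes. *)
Lemma cauchy_lower (s y : R) : 0 < s ->
  Cint (fun t => F t * (s%:C + 'i%C * (y - t)%:C)^-1) = 0.
Proof.
move=> s0.
rewrite (_ : (fun t => _) = (fun t => F t * (s%:C - 'i%C * (1 * t + - y)%:C)^-1)); last first.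
  by apply/funext => t; rewrite mul1r -(opprB y t) rmorphN/= mulrN opprK.
rewrite (halfline_transform 1 (- y) lF s0) -[RHS](@Cint0 R); congr Cint; apply/funext => p.
have [p0|p0] := leP 0 p.
  by rewrite mul1r F_pos ?mulr0// oppr_le0.
by rewrite indic_out ?mul0r ?rmorph0 ?mul0r//= in_itv/= andbT; apply/negP; rewrite -ltNge.
Qed.

(* The lower half-plane Cauchy kernel does not contribute, so any b may replace a in the second term. *)
Lemma cauchy_sum (a b y : R) : 0 < a -> 0 < b ->
  Cint (fun t => F t * ((a%:C - 'i%C * (y - t)%:C)^-1 + (b%:C + 'i%C * (y - t)%:C)^-1)) =
  Cint (fun t => F t * (a%:C - 'i%C * (y - t)%:C)^-1).
Proof.
move=> a0 b0; have mF := L1C_meas lF.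
have lK c (z : R -> C) : 0 < c -> mC z -> (forall t, re (z t) = c) -> L1C (fun t => F t * (z t)^-1).
  move=> c0 mz zc; rewrite (_ : (fun t => _) = (fun t => (z t)^-1 * F t)); last by apply/funext => t; rewrite mulrC.
  apply: (@L1C_mul R (fun t => (z t)^-1) F c^-1 (mCV mz) lF) => t.
  have h := normc_re (z t); rewrite zc ger0_norm ?(ltW c0)// in h.
  by rewrite normcV lef_pV2// posrE//; exact: lt_le_trans h.
have l1 : L1C (fun t => F t * (a%:C - 'i%C * (y - t)%:C)^-1).
  by apply: (lK a) => [//||t]; [mea|rewrite !reimE; ring].
have l2 : L1C (fun t => F t * (b%:C + 'i%C * (y - t)%:C)^-1).
  by apply: (lK b) => [//||t]; [mea|rewrite !reimE; ring].
rewrite -[RHS]addr0 -(cauchy_lower y b0) -CintD//; congr Cint.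
by apply/funext => t; rewrite mulrDr.
Qed.

Definition poisson_ext (s y : R) : C := Cint (fun t => F t * (poisson s (y - t))%:C).

Lemma L1C_bounded_mul (z : R -> C) (M : R) : mC z -> (forall t, normc (z t) <= M) ->
  L1C (fun t => F t * z t).
Proof.
move=> mz zM; rewrite (_ : (fun t => _) = (fun t => z t * F t)); last by apply/funext => t; rewrite mulrC.
exact: (@L1C_mul R z F M mz lF zM).
Qed.

(** The lower Cauchy term contributes nothing, whatever its width [b]. The strip argument takes for
    [b] the distance to 2 s instead of the height itself. *)
Lemma poisson_ext_cauchy (s b y : R) : 0 < s -> 0 < b ->
  poisson_ext s y = ((2 * pi)^-1)%:C * 
    Cint (fun t => F t * ((s%:C - 'i%C * (y - t)%:C)^-1 + (b%:C + 'i%C * (y - t)%:C)^-1)).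
Proof.
move=> s0 b0; rewrite cauchy_sum// -(cauchy_sum y s0 s0) -CintZ.
  by congr Cint; apply/funext => t; rewrite poissonE// mulrCA.
have mF := L1C_meas lF.
apply: (@L1C_bounded_mul _ (s^-1 + s^-1)); first by mea.
have bd (z : C) : re z = s -> normc z^-1 <= s^-1.
  move=> zs; have h := normc_re z; rewrite zs ger0_norm ?(ltW s0)// in h.
  rewrite normcV lef_pV2// posrE//; exact: lt_le_trans h.
move=> t; apply: (le_trans (ler_normcD _ _)).
by apply: lerD; apply: bd; rewrite !reimE; ring.
Qed.

Lemma poisson_ext_fourier (s y : R) : 0 < s ->
  poisson_ext s y = ((2 * pi)^-1)%:C *
    Cint (fun p => (\1_pos p * expR (- (s * p)))%:C * cis (y * p) * cFT F p).
Proof.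
move=> s0; rewrite (poisson_ext_cauchy y s0 s0) cauchy_sum//.
congr (_ * _).
rewrite (_ : (fun t => F t / _) = (fun t => F t * (s%:C - 'i%C * (-1 * t + y)%:C)^-1)); last first.
  by apply/funext => t; rewrite mulN1r (addrC (- t)).
rewrite (halfline_transform (-1) y lF s0); congr Cint; apply/funext => p.
by rewrite mulN1r opprK.
Qed.

Lemma poisson_int (s t : R) : 0 < s ->
  L1 (fun y => poisson s (y - t)) /\ Rint (fun y => poisson s (y - t)) = 1.
Proof.
move=> s0; have [l1 e1] := poisson1_int R.
have ls : L1 (fun y => poisson s (y - t)).
  have si : 0 < s^-1 by rewrite invr_gt0.
  have := L1Z s^-1 (L1_affine (- (t / s)) si l1).
  congr (is_true (L1 _)); apply/funext => y.
  rewrite -(poisson_scale _ s0) mulrA mulVf ?gt_eqF// mul1r; congr (poisson _ _).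
  by field; rewrite gt_eqF.
split => //.
rewrite (Rint_affine t s0 ls) -RintZ; last exact: (L1_affine t s0 ls).
rewrite -[RHS]e1; congr Rint; apply/funext => v.
by rewrite addrC addKr poisson_scale.
Qed.

(** Stated for any kernel under a multiple of a Poisson kernel, because it serves both the Poisson
    kernel itself and the product [ke] of two Cauchy kernels. *)
Lemma fubini_conv (s K M : R) (H Phi : R -> C) : 0 < s -> mC H -> mC Phi ->
  (forall x, normc (H x) <= K * poisson s x) -> (forall y, normc (Phi y) <= M) ->
  [/\ forall t, L1C (fun y => H (y - t) * Phi y),
      L1C (fun t => F t * Cint (fun y => H (y - t) * Phi y)),
      L1C (fun y => Cint (fun t => F t * H (y - t)) * Phi y) &
      Cint (fun t => F t * Cint (fun y => H (y - t) * Phi y)) =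
      Cint (fun y => Cint (fun t => F t * H (y - t)) * Phi y)].
Proof.
move=> s0 mH mP HK PM; have mF := L1C_meas lF.
have M0 : 0 <= M by exact: le_trans (normc_ge0 _) (PM 0).
have mF1 : mC (fun z : R * R => F z.1) by apply: (mC_comp mF); exact: measurable_fst.
have mP2 : mC (fun z : R * R => Phi z.2) by apply: (mC_comp mP); exact: measurable_snd.
have mH2 : mC (fun z : R * R => H (z.2 - z.1)) by apply: (mC_comp mH); mea.
have mHt t : mC (fun y : R => H (y - t)) by apply: (mC_comp mH); mea.
have mHy y : mC (fun t : R => H (y - t)) by apply: (mC_comp mH); mea.
pose k t y := F t * (H (y - t) * Phi y).
have bnd t y : normc (H (y - t) * Phi y) <= (M * K) * poisson s (y - t).
  by rewrite normcM mulrC -mulrA ler_pM ?normc_ge0.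
have lP t : L1C (fun y => H (y - t) * Phi y).
  by apply: (L1C_le _ (L1Z (M * K) (poisson_int t s0).1)) => //; mea.
have mk : mC (fun z : R * R => k z.1 z.2) by rewrite /k; mea.
have lu : L1 (fun t => (M * K) * normc (F t)) by exact: L1Z (L1C_norm lF).
have [|l1 l2 e] := @fubini_Cint R k _ mk lu.
  move=> t; have [lp ep] := poisson_int t s0.
  have mkt : mC (k t) by rewrite /k; mea.
  apply: (@le_trans _ _ (\int[mu]_y (M * K * normc (F t) * poisson s (y - t))%:E)%E).
    apply: ge0_le_integral => //=.
    - by move=> y _; rewrite lee_fin normc_ge0.
    - by apply/measurable_EFinP; exact: (m_normc mkt).
    - by apply/measurable_EFinP; apply: L1_meas (L1Z _ lp).
    - move=> y _; rewrite lee_fin /k normcM.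
      by rewrite (mulrC (M * K)) -mulrA ler_wpM2l ?normc_ge0.
  by rewrite (RintE (L1Z _ lp)) (RintZ _ lp) ep mulr1.
have eW t : Cint (k t) = F t * Cint (fun y => H (y - t) * Phi y).
  by rewrite /k CintZ.
have eL y : Cint (k^~ y) = Cint (fun t => F t * H (y - t)) * Phi y.
  rewrite -CintZr; last first.
    rewrite (_ : (fun t => _) = (fun t => H (y - t) * F t)); last by apply/funext => t; rewrite mulrC.
    apply: (@L1C_mul R (fun t => H (y - t)) F (K * poisson s 0) (mHy y) lF).
    have K0 : 0 <= K.
      by have := le_trans (normc_ge0 _) (HK 0); rewrite (pmulr_lge0 _ (poisson_gt0 0 s0)).
    move=> t; apply: (le_trans (HK _)); apply: ler_wpM2l; [exact: K0|exact: le_poisson0].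
  by congr Cint; apply/funext => t; rewrite /k mulrA.
split; first exact: lP.
- by move: l1; congr (L1C _); apply/funext => t; rewrite eW.
- by move: l2; congr (L1C _); apply/funext => t; rewrite eL.
- rewrite [RHS](_ : _ = Cint (fun y => Cint (k^~ y))); last by congr Cint; apply/funext => y; rewrite eL.
  by rewrite -e; congr Cint; apply/funext => t; rewrite eW.
Qed.

(** In the variable v = (y - t) / s the kernel no longer depends on [s], so that the limit s -> 0 is
    within reach of dominated convergence. *)
Lemma poisson_convE (s M t : R) (Phi : R -> C) : 0 < s -> mC Phi ->
  (forall y, normc (Phi y) <= M) ->
  Cint (fun y => (poisson s (y - t))%:C * Phi y) =
  Cint (fun v => (poisson 1 v)%:C * Phi (t + s * v)).
Proof.
move=> s0 mP PM.
have lP : L1C (fun y => (poisson s (y - t))%:C * Phi y).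
  apply: (L1C_le _ (L1Z M (poisson_int t s0).1)); first by mea.
  move=> y; rewrite normcM normcR ger0_norm ?poisson_ge0// mulrC.
  by rewrite ler_wpM2r ?poisson_ge0.
rewrite (Cint_affine t s0 lP) -CintZ; last exact: (L1C_affine t s0 lP).
congr Cint; apply/funext => v.
by rewrite mulrA -rmorphM/= addrC addKr poisson_scale// addrC.
Qed.

(** Fubini moves the Poisson kernel from [F] to the test function [Phi]. The resulting expression
    keeps its meaning at s = 0, where the extension itself does not. *)
Lemma poisson_ext_transfer (s M : R) (Phi : R -> C) : 0 < s -> mC Phi ->
  (forall y, normc (Phi y) <= M) ->
  [/\ L1C (fun t => F t * Cint (fun v => (poisson 1 v)%:C * Phi (t + s * v))),
      L1C (fun y => poisson_ext s y * Phi y) &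
   Cint (fun y => poisson_ext s y * Phi y) =
   Cint (fun t => F t * Cint (fun v => (poisson 1 v)%:C * Phi (t + s * v)))].
Proof.
move=> s0 mP PM.
have mH : mC (fun x => (poisson s x)%:C) by mea.
have [|_ l1 l2 e] := @fubini_conv s 1 M _ Phi s0 mH mP _ PM.
  by move=> x; rewrite normcR mul1r ger0_norm ?poisson_ge0.
have eq1 t := poisson_convE t s0 mP PM.
split; [|exact: l2|].
- by move: l1; congr (L1C _); apply/funext => t; rewrite eq1.
- by rewrite -e; congr Cint; apply/funext => t; rewrite eq1.
Qed.

Lemma L1C_poisson_ext (s : R) : 0 < s -> L1C (poisson_ext s).
Proof.
move=> s0; have [|_ + _] := @poisson_ext_transfer s 1 (fun=> 1) s0 (mC_cst _ _).
  by move=> _; rewrite normc1.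
by congr (L1C _); apply/funext => y; rewrite mulr1.
Qed.

End PoissonExtension.

(** * Rotation of the line of integration *)

Section Rotation.
Variable R : realType.
Local Notation mu := (@lebesgue_measure R).
Local Notation C := R[i].

Lemma der1_Rint (f df : R -> R -> R) (G : R -> R) (u v a : R) : u < a < v ->
  (forall x, u < x < v -> L1 (f x)) ->
  (forall x y, u < x < v -> der1 (f^~ y) x (df x y)) ->
  L1 G -> (forall x y, u < x < v -> `|df x y| <= G y) ->
  der1 (fun x => Rint (f x)) a (Rint (df a)).
Proof.
move=> uav lf fdf lG dfG.
have inI x : `]u, v[%classic x -> u < x < v by rewrite /= in_itv.
have Ia : `]u, v[%classic a by rewrite /= in_itv.
have G0 y : 0 <= G y by apply: le_trans (dfG a y uav); exact: normr_ge0.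
have d1 x y : u < x < v -> partial1of2 f x y = df x y.
  by move=> ux; rewrite partial1of2E; have [] := fdf x y ux.
have dv := @derivable_under_integral R _ (measurableTypeR R) mu f setT measurableT a u v Ia
  (fun x Ix => lf x (inI x Ix)) (fun x y Ix _ => let: DeriveDef h _ := fdf x y (inI x Ix) in h)
  G G0 lG.
have de := @differentiation_under_integral R _ (measurableTypeR R) mu f setT measurableT a u v Ia
  (fun x Ix => lf x (inI x Ix)) (fun x y Ix _ => let: DeriveDef h _ := fdf x y (inI x Ix) in h)
  G G0 lG.
apply: DeriveDef.
  by apply: dv => x y /inI ux _; rewrite d1// dfG.
rewrite -derive1E de.
  by congr Rint; apply/funext => y; rewrite /= d1.
by move=> x y /inI ux _; rewrite d1// dfG.
Qed.

Lemma cvg0_inv_sqr (g : R -> R) (K u t : R) : 0 < u -> 0 <= K ->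
  (forall y, `|g y| <= K / (u ^+ 2 + (y - t) ^+ 2)) ->
  g y @[y --> +oo] --> 0 /\ g y @[y --> -oo] --> 0.
Proof.
move=> u0 K0 gK.
have key e y : 0 < e -> 1 + K / e < `|y - t| -> `|0 - g y| < e.
  move=> e0 h; rewrite sub0r normrN (le_lt_trans (gK y))//.
  have Ke : 0 <= K / e by rewrite divr_ge0// ltW.
  have h1 : K / e < (y - t) ^+ 2 by rewrite -(real_normK (num_real (y - t))); nra.
  have pos : 0 < u ^+ 2 + (y - t) ^+ 2 by rewrite ltr_wpDr ?sqr_ge0// exprn_gt0.
  rewrite ltr_pdivrMr//; move: h1; rewrite ltr_pdivrMr// => h1.
  have := sqr_ge0 u; nra.
split; apply/cvgrPdist_lt => e e0; near=> y; apply: key => //.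
- rewrite (lt_le_trans _ (ler_norm _))// ltrBrDr.
  by near: y; apply: nbhs_pinfty_gt; exact: num_real.
- rewrite distrC (lt_le_trans _ (ler_norm _))//.
  suff : y < t - (1 + K / e) by lra.
  by near: y; apply: nbhs_ninfty_lt; exact: num_real.
Unshelve. all: by end_near. Qed.

Lemma normc_inv_le (z : C) (u x : R) : 0 < u -> u <= `|re z| -> `|im z| = `|x| ->
  normc z^-1 <= u^-1 /\ normc z^-1 ^+ 2 <= (u ^+ 2 + x ^+ 2)^-1.
Proof.
move=> u0 uz xz.
have h : u ^+ 2 + x ^+ 2 <= normc z ^+ 2.
  rewrite sqr_normc -(real_normK (num_real (im z))) xz (real_normK (num_real x)) lerD2r.
  by rewrite -(real_normK (num_real (re z))) ler_sqr ?nnegrE// ltW.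
have pos : 0 < u ^+ 2 + x ^+ 2 by rewrite ltr_wpDr ?sqr_ge0// exprn_gt0.
rewrite normcV; split; last first.
  by rewrite exprVn lef_pV2// posrE//; exact: lt_le_trans h.
have u1 : u <= normc z by exact: le_trans (normc_re z).
by rewrite lef_pV2// posrE//; exact: lt_le_trans u1.
Qed.

Lemma cvgCN (u : nat -> C) l : cvgC u l -> cvgC (fun n => - u n) (- l).
Proof.
move=> h; rewrite -mulN1r; under eq_fun do rewrite -mulN1r.
by apply: cvgCM h; exact: cvgC_cst.
Qed.

Lemma cvgCB (u v : nat -> C) l m : cvgC u l -> cvgC v m -> cvgC (fun n => u n - v n) (l - m).
Proof. by move=> hu /cvgCN; exact: cvgCD. Qed.

(** * Holomorphic factors in a horizontal strip *)

Section Strip.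
(** [Phi tau y] stands for the value at y + i tau of a function holomorphic inside the strip,
    continuous on its closure and bounded by 1; [Phi_dy] and [Phi_dtau] together are the
    Cauchy-Riemann equations. The derivative is bounded only away from the lower edge: that of exp
    (- i k e^-z) is unbounded on the real line. *)
Variables (s : R) (Phi Phi' : R -> R -> C).
Hypothesis s0 : 0 < s.
Hypothesis Phi_le1 : forall tau y, 0 <= tau <= s -> normc (Phi tau y) <= 1.
Hypothesis Phi_cvg : forall tau y (v u : nat -> R), 0 <= tau <= s ->
  (forall n, 0 <= v n <= s) -> v n @[n --> \oo] --> tau -> u n @[n --> \oo] --> y ->
  cvgC (fun n => Phi (v n) (u n)) (Phi tau y).
Hypothesis Phi_dy : forall tau y, 0 < tau < s -> cder (Phi tau) y (Phi' tau y).
Hypothesis Phi_dtau : forall tau y, 0 < tau < s -> cder (Phi^~ y) tau ('i%C * Phi' tau y).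
Hypothesis Phi'_cvg : forall tau y (u : nat -> R), 0 < tau < s ->
  u n @[n --> \oo] --> y -> cvgC (fun n => Phi' tau (u n)) (Phi' tau y).
Hypothesis Phi'_bnd : forall a, 0 < a -> exists M, forall tau y, a <= tau < s -> normc (Phi' tau y) <= M.

Let mPhi tau : 0 <= tau <= s -> mC (Phi tau).
Proof.
move=> ts; apply: mC_continuous => y u uy.
by apply: (Phi_cvg (v := fun=> tau)) => //; exact: cvg_cst.
Qed.

Let ze tau x : C := tau%:C - 'i%C * x%:C.
(** Since 1/A + 1/(c - A) = c/(A (c - A)), this is, up to the factor 2 s, the sum of the upper
    Cauchy kernel at height tau and the lower one of width 2 s - tau. Like each of them it is
    holomorphic in x + i tau, but it decays quadratically. [dke] is its derivative with respect to
    [ze]. *)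
Let ke tau x : C := (ze tau x)^-1 * ((2 * s)%:C - ze tau x)^-1.
Let dke tau x : C := (ze tau x)^-1 * ((2 * s)%:C - ze tau x)^-1 ^+ 2
   - (ze tau x)^-1 ^+ 2 * ((2 * s)%:C - ze tau x)^-1.

Let ze_neq0 tau x : 0 < tau < s -> ze tau x != 0.
Proof. by move=> /andP[t0 _]; exact: sBi_neq0. Qed.

Let zec_neq0 tau x : 0 < tau < s -> (2 * s)%:C - ze tau x != 0.
Proof.
move=> /andP[t0 ts]; apply/eqP => /(congr1 (@re R)); rewrite /ze !reimE => h.
by have : 2 * s - tau = 0 by [move: h; lra]; lra.
Qed.

Let ke_dy t tau y : 0 < tau < s -> cder (fun y => ke tau (y - t)) y (- 'i%C * dke tau (y - t)).
Proof.
move=> ts.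
have h1 : cder (fun y => ze tau (y - t)) y (- 'i%C).
  apply: cder_eq; first by apply: cderB; [exact: cder_cst|apply: cderM; [exact: cder_cst|apply: cder_real; der1]].
  by apply: Cext; rewrite !reimE; ring.
have h2 : cder (fun y => (2 * s)%:C - ze tau (y - t)) y 'i%C.
  by apply: cder_eq; [apply: cderB; [exact: cder_cst|exact: h1]|rewrite sub0r opprK].
apply: cder_eq; first by apply: cderM; apply: cder_inv; first [exact: h1|exact: h2|exact: ze_neq0|exact: zec_neq0].
rewrite /dke; cbv beta; move: (ze_neq0 (y - t) ts) (zec_neq0 (y - t) ts).
set B := _ - ze tau (y - t); move: B; set A := ze tau (y - t); move: A => A B zA zB.
by field; rewrite zA zB.
Qed.

Let ke_dtau x tau : 0 < tau < s -> cder (ke^~ x) tau (dke tau x).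
Proof.
move=> ts.
have h1 : cder (ze^~ x) tau 1.
  apply: cder_eq; first by apply: cderB; [apply: cder_real; der1|exact: cder_cst].
  by apply: Cext; rewrite !reimE; ring.
have h2 : cder (fun tau => (2 * s)%:C - ze tau x) tau (- 1).
  by apply: cder_eq; [apply: cderB; [exact: cder_cst|exact: h1]|rewrite sub0r].
apply: cder_eq; first by apply: cderM; apply: cder_inv; first [exact: h1|exact: h2|exact: ze_neq0|exact: zec_neq0].
rewrite /dke; cbv beta; move: (ze_neq0 x ts) (zec_neq0 x ts).
set B := _ - ze tau x; move: B; set A := ze tau x; move: A => A B zA zB.
by field; rewrite zA zB.
Qed.

(** Both factors have a denominator of real part at least [u] (tau for one, 2 s - tau > s for the
    other) and of imaginary part x up to sign. The bound is a multiple of a Poisson kernel, hence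
    integrable. *)
Let ke_bnd u tau x : 0 < u -> u <= tau < s ->
  normc (ke tau x) <= (u ^+ 2 + x ^+ 2)^-1 /\
  normc (dke tau x) <= 2 / u * (u ^+ 2 + x ^+ 2)^-1.
Proof.
move=> u0 /andP[ut ts].
have [||a1 a2] := @normc_inv_le (ze tau x) u x u0.
- rewrite /ze !reimE; have -> : tau - (0 * x - 1 * 0) = tau by ring.
  by rewrite ger0_norm// (le_trans (ltW u0)).
- rewrite /ze !reimE; have -> : 0 - (0 * 0 + 1 * x) = - x by ring.
  exact: normrN.
have [||b1 b2] := @normc_inv_le ((2 * s)%:C - ze tau x) u x u0.
- rewrite /ze !reimE; have -> : 2 * s - (tau - (0 * x - 1 * 0)) = 2 * s - tau by ring.
  by rewrite ger0_norm; lra.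
- by rewrite /ze !reimE; congr (`|_|); ring.
set A := (ze tau x)^-1 in a1 a2 *; set B := (_ - _)^-1 in b1 b2 *.
have nA := normc_ge0 A; have nB := normc_ge0 B.
have k1 : normc (ke tau x) <= (u ^+ 2 + x ^+ 2)^-1.
  by rewrite /ke -/A -/B normcM; nra.
split => //; rewrite /dke -/A -/B (le_trans (ler_normcB _ _))// !expr2 !normcM.
rewrite /ke -/A -/B normcM in k1.
have ui : 0 < u^-1 by rewrite invr_gt0.
nra.
Qed.

Let psi t tau y := ke tau (y - t) * Phi tau y.
Let dpsi t tau y := - 'i%C * dke tau (y - t) * Phi tau y + ke tau (y - t) * Phi' tau y.

Let ke_cvg t tau y (u : nat -> R) : 0 < tau < s -> u n @[n --> \oo] --> y ->
  cvgC (fun n => ze tau (u n - t)) (ze tau (y - t)).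
Proof.
move=> ts uy; apply: cvgCD; first exact: cvgC_cst.
rewrite -mulrN -rmorphN; under eq_fun do rewrite -mulrN -rmorphN.
apply: cvgCM; first exact: cvgC_cst.
by apply: cvgC_real; apply: cvgN; apply: cvgB => //; exact: cvg_cst.
Qed.

Let dpsi_cvg t tau y (u : nat -> R) : 0 < tau < s -> u n @[n --> \oo] --> y ->
  cvgC (fun n => dpsi t tau (u n)) (dpsi t tau y).
Proof.
move=> ts uy; have hz := ke_cvg t ts uy.
have hA := cvgCV (ze_neq0 (y - t) ts) hz.
have hB := cvgCV (zec_neq0 (y - t) ts) (cvgCB (cvgC_cst (2 * s)%:C) hz).
have hP : cvgC (fun n => Phi tau (u n)) (Phi tau y).
  apply: (Phi_cvg (v := fun=> tau)) => //; last exact: cvg_cst.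
    by case/andP: ts => /ltW-> /ltW->.
  by move=> _; case/andP: ts => /ltW-> /ltW->.
have hP' := Phi'_cvg ts uy.
apply: cvgCD; last by apply: cvgCM => //; exact: cvgCM.
apply: cvgCM => //; apply: cvgCM; first exact: cvgC_cst.
rewrite /dke !expr2; under eq_fun do rewrite /dke !expr2.
by apply: cvgCB; do ?[exact: hA|exact: hB|apply: cvgCM].
Qed.

(** By Cauchy-Riemann the derivative of [psi] in tau is i times its derivative [dpsi] in y, and the
    integral of the latter over the line is 0 because [psi] vanishes at both ends. *)
Let strip_derivative t a : 0 < a < s ->
  cder (fun tau => Cint (psi t tau)) a 0.
Proof.
move=> /andP[a0 as_].
(* Heights above a/2 stay away from the lower edge, so one majorant [G] serves the whole
   neighbourhood of [a]. *)
pose u := a / 2; have u0 : 0 < u by rewrite divr_gt0.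
have [M HM] := Phi'_bnd u0.
have M0 : 0 <= M.
  have h : u <= a < s by rewrite /u as_ andbT; lra.
  exact: le_trans (normc_ge0 _) (HM a 0 h).
pose K := 2 / u + M.
have K0 : 0 <= K by rewrite addr_ge0// divr_ge0// ltW.
pose G y := K * (u ^+ 2 + (y - t) ^+ 2)^-1.
have lq : L1 (fun y => (u ^+ 2 + (y - t) ^+ 2)^-1).
  under eq_fun do rewrite inv_sqrD_poisson//.
  by apply: L1Z; case: (poisson_int t u0).
have lG : L1 G by exact: L1Z.
have rng tau : u < tau < s -> (0 < tau < s) && (u <= tau < s) && (0 <= tau <= s).
  by move=> /andP[h1 h2]; rewrite !(ltW h2) !h2 (ltW h1) !(lt_trans u0 h1) (ltW (lt_trans u0 h1)).
have psi_bnd tau y : u < tau < s -> normc (psi t tau y) <= (u ^+ 2 + (y - t) ^+ 2)^-1.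
  move=> /rng/andP[/andP[h1 h2] h3]; have [k1 _] := ke_bnd (y - t) u0 h2.
  by rewrite normcM; have := Phi_le1 y h3; have := normc_ge0 (ke tau (y - t)); have := normc_ge0 (Phi tau y); nra.
have dpsi_bnd tau y : u < tau < s -> normc (dpsi t tau y) <= G y.
  move=> /rng/andP[/andP[h1 h2] h3]; have [k1 k2] := ke_bnd (y - t) u0 h2.
  apply: (le_trans (ler_normcD _ _)); rewrite !normcM normcN normci mul1r.
  have -> : G y = 2 / u * (u ^+ 2 + (y - t) ^+ 2)^-1 * 1 + (u ^+ 2 + (y - t) ^+ 2)^-1 * M.
    by rewrite /G /K; ring.
  apply: lerD; apply: ler_pM; try exact: normc_ge0; [exact: k2|exact: (Phi_le1 y h3)|by rewrite -normcM normc_ge0|by rewrite -normcM|exact: (HM tau y h2)].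
have psi_dy tau y : 0 < tau < s -> cder (psi t tau) y (dpsi t tau y).
  by move=> ts; apply: cderM; [exact: ke_dy|exact: Phi_dy].
have psi_dtau tau y : 0 < tau < s -> cder (fun tau => psi t tau y) tau ('i%C * dpsi t tau y).
  move=> ts; apply: cder_eq; first by apply: cderM; [exact: ke_dtau|exact: Phi_dtau].
  have ii : ('i%C * 'i%C = -1 :> C) by apply: Cext; rewrite !reimE; ring.
  rewrite /dpsi; cbv beta.
  move: (dke tau (y - t)) (ke tau (y - t)) (Phi tau y) (Phi' tau y) => a1 a2 a3 a4.
  have -> : 'i%C * (- 'i%C * a1 * a3 + a2 * a4) = - ('i%C * 'i%C) * a1 * a3 + a2 * ('i%C * a4) by ring.
  by rewrite ii; ring.
have mpsi tau : 0 < tau < s -> mC (psi t tau).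
  by move=> ts; apply: mC_continuous; exact: cder_cvgC (fun y => psi_dy tau y ts).
have mdpsi tau : 0 < tau < s -> mC (dpsi t tau).
  by move=> ts; apply: mC_continuous => y v vy; exact: dpsi_cvg.
have lpsi tau : u < tau < s -> L1C (psi t tau).
  move=> ts; have /andP[/andP[h1 h2] h3] := rng _ ts.
  by apply: (L1C_le (mpsi _ h1) lq) => y; exact: psi_bnd.
have ua : u < a < s by rewrite as_ andbT /u; lra.
have /andP[/andP[ra1 _] _] := rng _ ua.
have ldpsi : L1C (dpsi t a).
  by apply: (L1C_le (mdpsi _ ra1) lG) => y; exact: dpsi_bnd.
have I0 : Cint (dpsi t a) = 0.
  have [cr ci] := cvgC_continuous (fun y v => @dpsi_cvg t a y v ra1).
  have psi_bnd' (y : R) : normc (psi t a y) <= 1 / (u ^+ 2 + (y - t) ^+ 2).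
    by rewrite mul1r; exact: psi_bnd.
  apply: Cext; rewrite /=.
  - have [l1 l2] := cvg0_inv_sqr u0 ler01 (fun y => le_trans (normc_re _) (psi_bnd' y)).
    by apply: (FTC_line (fun y => (psi_dy a y ra1).1) cr ldpsi.1 l1 l2).
  - have [l1 l2] := cvg0_inv_sqr u0 ler01 (fun y => le_trans (normc_im _) (psi_bnd' y)).
    by apply: (FTC_line (fun y => (psi_dy a y ra1).2) ci ldpsi.2 l1 l2).
have I1 : Cint (fun y => 'i%C * dpsi t a y) = 0 by rewrite CintZ// I0 mulr0.
rewrite -I1; split.
- apply: (@der1_Rint (fun tau y => re (psi t tau y)) (fun tau y => re ('i%C * dpsi t tau y)) G u s a ua) => //.
  + by move=> x ux; case: (lpsi x ux).
  + by move=> x y ux; have /andP[/andP[h1 _] _] := rng _ ux; case: (psi_dtau x y h1).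
  + move=> x y ux; rewrite (le_trans (normc_re _))// normcM normci mul1r; exact: dpsi_bnd.
- apply: (@der1_Rint (fun tau y => im (psi t tau y)) (fun tau y => im ('i%C * dpsi t tau y)) G u s a ua) => //.
  + by move=> x ux; case: (lpsi x ux).
  + by move=> x y ux; have /andP[/andP[h1 _] _] := rng _ ux; case: (psi_dtau x y h1).
  + move=> x y ux; rewrite (le_trans (normc_im _))// normcM normci mul1r; exact: dpsi_bnd.
Qed.

Let const_of_der1 (g : R -> R) a b : 0 < a < s -> 0 < b < s ->
  (forall x, 0 < x < s -> der1 g x 0) -> g a = g b.
Proof.
wlog ab : a b / a <= b.
  move=> H ha hb hg; have [|/ltW] := leP a b; first by move=> ?; exact: H.
  by move=> ?; apply/esym; exact: H.
move=> /andP[a0 as_] /andP[b0 bs] hg.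
have inab x : x \in `[a, b] -> 0 < x < s.
  by rewrite in_itv/= => /andP[h1 h2]; rewrite (lt_le_trans a0)//= (le_lt_trans h2).
have [||c _ e] := @MVT_segment R g (fun=> 0) a b ab.
- by move=> x xab; apply: hg; apply: inab; exact: subset_itv_oo_cc.
- by apply: derivable_within_continuous => z zab; have [] := hg z (inab z zab).
by apply/eqP; rewrite eq_sym -subr_eq0 e mul0r.
Qed.

Let strip_const t a b : 0 < a < s -> 0 < b < s -> Cint (psi t a) = Cint (psi t b).
Proof.
move=> ha hb; apply: Cext.
- by apply: (@const_of_der1 (fun tau => re (Cint (psi t tau)))) => // x xs; case: (strip_derivative t xs).
- by apply: (@const_of_der1 (fun tau => im (Cint (psi t tau)))) => // x xs; case: (strip_derivative t xs).
Qed.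

Variable F : R -> C.
Hypothesis lF : L1C F.
Hypothesis F_pos : forall p, p <= 0 -> cFT F p = 0.

(** Poisson average of [Phi] on the line Im = tau, rescaled so that tau = 0 gives back [Phi 0]. For
    tau > 0, [T tau] is the integral over that line of the extension of [F] times [Phi]; it is
    continuous on the closed interval. *)
Let W tau t := Cint (fun v => (poisson 1 v)%:C * Phi tau (t + tau * v)).
Let T tau := Cint (fun t => F t * W tau t).

Let mPhi_affine tau t : 0 <= tau <= s -> mC (fun v => Phi tau (t + tau * v)).
Proof. by move=> ts; apply: (mC_comp (mPhi ts)); exact: measurable_affine. Qed.

Let W_integrand tau t : 0 <= tau <= s ->
  mC (fun v => (poisson 1 v)%:C * Phi tau (t + tau * v)) /\
  forall v, normc ((poisson 1 v)%:C * Phi tau (t + tau * v)) <= poisson 1 v.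
Proof.
move=> ts; have h := mPhi_affine t ts; split; first by mea.
move=> v; rewrite normcM normcR ger0_norm ?poisson_ge0//.
by rewrite ler_piMr ?poisson_ge0// Phi_le1.
Qed.

Let W_bnd tau t : 0 <= tau <= s -> normc (W tau t) <= 2.
Proof.
move=> ts; have [l e] := poisson1_int R; have [m b] := W_integrand t ts.
by have := normc_Cint_le m l b; rewrite e mulr1.
Qed.

Let W0 t : W 0 t = Phi 0 t.
Proof.
have [l e] := poisson1_int R.
rewrite /W; under eq_fun do rewrite mul0r addr0.
by rewrite CintZr ?Cint_real ?e ?mul1r//; exact: L1C_real.
Qed.

Let L1C_FW tau : 0 <= tau <= s -> L1C (fun t => F t * W tau t).
Proof.
move=> ts; have [t0|t0] := eqVneq tau 0.
  rewrite t0; under eq_fun do rewrite W0.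
  have ss : (0 <= (0:R) <= s)%R by apply/andP; split; [exact: lexx|exact: ltW].
  by apply: (L1C_bounded_mul lF (mPhi ss)) => t; exact: Phi_le1.
have tp : 0 < tau by rewrite lt_def t0; case/andP: ts.
have [h _ _] := poisson_ext_transfer lF tp (mPhi ts) (fun y => Phi_le1 y ts).
exact: h.
Qed.

Let W_cvg tau t (v : nat -> R) : 0 <= tau <= s -> (forall n, 0 <= v n <= s) ->
  v n @[n --> \oo] --> tau -> cvgC (fun n => W (v n) t) (W tau t).
Proof.
move=> ts vs vt; have [l e] := poisson1_int R.
have [|||||_ h] := @dominated_Cint R (fun n x => (poisson 1 x)%:C * Phi (v n) (t + v n * x))
   (fun x => (poisson 1 x)%:C * Phi tau (t + tau * x)) (poisson 1).
- by move=> n; case: (W_integrand t (vs n)).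
- by case: (W_integrand t ts).
- exact: l.
- move=> x; apply: cvgCM; first exact: cvgC_cst.
  apply: Phi_cvg => //; apply: cvgD; first exact: cvg_cst.
  by apply: cvgM => //; exact: cvg_cst.
- by move=> n x; case: (W_integrand t (vs n)).
exact: h.
Qed.

Let T_cvg tau (v : nat -> R) : 0 <= tau <= s -> (forall n, 0 <= v n <= s) ->
  v n @[n --> \oo] --> tau -> cvgC (fun n => T (v n)) (T tau).
Proof.
move=> ts vs vt.
have [|||||_ h] := @dominated_Cint R (fun n t => F t * W (v n) t) (fun t => F t * W tau t)
   (fun t => 2 * normc (F t)).
- by move=> n; apply: L1C_meas; exact: L1C_FW.
- by apply: L1C_meas; exact: L1C_FW.
- by apply: L1Z; exact: L1C_norm.
- by move=> t; apply: cvgCM; [exact: cvgC_cst|exact: W_cvg].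
- move=> n t; rewrite normcM mulrC; apply: ler_wpM2r; first exact: normc_ge0.
  exact: W_bnd.
exact: h.
Qed.

Let mke tau : 0 < tau < s -> mC (ke tau).
Proof. by move=> ts; rewrite /ke /ze; mea. Qed.

(** Integrated against [F], the Poisson kernel may be traded for the holomorphic kernel [ke], since
    the two differ by lower Cauchy kernels only. The factor s / pi is 2 s, from the sum of the two
    fractions, over 2 pi. *)
Let T_strip tau : 0 < tau < s -> T tau = Cint (fun t => F t * Cint (fun y => (s / pi)%:C * ke tau (y - t) * Phi tau y)).
Proof.
move=> ts; have /andP[t0 t1] := ts.
have ts' : 0 <= tau <= s by rewrite !ltW.
have mP := mPhi ts'.
have PM y := Phi_le1 y ts'.
have mH1 : mC (fun x => (poisson tau x)%:C) by mea.
have mk := mke ts.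
have mH2 : mC (fun x => (s / pi)%:C * ke tau x) by mea.
have [|_ _ _ e1] := @fubini_conv R F lF tau 1 1 _ _ t0 mH1 mP _ PM.
  by move=> x; rewrite normcR mul1r ger0_norm ?poisson_ge0.
have sp : 0 <= s / pi by apply: divr_ge0; [exact: ltW|exact: pi_ge0].
have [|_ _ _ e2] := @fubini_conv R F lF tau (s / pi * (pi / tau)) 1 _ _ t0 mH2 mP _ PM.
  move=> x; rewrite normcM normcR (ger0_norm sp) -mulrA; apply: ler_wpM2l => //.
  rewrite -inv_sqrD_poisson//.
  by have [|h _] := @ke_bnd tau tau x t0; rewrite ?lexx.
rewrite e2 /T /W.
transitivity (Cint (fun t => F t * Cint (fun y => (poisson tau (y - t))%:C * Phi tau y))).
  by congr Cint; apply/funext => t; rewrite (poisson_convE t t0 mP PM).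
rewrite e1; congr Cint; apply/funext => y; congr (_ * _).
(* With this width the lower kernel is the inverse of 2 s - [ze], a function of [ze] alone. *)
have b0 : 0 < 2 * s - tau by lra.
have := poisson_ext_cauchy lF F_pos y t0 b0; rewrite /poisson_ext => ->.
rewrite -CintZ; last first.
  apply: (@L1C_bounded_mul _ F lF _ (tau^-1 + (2 * s - tau)^-1)); first by mea.
  have bd c (z : C) : 0 < c -> re z = c -> normc z^-1 <= c^-1.
    move=> c0 zs; have h := normc_re z; rewrite zs ger0_norm ?(ltW c0)// in h.
    rewrite normcV lef_pV2// posrE//; exact: lt_le_trans h.
  move=> t; apply: (le_trans (ler_normcD _ _)).
  by apply: lerD; apply: bd => //; rewrite !reimE; ring.
congr Cint; apply/funext => t; rewrite mulrCA; congr (_ * _).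
have z1 := ze_neq0 (y - t) ts; have z2 := zec_neq0 (y - t) ts.
have p0 : (pi : R) != 0 by rewrite gt_eqF ?pi_gt0.
have -> : (2 * s - tau)%:C + 'i%C * (y - t)%:C = (2 * s)%:C - ze tau (y - t).
  by rewrite /ze rmorphB/=; ring.
rewrite /ke -[tau%:C - _]/(ze tau (y - t)).
have -> : (s / pi)%:C = ((2 * pi)^-1)%:C * (2 * s)%:C :> C.
  by rewrite -rmorphM/=; congr (_%:C); move: (pi) p0 => q q0; field.
rewrite -!mulrA; congr (_ * _).
move: z1 z2; move: (ze tau (y - t)) ((2 * s)%:C) => A c z1 z2.
by field; rewrite z1 z2.
Qed.

Let T_const a b : 0 < a < s -> 0 < b < s -> T a = T b.
Proof.
move=> ha hb; rewrite (T_strip ha) (T_strip hb); congr Cint; apply/funext => t; congr (_ * _).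
have lp c : 0 < c < s -> L1C (psi t c).
  move=> hc; have /andP[c0 c1] := hc.
  have hc' : 0 <= c <= s by rewrite !ltW.
  apply: (@L1C_le R _ (fun y => pi / c * poisson c (y - t))).
  - have mk : mC (fun y : R => ke c (y - t)) by apply: (mC_comp (mke hc)); mea.
    by apply: mCM => //; exact: mPhi.
  - by apply: L1Z; case: (poisson_int t c0).
  - move=> y; rewrite -inv_sqrD_poisson// normcM.
    have [|h _] := @ke_bnd c c (y - t) c0; first by rewrite lexx.
    rewrite -[leRHS]mulr1; apply: ler_pM; [exact: normc_ge0|exact: normc_ge0|exact: h|exact: Phi_le1].
have e c : 0 < c < s -> Cint (fun y => (s / pi)%:C * ke c (y - t) * Phi c y) = (s / pi)%:C * Cint (psi t c).
  by move=> hc; rewrite -(CintZ _ (lp c hc)); congr Cint; apply/funext => y; rewrite /psi mulrA.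
by rewrite (e a ha) (e b hb) (strip_const t ha hb).
Qed.

(* The integral of Phi times the extension of F over a horizontal line does not depend on its height. *)
Lemma rotate_contour : Cint (fun t => F t * Phi 0 t) = Cint (fun y => poisson_ext F s y * Phi s y).
Proof.
have hs : 0 < s / 2 < s by rewrite divr_gt0//= ltr_pdivrMr// ltr_pMr// ltr1n.
have ss0 : (0 <= (0:R) <= s)%R by apply/andP; split; [exact: lexx|exact: ltW].
have sss : (0 <= s <= s)%R by apply/andP; split; [exact: ltW|exact: lexx].
(* [n.+2] makes the height interior already at n = 0. These heights tend to the lower edge, and s
   minus them to the upper one; both limits are compared with the height s / 2. *)
have hn n : 0 < s * (n.+2%:R)^-1 < s.
  by rewrite mulr_gt0 ?invr_gt0//= gtr_pMr// invf_lt1// ltr1n.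
have cn : s * (n.+2%:R)^-1 @[n --> \oo] --> 0.
  rewrite -(mulr0 s); apply: cvgM; first exact: cvg_cst.
  apply/gtr0_cvgV0; first exact: nearW.
  apply/cvgryPge => A; have := near_natS_ge A; apply: filterS => n h.
  by rewrite (le_trans h)// ler_nat.
have e0 : T 0 = T (s / 2).
  have h : cvgC (fun n => T (s * (n.+2%:R)^-1)) (T 0).
    by apply: T_cvg => // n; have /andP[/ltW-> /ltW->] := hn n.
  apply: cvgC_unique h _; have e (n : nat) : T (s * (n.+2%:R)^-1) = T (s / 2) := T_const (hn n) hs.
  under eq_fun do rewrite e.
  exact: cvgC_cst.
have e1 : T s = T (s / 2).
  have hn' (n : nat) : 0 < s - s * (n.+2%:R)^-1 < s by have /andP[h1 h2] := hn n; rewrite subr_gt0 h2/= ltrBlDr ltrDl.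
  have hc : s - s * (n.+2%:R)^-1 @[n --> \oo] --> s.
    rewrite -[X in _ --> X]subr0; apply: cvgB; [exact: cvg_cst|exact: cn].
  have hi (n : nat) : 0 <= s - s * (n.+2%:R)^-1 <= s by have /andP[/ltW-> /ltW->] := hn' n.
  have h := T_cvg sss hi hc.
  apply: cvgC_unique h _; have e (n : nat) : T (s - s * (n.+2%:R)^-1) = T (s / 2) := T_const (hn' n) hs.
  under eq_fun do rewrite e.
  exact: cvgC_cst.
have [_ _ ->] := poisson_ext_transfer lF s0 (mPhi sss) (fun y => Phi_le1 y sss).
transitivity (T 0); last exact: (etrans e0 (esym e1)).
by congr Cint; apply/funext => t; rewrite W0.
Qed.

End Strip.
End Rotation.

(** * The two phases continued to complex arguments *)

Section PhaseFunctions.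
Variable R : realType.
Local Notation C := R[i].

(** Principal branch of the logarithm, correct for Re z > 0 only; 1 + [zeta] remains there for 0 <=
    tau <= pi/2. *)
Definition clog (z : C) : C := (ln (re z * re z + im z * im z) / 2) +i* atan (im z / re z).

Lemma re_clog z : re (clog z) = ln (re z * re z + im z * im z) / 2. Proof. by []. Qed.
Lemma im_clog z : im (clog z) = atan (im z / re z). Proof. by []. Qed.

Lemma cder_clog (g : R -> C) x a : 0 < re (g x) -> cder g x a ->
  cder (fun y => clog (g y)) x (a / g x).
Proof.
move=> g0 [h1 h2].
have gp : 0 < re (g x) * re (g x) + im (g x) * im (g x).
  by rewrite ltr_pwDl ?mulr_gt0// -expr2 sqr_ge0.
have n0 : re (g x) != 0 by rewrite gt_eqF.
split.
- rewrite /clog; under eq_fun do rewrite reC.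
  apply: der1_eq.
    apply: der1M; last exact: der1_cst.
    by apply: der1_ln => //; apply: der1D; apply: der1M; eassumption.
  cbv beta; rewrite reM reV imV !expr2; field.
  by rewrite gt_eqF.
- rewrite /clog; under eq_fun do rewrite imC.
  apply: der1_eq.
    apply: der1_atan; apply: der1M; first eassumption.
    by apply: der1_inv; [exact: n0|eassumption].
  cbv beta; rewrite imM reV imV !expr2; field.
  by rewrite n0 !gt_eqF.
Qed.

Lemma cvgC_clog (u : nat -> C) l : 0 < re l -> cvgC u l -> cvgC (fun n => clog (u n)) (clog l).
Proof.
move=> l0 [a b].
have gp : 0 < re l * re l + im l * im l.
  by rewrite ltr_pwDl ?mulr_gt0// -expr2 sqr_ge0.
split; rewrite /clog.
- under eq_fun do rewrite reC; rewrite reC.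
  apply: cvgM; last exact: cvg_cst.
  apply: (@continuous_cvg _ _ _ _ _ _ (@ln R)); first exact: continuous_ln.
  by apply: cvgD; apply: cvgM.
- under eq_fun do rewrite imC; rewrite imC.
  apply: (@continuous_cvg _ _ _ _ _ _ (@atan R)); first exact: continuous_atan.
  by apply: cvgM => //; apply: cvgV => //; rewrite gt_eqF.
Qed.

Definition zeta (tau y : R) : C := cexp (- (y%:C + 'i%C * tau%:C)).

Lemma re_zeta tau y : re (zeta tau y) = expR (- y) * cos tau.
Proof.
rewrite /zeta /cexp !reimE.
have -> : - (y + (0 * tau - 1 * 0)) = - y by ring.
have -> : - (0 + (0 * 0 + 1 * tau)) = - tau by ring.
by rewrite cosN; ring.
Qed.

Lemma im_zeta tau y : im (zeta tau y) = - (expR (- y) * sin tau).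
Proof.
rewrite /zeta /cexp !reimE.
have -> : - (y + (0 * tau - 1 * 0)) = - y by ring.
have -> : - (0 + (0 * 0 + 1 * tau)) = - tau by ring.
by rewrite sinN; ring.
Qed.

Lemma zeta_dy tau y : cder (zeta tau) y (- zeta tau y).
Proof.
have h : cder (fun y => - (y%:C + 'i%C * tau%:C)) y (- 1).
  apply: cder_eq; first by apply: cderN; apply: cderD; [apply: cder_real; exact: der1_id|exact: cder_cst].
  by rewrite addr0.
by apply: cder_eq; [exact: cder_cexp h|rewrite mulrN1].
Qed.

Lemma zeta_dtau tau y : cder (zeta^~ y) tau (- 'i%C * zeta tau y).
Proof.
have h : cder (fun tau => - (y%:C + 'i%C * tau%:C)) tau (- 'i%C).
  apply: cder_eq; first by apply: cderN; apply: cderD; [exact: cder_cst|apply: cderM; [exact: cder_cst|apply: cder_real; exact: der1_id]].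
  by rewrite mul0r mulr1 !add0r.
by apply: cder_eq; [exact: cder_cexp h|rewrite mulrC].
Qed.

Lemma zeta_cvg tau y (v u : nat -> R) : v n @[n --> \oo] --> tau -> u n @[n --> \oo] --> y ->
  cvgC (fun n => zeta (v n) (u n)) (zeta tau y).
Proof.
move=> vt uy; apply: cvgC_cexp; apply: cvgCN; apply: cvgCD; first exact: cvgC_real.
by apply: cvgCM; [exact: cvgC_cst|exact: cvgC_real].
Qed.

Lemma pihalf_gt0 : 0 < pi / 2 :> R.
Proof. by apply: divr_gt0 => //; exact: pi_gt0. Qed.

Lemma sin_cos_ge0 (tau : R) : 0 <= tau <= pi / 2 -> 0 <= sin tau /\ 0 <= cos tau.
Proof.
move=> /andP[t0 t1]; have p0 := pihalf_gt0; split.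
  apply: sin_ge0_pi; rewrite t0/= (le_trans t1)//.
  by rewrite ler_pdivrMr// ler_peMr ?pi_ge0// ler1n.
apply: cos_ge0_pihalf; rewrite t1 andbT (le_trans _ t0)//.
by rewrite oppr_le0 ltW.
Qed.

Section FixedMomentum.
Variable k : R.
Hypothesis k0 : 0 <= k.

(** [phiTh] and [phiX] continue exp (- i k e^-y) and exp (i k x(y)) from the real line to y + i tau,
    [zeta] being e^-z. Both keep modulus at most 1 up to tau = pi/2, where [phiTh] becomes real. *)
Definition phiTh (tau y : R) : C := cexp (- ('i%C * k%:C * zeta tau y)).
Definition phiTh' (tau y : R) : C := phiTh tau y * ('i%C * k%:C * zeta tau y).
Definition phiX (tau y : R) : C := cexp (- ('i%C * k%:C * clog (1 + zeta tau y))).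
Definition phiX' (tau y : R) : C :=
  phiX tau y * ('i%C * k%:C * (zeta tau y / (1 + zeta tau y))).

Lemma re_Nik (z : C) : re (- ('i%C * k%:C * z)) = k * im z.
Proof. by rewrite !(reN,reM,imM,rei,imi,reR,imR); ring. Qed.

Lemma im_Nik (z : C) : im (- ('i%C * k%:C * z)) = - (k * re z).
Proof. by rewrite !(imN,reM,imM,rei,imi,reR,imR); ring. Qed.

Lemma normc_ik (z : C) : normc ('i%C * k%:C * z) = k * normc z.
Proof. by rewrite !normcM normci mul1r normcR ger0_norm. Qed.

Lemma re1D (z : C) : re (1 + z) = 1 + re z. Proof. by rewrite reD. Qed.
Lemma im1D (z : C) : im (1 + z) = im z. Proof. by rewrite imD im1 add0r. Qed.

Lemma normc_phiTh tau y : normc (phiTh tau y) = expR (- (k * (expR (- y) * sin tau))).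
Proof.
rewrite /phiTh normc_cexp; congr expR.
by rewrite re_Nik im_zeta; ring.
Qed.

Lemma normc_phiX tau y :
  normc (phiX tau y) = expR (k * atan (- (expR (- y) * sin tau) / (1 + expR (- y) * cos tau))).
Proof.
rewrite /phiX normc_cexp; congr expR.
by rewrite re_Nik im_clog re1D im1D re_zeta im_zeta.
Qed.

Lemma phiTh_le1 tau y : 0 <= tau <= pi / 2 -> normc (phiTh tau y) <= 1.
Proof.
move=> /sin_cos_ge0[s1 _].
by rewrite normc_phiTh expR_le1 oppr_le0 mulr_ge0// mulr_ge0// expR_ge0.
Qed.

Lemma atan_le0 (x : R) : x <= 0 -> atan x <= 0.
Proof. by move=> /(@le_atan R); rewrite atan0. Qed.

Lemma phiX_le1 tau y : 0 <= tau <= pi / 2 -> normc (phiX tau y) <= 1.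
Proof.
move=> /sin_cos_ge0[s1 c1].
rewrite normc_phiX expR_le1 mulr_ge0_le0// atan_le0//.
rewrite mulNr oppr_le0 divr_ge0// ?mulr_ge0 ?expR_ge0//.
by rewrite addr_ge0// mulr_ge0// expR_ge0.
Qed.

Lemma re_1Dzeta tau y : 0 <= tau <= pi / 2 -> 0 < re (1 + zeta tau y).
Proof.
move=> /sin_cos_ge0[s1 c1]; rewrite re1D re_zeta.
by rewrite ltr_pwDl// mulr_ge0// expR_ge0.
Qed.

Lemma phiTh_cvg tau y (v u : nat -> R) : v n @[n --> \oo] --> tau ->
  u n @[n --> \oo] --> y -> cvgC (fun n => phiTh (v n) (u n)) (phiTh tau y).
Proof.
move=> vt uy; apply: cvgC_cexp; apply: cvgCN; apply: cvgCM; first exact: cvgC_cst.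
exact: zeta_cvg.
Qed.

Lemma phiX_cvg tau y (v u : nat -> R) : 0 <= tau <= pi / 2 -> v n @[n --> \oo] --> tau ->
  u n @[n --> \oo] --> y -> cvgC (fun n => phiX (v n) (u n)) (phiX tau y).
Proof.
move=> ts vt uy; apply: cvgC_cexp; apply: cvgCN; apply: cvgCM; first exact: cvgC_cst.
apply: cvgC_clog; first exact: re_1Dzeta.
by apply: cvgCD; [exact: cvgC_cst|exact: zeta_cvg].
Qed.

Lemma phiTh_dy tau y : cder (phiTh tau) y (phiTh' tau y).
Proof.
apply: cder_eq.
  by apply: cder_cexp; apply: cderN; apply: cderM; [exact: cder_cst|exact: zeta_dy].
by rewrite /phiTh' /phiTh; ring.
Qed.

Lemma mulii : 'i%C * 'i%C = -1 :> C.
Proof. by apply: Cext; rewrite !reimE; ring. Qed.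

Lemma phiTh_dtau tau y : cder (phiTh^~ y) tau ('i%C * phiTh' tau y).
Proof.
apply: cder_eq.
  by apply: cder_cexp; apply: cderN; apply: cderM; [exact: cder_cst|exact: zeta_dtau].
by rewrite /phiTh' /phiTh; ring.
Qed.

Lemma phiX_dy tau y : 0 <= tau <= pi / 2 -> cder (phiX tau) y (phiX' tau y).
Proof.
move=> ts; apply: cder_eq.
  apply: cder_cexp; apply: cderN; apply: cderM; first exact: cder_cst.
  apply: cder_clog; first exact: re_1Dzeta.
  by apply: cderD; [exact: cder_cst|exact: zeta_dy].
by rewrite /phiX' /phiX; cbv beta; ring.
Qed.

Lemma phiX_dtau tau y : 0 <= tau <= pi / 2 -> cder (phiX^~ y) tau ('i%C * phiX' tau y).
Proof.
move=> ts; apply: cder_eq.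
  apply: cder_cexp; apply: cderN; apply: cderM; first exact: cder_cst.
  apply: cder_clog; first exact: re_1Dzeta.
  by apply: cderD; [exact: cder_cst|exact: zeta_dtau].
by rewrite /phiX' /phiX; cbv beta; ring.
Qed.

Lemma x_expN_le1 (x : R) : x * expR (- x) <= 1.
Proof.
rewrite expRN -ler_pdivlMr ?invr_gt0 ?expR_gt0// invrK mul1r.
by have := expR_ge1Dx x; lra.
Qed.

Lemma normc_zeta tau y : normc (zeta tau y) = expR (- y).
Proof.
rewrite normc_cexp; congr expR; rewrite !reimE; ring.
Qed.

(** The modulus of the derivative is k e^-y exp (- k e^-y sin tau). With X = k e^-y sin tau, X e^-X
    <= 1 bounds it by 1 / sin tau, and the sine is increasing here. *)
Lemma phiTh'_bnd a : 0 < a -> exists M, forall tau y, a <= tau < pi / 2 -> normc (phiTh' tau y) <= M.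
Proof.
move=> a0; exists (sin a)^-1 => tau y /andP[at_ tp].
have ap : a < pi / 2 by exact: le_lt_trans tp.
have pp : pi / 2 < pi :> R.
  by rewrite ltr_pdivrMr// ltr_pMr ?pi_gt0// ltr1n.
have sa : 0 < sin a by apply: sin_gt0_pi; rewrite a0/=; exact: lt_trans pp.
have np : - (pi / 2) <= 0 :> R by rewrite oppr_le0 ltW// pihalf_gt0.
have st : sin a <= sin tau.
  have ia : a \in `[(- (pi / 2)), (pi / 2)] by rewrite in_itv/= (ltW ap) andbT (le_trans np)// ltW.
  have it : tau \in `[(- (pi / 2)), (pi / 2)].
    by rewrite in_itv/= (ltW tp) andbT (le_trans np)// (le_trans (ltW a0)).
  by move: at_; rewrite le_eqVlt => /orP[/eqP->//|att]; rewrite ltW// ltr_sin.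
rewrite /phiTh' normcM normc_ik normc_zeta normc_phiTh.
rewrite -[leRHS]mul1r ler_pdivlMr//.
apply: le_trans (x_expN_le1 (k * (expR (- y) * sin tau))).
set E := expR (- (k * _)).
have E0 : 0 <= E by exact: expR_ge0.
have K0 : 0 <= k * expR (- y) by rewrite mulr_ge0// expR_ge0.
have -> : E * (k * expR (- y)) * sin a = (k * expR (- y) * E) * sin a by ring.
have -> : k * (expR (- y) * sin tau) * E = (k * expR (- y) * E) * sin tau by ring.
by rewrite ler_wpM2l// mulr_ge0.
Qed.

(** Since [zeta] has nonnegative real part, |zeta| <= |1 + zeta|. *)
Lemma phiX'_bnd tau y : 0 <= tau <= pi / 2 -> normc (phiX' tau y) <= k.
Proof.
move=> ts; have r0 := re_1Dzeta y ts; have /sin_cos_ge0[s1 c1] := ts.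
have n1 : 0 < normc (1 + zeta tau y).
  by rewrite (lt_le_trans r0)// (le_trans (ler_norm _))// normc_re.
rewrite /phiX' normcM normc_ik [normc (_ / _)]normcM normcV.
have h : normc (zeta tau y) / normc (1 + zeta tau y) <= 1.
  rewrite ler_pdivrMr// mul1r.
  rewrite -ler_sqr ?nnegrE ?normc_ge0// !sqr_normc re1D im1D.
  have rz : 0 <= re (zeta tau y) by rewrite re_zeta mulr_ge0// expR_ge0.
  by rewrite lerD2r ler_sqr ?nnegrE ?lerDr// addr_ge0.
have h0 : 0 <= normc (zeta tau y) / normc (1 + zeta tau y).
  by rewrite divr_ge0// normc_ge0.
have := phiX_le1 y ts; have := normc_ge0 (phiX tau y) => p0 p1.
rewrite -[leRHS]mul1r; apply: ler_pM; [exact: p0|exact: mulr_ge0|exact: p1|].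
exact: ler_piMr.
Qed.

Lemma zeta0 y : zeta 0 y = (expR (- y))%:C.
Proof. by apply: Cext; rewrite ?re_zeta ?im_zeta !reimE ?cos0 ?sin0; ring. Qed.

Lemma zeta_pihalf y : zeta (pi / 2) y = - ('i%C * (expR (- y))%:C).
Proof. by apply: Cext; rewrite ?re_zeta ?im_zeta !reimE ?cos_pihalf ?sin_pihalf; ring. Qed.

Lemma phiTh0 y : phiTh 0 y = cis (- (k * expR (- y))).
Proof.
rewrite /phiTh zeta0 [RHS]cisE; congr (cexp _).
by rewrite rmorphN rmorphM/=; ring.
Qed.

Lemma phiTh_pihalf y : phiTh (pi / 2) y = (expR (- (k * expR (- y))))%:C.
Proof.
rewrite /phiTh zeta_pihalf -[RHS]cexpR; congr (cexp _).
rewrite rmorphN rmorphM/=.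
have -> : - ('i%C * k%:C * - ('i%C * (expR (- y))%:C)) = ('i%C * 'i%C) * (k%:C * (expR (- y))%:C) :> C by ring.
by rewrite mulii mulN1r.
Qed.

Lemma phiX0 y : phiX 0 y = cis (k * xcoord y).
Proof.
have e0 : 0 < 1 + expR (- y) by rewrite addr_gt0// expR_gt0.
rewrite /phiX zeta0 [RHS]cisE; congr (cexp _).
have -> : clog (1 + (expR (- y))%:C) = (ln (1 + expR (- y)))%:C.
  apply: Cext.
  - by rewrite re_clog re1D im1D !reR imR mulr0 addr0 lnM ?posrE//; move: (ln _) => l; field.
  - by rewrite im_clog im1D !imR mul0r atan0.
by rewrite /xcoord rmorphM rmorphN/=; ring.
Qed.

Lemma phiX_pihalf y : phiX (pi / 2) y =
  cexp ((- (k * atan (expR (- y)))) +i* (- (k * (ln (1 + expR (- y) ^+ 2) / 2)))).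
Proof.
rewrite /phiX; congr (cexp _); apply: Cext.
- rewrite [RHS]reC re_Nik im_clog re1D im1D re_zeta im_zeta cos_pihalf sin_pihalf mulr0 addr0 divr1 mulr1.
  by rewrite atanN mulrN.
- rewrite [RHS]imC im_Nik re_clog re1D im1D re_zeta im_zeta cos_pihalf sin_pihalf mulr0 addr0 mulr1.
  by rewrite !mulr1 mulrNN -expr2.
Qed.

Variable F : R -> C.
Hypothesis lF : L1C F.
Hypothesis F_pos : forall p, p <= 0 -> cFT F p = 0.

Let open_closed (tau : R) : 0 < tau < pi / 2 -> 0 <= tau <= pi / 2.
Proof. by move=> /andP[/ltW-> /ltW->]. Qed.

Lemma rotate_Th : Cint (fun t => F t * cis (- (k * expR (- t)))) =
  Cint (fun y => poisson_ext F (pi / 2) y * (expR (- (k * expR (- y))))%:C).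
Proof.
rewrite (_ : (fun t => F t * _) = (fun t => F t * phiTh 0 t)); last first.
  by apply/funext => t; rewrite phiTh0.
rewrite [in RHS](_ : (fun y => _) = (fun y => poisson_ext F (pi / 2) y * phiTh (pi / 2) y)); last first.
  by apply/funext => t; rewrite phiTh_pihalf.
apply: (@rotate_contour R (pi / 2) phiTh phiTh' pihalf_gt0 phiTh_le1 _ _ _ _ _ F lF F_pos).
- by move=> tau y v u _ _; exact: phiTh_cvg.
- by move=> tau y _; exact: phiTh_dy.
- by move=> tau y _; exact: phiTh_dtau.
- move=> tau y u _ uy; apply: cvgCM; first by apply: (@phiTh_cvg tau y (fun=> tau)) => //; exact: cvg_cst.
  apply: cvgCM; first exact: cvgC_cst.
  by apply: (@zeta_cvg tau y (fun=> tau)) => //; exact: cvg_cst.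
- exact: phiTh'_bnd.
Qed.

Lemma rotate_X : Cint (fun t => F t * cis (k * xcoord t)) =
  Cint (fun y => poisson_ext F (pi / 2) y * phiX (pi / 2) y).
Proof.
rewrite (_ : (fun t => F t * _) = (fun t => F t * phiX 0 t)); last first.
  by apply/funext => t; rewrite phiX0.
apply: (@rotate_contour R (pi / 2) phiX phiX' pihalf_gt0 phiX_le1 _ _ _ _ _ F lF F_pos).
- by move=> tau y v u ts _; exact: phiX_cvg.
- by move=> tau y /open_closed; exact: phiX_dy.
- by move=> tau y /open_closed; exact: phiX_dtau.
- move=> tau y u /open_closed ts uy.
  have hz : cvgC (fun n => zeta tau (u n)) (zeta tau y).
    by apply: (@zeta_cvg tau y (fun=> tau)) => //; exact: cvg_cst.
  apply: cvgCM; first by apply: (@phiX_cvg tau y (fun=> tau)) => //; exact: cvg_cst.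
  apply: cvgCM; first exact: cvgC_cst.
  apply: cvgCM => //; apply: cvgCV; last by apply: cvgCD => //; exact: cvgC_cst.
  have := re_1Dzeta y ts; apply: contraTneq => ->.
  by rewrite re0 ltxx.
- move=> a a0; exists k => tau y /andP[at_ tp].
  by apply: phiX'_bnd; rewrite (ltW tp) (le_trans (ltW a0)).
Qed.

End FixedMomentum.
End PhaseFunctions.

(** * The substitution k = e^u in integrals against dk / k *)

Section LogarithmicSubstitution.
Variable R : realType.
Local Notation mu := (@lebesgue_measure R).
Variable h : R -> R.
Hypothesis h_cont : forall k, 0 < k -> {for k, continuous h}.
Hypothesis h_ge0 : forall k, 0 < k -> 0 <= h k.

Let q k := h k / k.

Let q_cont k : 0 < k -> {for k, continuous q}.
Proof.
move=> k0; apply: cvgM; first exact: h_cont.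
by apply: cvgV; [rewrite gt_eqF|exact: cvg_id].
Qed.

Let q_ge0 k : 0 < k -> 0 <= q k.
Proof. by move=> k0; rewrite divr_ge0 ?h_ge0// ltW. Qed.

(** The sign [s] lets the same preparation serve k = e^u on [1, oo[ (s = 1) and k = e^-u on ]0, 1]
    (s = -1). *)
Let der_exp (s x : R) : der1 (fun u => expR (s * u)) x (s * expR (s * x)).
Proof. apply: der1_eq; first by der1. by rewrite /=; ring. Qed.

Let exp_cont (s : R) : continuous (fun u : R => expR (s * u)).
Proof. exact: der1_continuous (der_exp s). Qed.

Let derive_exp (s : R) : derive1 (fun u : R => expR (s * u)) = (fun u => s * expR (s * u)).
Proof. by apply/funext => u; rewrite derive1E; have [] := der_exp s u. Qed.

Let derive_exp_cont (s : R) : continuous (derive1 (fun u : R => expR (s * u))).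
Proof. by rewrite derive_exp => u; apply: cvgM; [exact: cvg_cst|exact: exp_cont]. Qed.

Let hexp_cont (s : R) : continuous (fun u : R => h (expR (s * u))).
Proof.
move=> u; apply: (@continuous_comp _ _ _ (fun u => expR (s * u)) h); first exact: exp_cont.
by apply: h_cont; exact: expR_gt0.
Qed.

Let exp_LR (s a b : R) : derivable_oo_LRcontinuous (fun u : R => expR (s * u)) a b.
Proof.
split.
- by move=> x _; have [] := der_exp s x.
- by apply: cvg_at_right_filter; exact: exp_cont.
- by apply: cvg_at_left_filter; exact: exp_cont.
Qed.

(** Substitution is carried out on segments; monotone convergence along increasing unions extends it
    to the unbounded or half-open ranges. *)
Let integral_lim (D E : nat -> set R) (f g : R -> R) :
  nondecreasing_seq D -> nondecreasing_seq E ->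
  (forall n, measurable (D n)) -> (forall n, measurable (E n)) ->
  (forall n, measurable_fun (D n) f) -> (forall n, measurable_fun (E n) g) ->
  (forall n x, D n x -> 0 <= f x) -> (forall n x, E n x -> 0 <= g x) ->
  (forall n, \int[mu]_(x in D n) (f x)%:E = \int[mu]_(x in E n) (g x)%:E)%E ->
  (\int[mu]_(x in \bigcup_n D n) (f x)%:E = \int[mu]_(x in \bigcup_n E n) (g x)%:E)%E.
Proof.
move=> nD nE mD mE mf mg f0 g0 e.
have h1 := @ge0_nondecreasing_set_cvg_integral _ (measurableTypeR R) R D (EFin \o f) mu nD mD
  (fun n => let: conj _ p := measurable_EFinP (D n) f in p (mf n)) (fun n x Dx => f0 n x Dx).
have h2 := @ge0_nondecreasing_set_cvg_integral _ (measurableTypeR R) R E (EFin \o g) mu nE mE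
  (fun n => let: conj _ p := measurable_EFinP (E n) g in p (mg n)) (fun n x Dx => g0 n x Dx).
move: h1; under eq_fun do rewrite e; move=> h1.
exact: cvg_unique h1 h2.
Qed.

Let bigcup_0n : \bigcup_n `[0, n%:R]%classic = `[0, +oo[%classic :> set R.
Proof.
apply/seteqP; split => x /=.
  by move=> [n _ /=]; rewrite !in_itv/= andbT => /andP[].
rewrite in_itv/= andbT => x0; have [N _ H] := near_natS_ge x.
by exists N.+1 => //=; rewrite in_itv/= x0 (H N)/=.
Qed.

Let nd_0n : nondecreasing_seq (fun n => `[0, n%:R]%classic : set R).
Proof.
move=> m n mn; apply/subsetPset => x /=; rewrite !in_itv/= => /andP[-> xm].
by rewrite (le_trans xm)// ler_nat.
Qed.

Lemma integral_log_large :
  (\int[mu]_(k in `[1%R, +oo[) (h k / k)%:E = \int[mu]_(u in `[0%R, +oo[) (h (expR u))%:E)%E.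
Proof.
have eD : \bigcup_n `[1, expR n%:R]%classic = `[1, +oo[%classic :> set R.
  apply/seteqP; split => x /=.
    by move=> [n _ /=]; rewrite !in_itv/= andbT => /andP[].
  rewrite in_itv/= andbT => x1; have [N _ H] := near_natS_ge x.
  exists N.+1 => //=; rewrite in_itv/= x1/= (le_trans (H N _))//=.
  by apply: le_trans (expR_ge1Dx _); rewrite lerDr.
have pos k n : `[1, expR n%:R]%classic k -> 0 < k.
  by rewrite /= in_itv/= => /andP[k1 _]; exact: lt_le_trans k1.
rewrite -eD -bigcup_0n; apply: integral_lim => //.
- move=> m n mn; apply/subsetPset => x /=; rewrite !in_itv/= => /andP[-> xm].
  by rewrite (le_trans xm)// ler_expR ler_nat.
- move=> n; apply: subspace_continuous_measurable_fun => //.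
  by apply: continuous_in_subspaceT => k /set_mem/pos; exact: q_cont.
- move=> n; apply: measurable_funTS; apply: continuous_measurable_fun.
  by have := @hexp_cont 1; under eq_fun do rewrite mul1r.
- by move=> n k /pos; exact: q_ge0.
- by move=> n u _; rewrite h_ge0// expR_gt0.
- move=> n.
  have := @integration_by_substitution_increasing R (fun u => expR (1 * u)) q 0 n%:R (ler0n _ _).
  rewrite mulr0 expR0 mul1r => ->.
  + apply: eq_integral => u _; rewrite derive_exp; congr EFin.
    rewrite -[LHS]/(q (expR (1 * u)) * (1 * expR (1 * u))) /q !mul1r.
    by rewrite divfK// gt_eqF// expR_gt0.
  + by move=> x y _ _ xy; rewrite ltr_expR !mul1r.
  + by move=> x _; exact: derive_exp_cont.
  + by apply/cvg_ex; exists (derive1 (fun u : R => expR (1 * u)) 0); apply: cvg_at_right_filter; exact: derive_exp_cont.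
  + by apply/cvg_ex; exists (derive1 (fun u : R => expR (1 * u)) n%:R); apply: cvg_at_left_filter; exact: derive_exp_cont.
  + exact: exp_LR.
  + by apply: continuous_in_subspaceT => k /set_mem/pos; exact: q_cont.
Qed.

Lemma integral_log_small :
  (\int[mu]_(k in `]0%R, 1%R]) (h k / k)%:E = \int[mu]_(u in `[0%R, +oo[) (h (expR (- u)%R))%:E)%E.
Proof.
have eD : \bigcup_n `[expR (- n%:R), 1]%classic = `]0, 1]%classic :> set R.
  apply/seteqP; split => x /=.
    move=> [n _ /=]; rewrite !in_itv/= => /andP[h1 ->]; rewrite andbT.
    by apply: lt_le_trans h1; exact: expR_gt0.
  rewrite in_itv/= => /andP[x0 x1]; have [N _ H] := near_natS_ge x^-1.
  exists N.+1 => //=; rewrite in_itv/= x1 andbT expRN -[leRHS]invrK.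
  rewrite lef_pV2 ?posrE ?expR_gt0 ?invr_gt0// (le_trans (H N _))//=.
  by apply: le_trans (expR_ge1Dx _); rewrite lerDr.
have pos k n : `[expR (- n%:R), 1]%classic k -> 0 < k.
  by rewrite /= in_itv/= => /andP[k1 _]; apply: lt_le_trans k1; exact: expR_gt0.
rewrite -eD -bigcup_0n; apply: integral_lim => //.
- move=> m n mn; apply/subsetPset => x /=; rewrite !in_itv/= => /andP[xm ->].
  by rewrite andbT (le_trans _ xm)// ler_expR lerN2 ler_nat.
- move=> n; apply: subspace_continuous_measurable_fun => //.
  by apply: continuous_in_subspaceT => k /set_mem/pos; exact: q_cont.
- move=> n; apply: measurable_funTS; apply: continuous_measurable_fun.
  by have := @hexp_cont (-1); under eq_fun do rewrite mulN1r.
- by move=> n k /pos; exact: q_ge0.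
- by move=> n u _; rewrite h_ge0// expR_gt0.
- move=> n.
  have := @integration_by_substitution_decreasing R (fun u => expR (-1 * u)) q 0 n%:R (ler0n _ _).
  rewrite mulr0 expR0 mulN1r => ->.
  + apply: eq_integral => u _; rewrite derive_exp; congr EFin.
    rewrite -[LHS]/(q (expR (-1 * u)) * - (-1 * expR (-1 * u))) /q !mulN1r opprK.
    by rewrite divfK// gt_eqF// expR_gt0.
  + by move=> x y _ _ xy; rewrite ltr_expR !mulN1r ltrN2.
  + by move=> x _; exact: derive_exp_cont.
  + by apply/cvg_ex; exists (derive1 (fun u : R => expR (-1 * u)) 0); apply: cvg_at_right_filter; exact: derive_exp_cont.
  + by apply/cvg_ex; exists (derive1 (fun u : R => expR (-1 * u)) n%:R); apply: cvg_at_left_filter; exact: derive_exp_cont.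
  + exact: exp_LR.
  + by apply: continuous_in_subspaceT => k /set_mem/pos; exact: q_cont.
Qed.

End LogarithmicSubstitution.

(** * Powers near 0 *)

Section PowerIntegrals.
Variable R : realType.
Local Notation mu := (@lebesgue_measure R).
Local Notation C := R[i].
Local Notation pos := (`[0, +oo[%classic : set R).
Local Notation unit01 := (`]0, 1]%classic : set R).

Lemma powR_exp (p b : R) : 0 < p -> p `^ b = expR (b * ln p).
Proof. by move=> p0; rewrite /powR gt_eqF. Qed.

(** With p = e^-u the integrand becomes exp (- b u) on a half line; for b = 0 the same substitution
    leaves the constant 1, which is the divergence of [integral_inv01]. *)
Lemma integral_pow01 (b : R) : 0 < b -> L1 (fun p => \1_unit01 p * p `^ (b - 1)).
Proof.
move=> b0; have mf : measurable_fun setT (fun p : R => p `^ (b - 1)) by exact: measurable_powR.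
apply: (L1_indicP _ mf) => //.
have c1 k : 0 < k -> {for k, continuous (fun k : R => expR (b * ln k))}.
  move=> k0; apply: (@continuous_comp _ _ _ (fun k => b * ln k) expR); last exact: continuous_expR.
  by apply: cvgM; [exact: cvg_cst|exact: continuous_ln].
have := integral_log_small c1 (fun k _ => expR_ge0 _).
rewrite (_ : (\int[mu]_(k in unit01) _ = \int[mu]_(k in unit01) `|k `^ (b - 1)|%:E)%E); last first.
  apply: eq_integral => k /set_mem/=; rewrite in_itv/= => /andP[k0 _].
  rewrite ger0_norm ?powR_ge0// powR_exp// mulrBl mul1r expRB lnK//.
move=> ->.
rewrite (_ : (\int[mu]_(u in pos) _ = \int[mu]_(u in pos) (expR (- (b * u)))%:E)%E); last first.
  by apply: eq_integral => u _; rewrite expRK mulrN.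
rewrite integral_indic_mul (RintE (L1_expN b0)); exact: ltry.
Qed.

Lemma integral_inv01 : (\int[mu]_(p in unit01) (p^-1)%:E = +oo)%E.
Proof.
have c1 k : 0 < k -> {for k, continuous (fun _ : R => 1 : R)} by move=> _; exact: cvg_cst.
have := integral_log_small c1 (fun k _ => ler01).
rewrite (_ : (\int[mu]_(k in unit01) _ = \int[mu]_(k in unit01) (k^-1)%:E)%E); last first.
  by apply: eq_integral => k _; rewrite mul1r.
move=> ->; rewrite integral_cst//=.
by rewrite mul1e lebesgue_measure_itv/= ltry.
Qed.

(** A majorant of p^(b - 1) exp (- c p) for b <= 1: the first term carries the singularity at 0, the
    second the decay at infinity. *)
Definition spectral_dom (b c p : R) : R := \1_unit01 p * p `^ (b - 1) + \1_pos p * expR (- (c * p)).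

Lemma L1_spectral_dom b c : 0 < b -> 0 < c -> L1 (spectral_dom b c).
Proof. by move=> b0 c0; apply: L1D; [exact: integral_pow01|exact: L1_expN]. Qed.

Lemma powR_ge1_le1 (p b : R) : 1 <= p -> b <= 0 -> p `^ b <= 1.
Proof.
move=> p1 b0; rewrite powR_exp ?(lt_le_trans ltr01)// expR_le1.
by rewrite mulr_le0_ge0// ln_ge0.
Qed.

Lemma le_spectral_dom (b c p : R) : b <= 1 -> 0 < c -> 0 < p ->
  p `^ (b - 1) * expR (- (c * p)) <= spectral_dom b c p.
Proof.
move=> b1 c0 p0; rewrite /spectral_dom.
have -> : \1_pos p = 1 :> R by apply: indic_in; rewrite /= in_itv/= (ltW p0).
rewrite mul1r; have [p1|/ltW p1] := leP p 1.
  have -> : \1_unit01 p = 1 :> R by apply: indic_in; rewrite /= in_itv/= p0.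
  rewrite mul1r -[leLHS]addr0 lerD ?expR_ge0// ler_piMr ?powR_ge0// expR_le1 oppr_le0.
  by rewrite mulr_ge0// ltW.
rewrite -[leLHS]add0r lerD ?mulr_ge0 ?indic_ge0 ?powR_ge0// ler_piMl ?expR_ge0//.
by apply: powR_ge1_le1 => //; rewrite subr_le0.
Qed.

Lemma spectral_dom_ge0 b c p : 0 <= spectral_dom b c p.
Proof. by rewrite /spectral_dom addr_ge0// mulr_ge0 ?indic_ge0 ?powR_ge0 ?expR_ge0. Qed.

End PowerIntegrals.

(** * The rotated phases compared for large and small momentum *)

Section RotatedComparison.
Variable R : realType.
Local Notation C := R[i].

(** Apart from the sign of atan, each bound compares derivatives, through the helper [d]: the
    difference of the two sides vanishes at 0 and increases. On [0, 1] the derivative of atan is at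
    least 1/2. *)
Lemma atan_bounds (z : R) : 0 <= z ->
  [/\ 0 <= atan z, atan z <= z, z - atan z <= z ^+ 2 & (z <= 1 -> z / 2 <= atan z)].
Proof.
move=> z0.
have d (f g : R -> R) (fg : forall x, der1 f x (g x)) (y : R) : 0 <= y -> (forall x, 0 <= x <= y -> 0 <= g x) -> f 0 <= f y.
  move=> y0 gp.
  have [|c cy e] := @MVT_segment R f g 0 y y0 (fun x _ => fg x).
    by apply: derivable_within_continuous => x _; have [] := fg x.
  by rewrite -subr_ge0 e mulr_ge0 ?subr_ge0// gp.
have da x : der1 (@atan R) x ((1 + x ^+ 2)^-1).
  by apply: der1_eq; [apply: (@der1_atan R (fun y => y)); exact: der1_id|rewrite mul1r].
have p1 (x : R) : 0 < 1 + x ^+ 2 by rewrite ltr_wpDr ?sqr_ge0.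
have a0 : 0 <= atan z by rewrite -[leLHS](@atan0 R); exact: le_atan.
split => //.
- have := d (fun x => x - atan x) (fun x => 1 - (1 + x ^+ 2)^-1) _ z z0.
  rewrite atan0 subr0 subr_ge0; apply.
    by move=> x; apply: der1B; [exact: der1_id|exact: da].
  by move=> x _; rewrite subr_ge0 invf_le1// lerDl sqr_ge0.
- have := d (fun x => x * x - (x - atan x)) (fun x => (1 * x + x * 1) - (1 - (1 + x ^+ 2)^-1)) _ z z0.
  rewrite atan0 subr0 mulr0 subrr subr_ge0 -expr2; apply.
    by move=> x; apply: der1B; [apply: der1M; exact: der1_id|apply: der1B; [exact: der1_id|exact: da]].
  move=> x /andP[x0 _]; rewrite mul1r mulr1.
  have -> : 1 - (1 + x ^+ 2)^-1 = x * (x * (1 + x ^+ 2)^-1) by field; rewrite gt_eqF.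
  have : x * (1 + x ^+ 2)^-1 <= 1 by rewrite ler_pdivrMr//; have := sqr_ge0 (x - 1); nra.
  by nra.
- move=> z1; have := d (fun x => atan x - x * 2^-1) (fun x => (1 + x ^+ 2)^-1 - (1 * 2^-1 + x * 0)) _ z z0.
  rewrite atan0 mul0r subr0 subr_ge0; apply.
    by move=> x; apply: der1B; [exact: da|apply: der1M; [exact: der1_id|exact: der1_cst]].
  move=> x /andP[x0 xz]; rewrite mulr0 addr0 mul1r subr_ge0 lef_pV2 ?posrE//.
  have : x <= 1 by exact: le_trans xz z1.
  by rewrite (_ : 2 = 1 + 1 :> R)// lerD2l => x1; rewrite expr_le1.
Qed.

Lemma ln1p_sqr_bounds (z : R) : 0 <= ln (1 + z ^+ 2) <= z ^+ 2.
Proof.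
have p1 : 0 < 1 + z ^+ 2 by rewrite ltr_wpDr ?sqr_ge0.
rewrite ln_ge0/= ?lerDl ?sqr_ge0//.
by have := expR_ge1Dx (ln (1 + z ^+ 2)); rewrite lnK ?posrE//; lra.
Qed.

Lemma sqr_expN_le (x : R) : 0 <= x -> x ^+ 2 * expR (- x) <= 4.
Proof.
move=> x0; have h := x_expN_le1 (x / 2).
have -> : expR (- x) = expR (- (x / 2)) ^+ 2.
  by rewrite expr2 -expRD; congr expR; field.
have e0 := expR_ge0 (- (x / 2)).
have p0 : 0 <= x / 2 * expR (- (x / 2)) by rewrite mulr_ge0// divr_ge0.
have -> : x ^+ 2 * expR (- (x / 2)) ^+ 2 = 4 * (x / 2 * expR (- (x / 2))) ^+ 2 by field.
by rewrite ler_piMr// expr_le1.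
Qed.

(** With z = e^-y, [phiX] at height pi/2 is exp (- k atan z - i k ln (1 + z^2) / 2). For z <= 1 the
    defects of modulus and of phase are both O(k z^2), damped by exp (- k z / 2); the constant is 8
    times the 4 of [sqr_expN_le]. For z > 1, atan z >= 1/2, and both exponentials are themselves
    O(1/k). *)
Lemma phiX_Th_close (k y : R) : 0 < k ->
  normc (phiX k (pi / 2) y - (expR (- (k * expR (- y))))%:C) <= 32 / k.
Proof.
move=> k0; rewrite phiX_pihalf /cexp reC imC.
set z := expR (- y); have z0 : 0 < z by exact: expR_gt0.
have [a0 az zaz za2] := atan_bounds (ltW z0).
have /andP[l0 lz] := ln1p_sqr_bounds z.
set L := ln _ / 2; have L0 : 0 <= L by rewrite divr_ge0.
have Lz : L <= z ^+ 2 / 2 by rewrite ler_pM2r.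
set E := expR (- (k * atan z)).
have E0 : 0 <= E by exact: expR_ge0.
have -> : E%:C * cis (- (k * L)) - (expR (- (k * z)))%:C =
  E%:C * (cis (- (k * L)) - cis 0) + (E - expR (- (k * z)))%:C.
  by rewrite rmorphB/= cis0; ring.
apply: (le_trans (ler_normcD _ _)); rewrite normcM !normcR (ger0_norm E0).
have h1 : normc (cis (- (k * L)) - cis 0) <= 2 * (k * L).
  by apply: (le_trans (normc_cisB _ _)); rewrite subr0 normrN ger0_norm// mulr_ge0// ltW.
have kz : k * atan z <= k * z by rewrite ler_pM2l.
have Ez : expR (- (k * z)) <= E by rewrite ler_expR lerN2.
rewrite (ger0_norm (_ : 0 <= E - expR (- (k * z)))) ?subr_ge0//.
have [z1|z1] := leP z 1.
  have h2 : E - expR (- (k * z)) <= E * (k * z ^+ 2).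
    have -> : expR (- (k * z)) = E * expR (- (k * (z - atan z))).
      by rewrite -expRD; congr expR; ring.
    have := expR_ge1Dx (- (k * (z - atan z))) => h.
    have : k * (z - atan z) <= k * z ^+ 2 by rewrite ler_pM2l.
    by nra.
  have h3 : E <= expR (- (k * z / 2)).
    by rewrite ler_expR lerN2 -mulrA ler_pM2l// za2.
  have h4 := sqr_expN_le (divr_ge0 (mulr_ge0 (ltW k0) (ltW z0)) (ler0n _ 2)).
  have h5 : E * normc (cis (- (k * L)) - cis 0) <= E * (k * z ^+ 2).
    by rewrite ler_wpM2l// (le_trans h1)//; nra.
  apply: (le_trans (lerD h5 h2)).
  have -> : E * (k * z ^+ 2) + E * (k * z ^+ 2) = 8 / k * ((k * z / 2) ^+ 2 * E).
    by field; rewrite gt_eqF.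
  have -> : 32 / k = 8 / k * 4 by ring.
  rewrite ler_wpM2l ?divr_ge0 ?(ltW k0)//; apply: le_trans h4.
  by rewrite ler_wpM2l// sqr_ge0.
have a1 : 2^-1 <= atan z.
  have [_ _ _ h] := atan_bounds (ler01 : 0 <= 1 :> R).
  have := h (lexx _); rewrite mul1r => /le_trans; apply.
  by apply: le_atan; exact: ltW.
have h3 : E <= 2 / k.
  have : E <= expR (- (k / 2)) by rewrite ler_expR lerN2 ler_pM2l.
  have := x_expN_le1 (k / 2) => h4 h5.
  rewrite ler_pdivlMr//; nra.
have h6 : normc (cis (- (k * L)) - cis 0) <= 2.
  by apply: (le_trans (ler_normcB _ _)); rewrite !normc_cis.
have h7 : E - expR (- (k * z)) <= E by rewrite gerBl expR_ge0.
have h8 : E * normc (cis (- (k * L)) - cis 0) <= E * 2 by rewrite ler_wpM2l.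
apply: (le_trans (lerD h8 h7)).
have -> : 32 / k = 16 * (2 / k) by ring.
by nra.
Qed.

(** The exponents differ by k atan z <= k pi / 2 in the real part and by k (L + min (y, 0)) in the
    imaginary part, where L = ln (1 + e^(-2 y)) / 2 exceeds max (- y, 0) by at most 1. The factor 3
    is the Lipschitz constant of [normc_cexpB]. *)
Lemma phiX_small (k y : R) : 0 < k ->
  normc (phiX k (pi / 2) y - cis (k * Num.min y 0)) <= 3 * (k * (pi / 2 + 1)).
Proof.
move=> k0; rewrite phiX_pihalf.
set z := expR (- y); have z0 : 0 < z by exact: expR_gt0.
have [a0 _ _ _] := atan_bounds (ltW z0).
have ap : atan z <= pi / 2 by apply: ltW; exact: atan_ltpi2.
set L := ln _ / 2.
have Lb : 0 <= L + Num.min y 0 <= 1.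
  have [y0|y0] := leP y 0.
    have -> : L + y = ln (1 + (z^-1) ^+ 2) / 2.
      rewrite /L; have -> : 1 + z ^+ 2 = z ^+ 2 * (1 + z^-1 ^+ 2) by field; rewrite gt_eqF.
      have p1 : 0 < 1 + z^-1 ^+ 2 by rewrite ltr_wpDr ?sqr_ge0.
      rewrite lnM ?posrE ?exprn_gt0// expr2 lnM ?posrE// /z expRK.
      by field.
    have /andP[l0 l1] := ln1p_sqr_bounds z^-1.
    rewrite divr_ge0//= ler_pdivrMr// mul1r (le_trans l1)//.
    have : z^-1 <= 1 by rewrite invf_le1// /z -[leLHS]expR0 ler_expR oppr_ge0.
    have : 0 <= z^-1 by rewrite invr_ge0 ltW.
    by nra.
  rewrite addr0; have /andP[l0 l1] := ln1p_sqr_bounds z.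
  rewrite divr_ge0//= ler_pdivrMr// mul1r (le_trans l1)//.
  have : z <= 1 by rewrite expR_le1 oppr_le0 ltW.
  by nra.
have /andP[b0 b1] := Lb.
rewrite cisE.
set w := 'i%C * _; set v : C := _ +i* _.
have rw : re w = 0 by rewrite /w !reimE; ring.
have iw : im w = k * Num.min y 0 by rewrite /w !reimE; ring.
apply: (le_trans (normc_cexpB _ _)).
- by rewrite /v reC oppr_le0 mulr_ge0// ltW.
- by rewrite rw.
rewrite ler_wpM2l// (le_trans (normc_le _))// !(reD,imD,reN,imN) rw iw /v reC imC.
rewrite mulrDr mulr1; apply: lerD.
  by rewrite oppr0 addr0 normrN ger0_norm ?mulr_ge0 ?(ltW k0)// ler_pM2l.
rewrite -opprD normrN -mulrDr ger0_norm ?mulr_ge0 ?(ltW k0)//.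
by rewrite ler_piMr// ltW.
Qed.

End RotatedComparison.

(** * Spectral representation of the amplitudes *)

Section HalfLine.
Variable R : realType.
Local Notation C := R[i].
Local Notation pos := (`[0, +oo[%classic : set R).

(* Abel regularisation exp (- y / n) makes the order of integration interchangeable. *)
Lemma half_line (r : R -> C) (th : R -> R) : L1C r -> measurable_fun setT th ->
  (forall p, th p = 0 -> r p = 0) ->
  L1C (fun p => r p * ((th p)^-1)%:C) ->
  L1C (fun y => Cint (fun p => r p * cis (th p * y))) ->
  Cint (fun y => (\1_pos y)%:C * Cint (fun p => r p * cis (th p * y))) =
  Cint (fun p => r p * ('i%C * ((th p)^-1)%:C)).
Proof.
move=> lr mth r0 lrth lg; have mr := L1C_meas lr.
set g := fun y => Cint (fun p => r p * cis (th p * y)).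
have mg : mC g by exact: L1C_meas lg.
pose e n : R := n.+1%:R^-1.
have e0 n : 0 < e n by rewrite invr_gt0.
have mr2 : mC (fun z : R * R => r z.2) by apply: (mC_comp mr); exact: measurable_snd.
have mth2 : measurable_fun setT (fun z : R * R => th z.2).
  by apply: (measurableT_comp mth); exact: measurable_snd.
have lrc y : L1C (fun p => r p * cis (th p * y)) by apply: L1C_cis => //; mea.
have key n : Cint (fun y => (\1_pos y * expR (- (e n * y)))%:C * g y) =
             Cint (fun p => r p * ((e n)%:C - 'i%C * (th p)%:C)^-1).
  pose k y p := (\1_pos y * expR (- (e n * y)))%:C * (r p * cis (th p * y)).
  have mk : mC (fun z : R * R => k z.1 z.2) by rewrite /k; mea.
  have [|_ _ h] := @fubini_Cint_prod R k _ _ mk (L1_expN (e0 n)) (L1C_norm lr).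
    move=> y p; rewrite /k !normcM normc_cis mulr1 normcR.
    by rewrite (ger0_norm (mulr_ge0 (indic_ge0 _ _) (expR_ge0 _))).
  transitivity (Cint (fun y => Cint (k y))).
    by congr Cint; apply/funext => y; rewrite /k (CintZ _ (lrc y)).
  rewrite h; congr Cint; apply/funext => p.
  rewrite -(Cint_halfline (th p) (e0 n)) -CintZ; last first.
    apply: (@L1C_cis R (fun y => (\1_pos y * expR (- (e n * y)))%:C)); first exact: (L1C_real (L1_expN (e0 n))).
    by mea.
  by congr Cint; apply/funext => y; rewrite /k mulrCA.
have [|||||_ h1] := @dominated_Cint R (fun n y => (\1_pos y * expR (- (e n * y)))%:C * g y)
  (fun y => (\1_pos y)%:C * g y) (fun y => normc (g y)).
- by move=> n; mea.
- by mea.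
- exact: L1C_norm.
- move=> y; apply: cvgCM; last exact: cvgC_cst.
  apply: cvgC_real; rewrite -[X in _ --> X]mulr1; apply: cvgM; first exact: cvg_cst.
  rewrite -(expR0 R) -oppr0 -(mul0r y).
  apply: continuous_cvg; first exact: continuous_expR.
  by apply: cvgN; apply: cvgM; [exact: cvg_natSV|exact: cvg_cst].
- move=> n y; rewrite normcM normcR ler_piMl ?normc_ge0// normrM (ger0_norm (expR_ge0 _)).
  have [y0|y0] := pselect (pos y).
    rewrite (indic_in y0) normr1 mul1r expR_le1 oppr_le0 mulr_ge0 ?(ltW (e0 n))//.
    by move: y0; rewrite /= in_itv/= andbT.
  by rewrite (indic_out y0) normr0 mul0r.
have [|||||_ h2] := @dominated_Cint R (fun n p => r p * ((e n)%:C - 'i%C * (th p)%:C)^-1)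
  (fun p => r p * ('i%C * ((th p)^-1)%:C)) (fun p => normc (r p * ((th p)^-1)%:C)).
- by move=> n; mea.
- by mea.
- exact: L1C_norm.
(* At a zero of [th] the inverse has the default value 0 while the regularised kernel is unbounded
   in n; there [r] vanishes. *)
- move=> p; have [t0|t0] := eqVneq (th p) 0.
    rewrite (r0 _ t0) mul0r; under eq_fun do rewrite mul0r; exact: cvgC_cst.
  apply: cvgCM; first exact: cvgC_cst.
  have -> : 'i%C * ((th p)^-1)%:C = (0 - 'i%C * (th p)%:C)^-1.
    apply: Cext; rewrite !(reM,imM,reV,imV,reD,imD,reN,imN) !reimE.
      by rewrite !(mul0r,mulr0,mul1r,subr0,sub0r,addr0,add0r,oppr0).
    rewrite !(mul0r,mulr0,mul1r,subr0,sub0r,addr0,add0r,oppr0,sqrrN,mulNr,opprK).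
    by rewrite expr0n/= add0r; field.
  apply: cvgCV.
    rewrite sub0r oppr_eq0; apply/eqP => /(congr1 (@im R)); rewrite !reimE.
    by rewrite mul0r mul1r add0r => /eqP; rewrite (negbTE t0).
  apply: cvgCB; last exact: cvgC_cst.
  by have := cvgC_real (@cvg_natSV R); rewrite rmorph0.
- move=> n p; have [t0|t0] := eqVneq (th p) 0.
    by rewrite (r0 _ t0) !mul0r.
  rewrite !normcM ler_wpM2l ?normc_ge0// normcV normcR normrV ?unitfE//.
  have h : `|th p| <= normc ((e n)%:C - 'i%C * (th p)%:C).
    apply: le_trans (normc_im _); rewrite !reimE.
    by rewrite mul0r mul1r !add0r normrN.
  by rewrite lef_pV2 ?posrE ?normr_gt0// (lt_le_trans _ h)// normr_gt0.
apply: cvgC_unique h1 _; under eq_fun do rewrite key.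
exact: h2.
Qed.

End HalfLine.

Lemma pihalf_itv (R : realType) : (0 : R) <= (pi / 2 : R) <= (pi / 2 : R).
Proof. by rewrite lexx andbT; exact/ltW/pihalf_gt0. Qed.

(** * The amplitudes and the spectrum on the line Im = pi/2 *)

Section SpectralRepresentation.
Variable R : realType.
Local Notation mu := (@lebesgue_measure R).
Local Notation C := R[i].
Local Notation pos := (`[0, +oo[%classic : set R).
Variables (F : R -> C) (a B : R).
Hypothesis lF : L1C F.
Hypothesis F_pos : forall p, p <= 0 -> cFT F p = 0.
Hypothesis a_gt0 : 0 < a.
Hypothesis a_le1 : a <= 1.
Hypothesis F_bnd : forall p, 0 < p -> normc (cFT F p) <= B * p `^ a.

(** The two amplitudes without the factor (2 pi)^(-1/2), which returns in [check_sqnormE] and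
    [checkTh_sqnormE]. *)
Definition FX (k : R) : C := Cint (fun t => F t * cis (k * xcoord t)).
Definition FTh (k : R) : C := Cint (fun t => F t * cis (- (k * expR (- t)))).
(** Up to 1/(2 pi), the spectrum of the extension [f1] on the line Im = pi/2
    ([poisson_ext_shifted]). The transform of [F] is only known to be bounded at infinity; the
    exponential makes the product integrable. *)
Definition shifted_spectrum (p : R) : C := (\1_pos p * expR (- (pi / 2 * p)))%:C * cFT F p.
Local Notation r := shifted_spectrum.
Local Notation f1 := (poisson_ext F (pi / 2)).
Local Notation c0 := ((2 * pi)^-1%R)%:C.

Lemma normc_F_bnd (th : R -> R) : measurable_fun setT th ->
  normc (Cint (fun t => F t * cis (th t))) <= 2 * Rint (fun t => normc (F t)).
Proof.
move=> mth; apply: normc_Cint_le.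
- by apply: L1C_meas; exact: L1C_cis.
- exact: L1C_norm.
- by move=> t; rewrite normcM normc_cis mulr1.
Qed.

Lemma measurable_xcoord : measurable_fun setT (@xcoord R).
Proof.
apply: measurable_comp_opp; apply: (measurableT_comp (@measurable_ln R)); mea.
Qed.

Lemma normc_FX k : normc (FX k) <= 2 * Rint (fun t => normc (F t)).
Proof. by apply: normc_F_bnd; apply: measurable_funM => //; exact: measurable_xcoord. Qed.

Lemma normc_FTh k : normc (FTh k) <= 2 * Rint (fun t => normc (F t)).
Proof. by apply: normc_F_bnd; mea. Qed.

Lemma mC_shifted_spectrum : mC r.
Proof. by have := mC_cFT lF => mF; rewrite /shifted_spectrum; mea. Qed.

Lemma shifted_spectrum_out p : p <= 0 -> r p = 0.
Proof. by move=> p0; rewrite /shifted_spectrum F_pos// mulr0. Qed.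

Lemma normc_shifted_spectrum p : normc (r p) = \1_pos p * expR (- (pi / 2 * p)) * normc (cFT F p).
Proof.
by rewrite normcM normcR (ger0_norm (mulr_ge0 (indic_ge0 _ _) (expR_ge0 _))).
Qed.

Lemma L1C_shifted_spectrum : L1C r.
Proof.
have l := L1Z (2 * Rint (fun t => normc (F t))) (L1_expN (pihalf_gt0 R)).
apply: (L1C_le mC_shifted_spectrum l) => p.
rewrite normc_shifted_spectrum mulrC; apply: ler_wpM2r; last exact: normc_cFT.
by rewrite mulr_ge0 ?indic_ge0 ?expR_ge0.
Qed.

Lemma poisson_ext_shifted y : f1 y = c0 * Cint (fun p => r p * cis (p * y)).
Proof.
rewrite (poisson_ext_fourier lF F_pos y (pihalf_gt0 R)); congr (_ * _).
by congr Cint; apply/funext => p; rewrite /shifted_spectrum (mulrC y); ring.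
Qed.

Lemma L1C_f1 : L1C f1.
Proof. exact: (@L1C_poisson_ext R F lF (pi / 2) (pihalf_gt0 R)). Qed.

Lemma B_ge0 : 0 <= B.
Proof. by have := le_trans (normc_ge0 _) (F_bnd ltr01); rewrite powR1 mulr1. Qed.

Lemma FX_FTh_close : exists K, forall k, 0 < k -> normc (FX k - FTh k) <= K / k.
Proof.
(* 64 is the 32 of [phiX_Th_close] times the 2 of [normc_Cint_le]. *)
exists (64 * Rint (fun y => normc (f1 y))) => k k0.
have lf := L1C_f1; have mf := L1C_meas lf.
rewrite /FX /FTh (rotate_X (ltW k0) lF F_pos) (rotate_Th (ltW k0) lF F_pos).
have mX : mC (phiX k (pi / 2)).
  apply: mC_continuous => y u uy.
  have ts := pihalf_itv R.
  by apply: (@phiX_cvg R k (pi / 2) y (fun=> pi / 2)) => //; exact: cvg_cst.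
have mT : mC (fun y : R => (expR (- (k * expR (- y))))%:C : C) by mea.
have ts := pihalf_itv R.
have l1 : L1C (fun y => f1 y * phiX k (pi / 2) y).
  by apply: (@L1C_bounded_mul R f1 lf _ 1 mX) => y; apply: phiX_le1 => //; exact: ltW.
have l2 : L1C (fun y => f1 y * (expR (- (k * expR (- y))))%:C).
  apply: (@L1C_bounded_mul R f1 lf _ 1 mT) => y; rewrite normcR (ger0_norm (expR_ge0 _)).
  by rewrite expR_le1 oppr_le0 mulr_ge0 ?expR_ge0// ltW.
rewrite -CintB//.
have -> : 64 * Rint (fun y => normc (f1 y)) / k = 2 * Rint (fun y => 32 / k * normc (f1 y)).
  by rewrite RintZ; [field; rewrite gt_eqF|exact: L1C_norm].
apply: normc_Cint_le.
- by apply: L1C_meas; exact: L1CB.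
- by apply: L1Z; exact: L1C_norm.
- move=> y; rewrite -mulrBr normcM mulrC; apply: ler_wpM2r; first exact: normc_ge0.
  exact: phiX_Th_close.
Qed.

Lemma normc_div_spectrum p : normc (r p * (p^-1)%:C) <= B * spectral_dom a (pi / 2) p.
Proof.
have [p0|p0] := leP p 0.
  by rewrite (shifted_spectrum_out p0) mul0r normc0 mulr_ge0 ?B_ge0 ?spectral_dom_ge0.
rewrite normcM normc_shifted_spectrum normcR ger0_norm ?invr_ge0 ?(ltW p0)//.
have -> : \1_pos p = 1 :> R by apply: indic_in; rewrite /= in_itv/= (ltW p0).
apply: le_trans (ler_wpM2l B_ge0 (le_spectral_dom a_le1 (pihalf_gt0 R) p0)).
have -> : p `^ (a - 1) = p `^ a * p^-1.
  by rewrite !powR_exp// mulrBl mul1r expRB lnK.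
rewrite mul1r mulrC; have := F_bnd p0 => h.
have -> : B * (p `^ a / p * expR (- (pi / 2 * p))) = p^-1 * (expR (- (pi / 2 * p)) * (B * p `^ a)) by ring.
by rewrite ler_wpM2l ?invr_ge0 ?(ltW p0)// ler_wpM2l ?expR_ge0.
Qed.

Lemma L1C_div_spectrum : L1C (fun p => r p * (p^-1)%:C).
Proof.
have m := mC_shifted_spectrum.
apply: (L1C_le _ (L1Z B (L1_spectral_dom a_gt0 (pihalf_gt0 R)))); last exact: normc_div_spectrum.
apply: mCM => //; apply: mC_real; exact: measurable_inv.
Qed.

End SpectralRepresentation.

(** * Behaviour for small momentum and the thermal spectrum *)

Section SpectralAsymptotics.
Variable R : realType.
Local Notation mu := (@lebesgue_measure R).
Local Notation C := R[i].
Local Notation pos := (`[0, +oo[%classic : set R).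
Variables (F : R -> C) (a B : R).
Hypothesis lF : L1C F.
Hypothesis F_pos : forall p, p <= 0 -> cFT F p = 0.
Hypothesis a_gt0 : 0 < a.
Hypothesis a_le1 : a <= 1.
Hypothesis F_bnd : forall p, 0 < p -> normc (cFT F p) <= B * p `^ a.
Local Notation r := (shifted_spectrum F).
Local Notation f1 := (poisson_ext F (pi / 2)).
Local Notation c0 := ((2 * pi)^-1%R)%:C.

Let lr : L1C r := L1C_shifted_spectrum lF.
Let mr : mC r := mC_shifted_spectrum lF.
Let lf1 : L1C f1 := L1C_f1 lF.
Let mf1 : mC f1 := L1C_meas lf1.
Let rp p : C := c0 * r p.

Let lrp : L1C rp.
Proof. exact: L1CZ lr. Qed.

Let rp_out p : p <= 0 -> rp p = 0.
Proof. by move=> p0; rewrite /rp shifted_spectrum_out// mulr0. Qed.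

Let f1E y : f1 y = Cint (fun p => rp p * cis (p * y)).
Proof.
rewrite (poisson_ext_shifted lF F_pos) -CintZ; last by apply: L1C_cis => //; mea.
by congr Cint; apply/funext => p; rewrite /rp mulrA.
Qed.

Let ld : L1C (fun p => rp p * (p^-1)%:C).
Proof.
have := L1CZ c0 (L1C_div_spectrum lF F_pos a_gt0 a_le1 F_bnd).
by congr (L1C _); apply/funext => p; rewrite /rp mulrA.
Qed.

Let minv (h : R -> R) : measurable_fun setT h -> mC (fun p => (h p)^-1%:C : C).
Proof. by move=> mh; apply: mC_real; exact: measurable_comp_inv. Qed.

Let ldk k : 0 <= k -> L1C (fun p => rp p * ((p + k)^-1)%:C).
Proof.
move=> k0; apply: (L1C_le _ (L1C_norm ld)).
  apply: mCM; first exact: L1C_meas lrp.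
  by apply: minv; mea.
move=> p; have [p0|p0] := leP p 0; first by rewrite rp_out// !mul0r.
have pk : 0 < p + k by rewrite ltr_wpDr.
rewrite !(normcM (rp p)); apply: ler_wpM2l; first exact: normc_ge0.
rewrite !normcR (ger0_norm (_ : 0 <= (p + k)^-1)) ?invr_ge0 ?(ltW pk)//.
by rewrite (ger0_norm (_ : 0 <= p^-1)) ?invr_ge0 ?(ltW p0)// lef_pV2 ?posrE// lerDl.
Qed.

(** Characters are eigenfunctions of convolution with the Poisson kernel, so the transform of [f1]
    at - k is a multiple of that of [F], which is 0. *)
Lemma poisson_ext_negative k : 0 <= k -> Cint (fun y => f1 y * cis (k * y)) = 0.
Proof.
move=> k0.
have mc : mC (fun y : R => cis (k * y)) by mea.
have [|_ _ ->] := @poisson_ext_transfer R F lF (pi / 2) 1 _ (pihalf_gt0 R) mc.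
  by move=> y; rewrite normc_cis.
have lq : L1C (fun v => (poisson 1 v)%:C * cis (k * (pi / 2 * v)) : C).
  by apply: L1C_cis; [apply: L1C_real; case: (poisson1_int R)|mea].
transitivity (Cint (fun t => F t * cis (- (- k * t)) * Cint (fun v => (poisson 1 v)%:C * cis (k * (pi / 2 * v))))).
  congr Cint; apply/funext => t; rewrite -mulrA; congr (_ * _).
  rewrite -CintZ//; congr Cint; apply/funext => v.
  by rewrite mulNr opprK mulrDr cisD; ring.
rewrite CintZr; last by apply: L1C_cis => //; mea.
by rewrite -/(cFT F (- k)) F_pos ?mul0r// oppr_le0.
Qed.

Let half_lineD k : 0 <= k -> Cint (fun y => (\1_pos y)%:C * (f1 y * cis (k * y))) =
  Cint (fun p => rp p * ('i%C * ((p + k)^-1)%:C)).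
Proof.
move=> k0.
have e : (fun y => f1 y * cis (k * y)) = (fun y => Cint (fun p => rp p * cis ((p + k) * y))).
  apply/funext => y; rewrite f1E -CintZr; last by apply: L1C_cis => //; mea.
  by congr Cint; apply/funext => p; rewrite mulrDl cisD mulrA.
have h := @half_line R rp (fun p => p + k) lrp.
rewrite -h.
- by congr Cint; apply/funext => y; congr (_ * _); rewrite -[LHS]/((fun y => f1 y * cis (k * y)) y) e.
- by mea.
- by move=> p pk; apply: rp_out; have := k0; lra.
- exact: ldk.
- by rewrite -e; apply: L1C_cis => //; mea.
Qed.

(** The left side is at most min (1, k / p), hence at most (k / p)^b. With b = a / 2 this trades
    half of the vanishing p^a at 0 for a power of k. *)
Lemma powR_interp (b p k : R) : 0 < b -> b <= 1 -> 0 < p -> 0 < k ->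
  k / (p + k) <= k `^ b * p `^ (- b).
Proof.
move=> b0 b1 p0 k0; rewrite !powR_exp// -expRD.
have pk : 0 < p + k by rewrite addr_gt0.
have -> : b * ln k + - b * ln p = b * ln (k / p) by rewrite ln_div ?posrE//; ring.
have [kp|/ltW kp] := leP k p.
  have h : k / (p + k) <= k / p by rewrite ler_wpM2l ?(ltW k0)// lef_pV2 ?posrE// lerDl ltW.
  apply: (le_trans h); rewrite -[leLHS]lnK ?posrE ?divr_gt0// ler_expR.
  have : ln (k / p) <= 0 by apply: ln_le0; rewrite ler_pdivrMr// mul1r.
  by nra.
have h : k / (p + k) <= 1 by rewrite ler_pdivrMr// mul1r lerDr ltW.
apply: (le_trans h); rewrite -[leLHS]expR0 ler_expR mulr_ge0 ?(ltW b0)//.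
by rewrite ln_ge0// ler_pdivlMr// mul1r.
Qed.

Let c0_ge0 : 0 <= (2 * pi)^-1 :> R.
Proof. by rewrite invr_ge0 mulr_ge0// pi_ge0. Qed.

(** The phase exp (i k min (y, 0)) is 1 on the right half line, and on the left one the integral of
    [f1] exp (i k y) is minus that on the right, the full integral being 0. What remains is the
    right half-line integral of [f1] (1 - exp (i k y)), whose spectral form carries 1/p - 1/(p + k)
    = k / (p (p + k)); [powR_interp] leaves the integrable singularity p^(a/2 - 1). *)
Let A_bound k : 0 < k -> normc (Cint (fun y => f1 y * cis (k * Num.min y 0))) <=
   2 * ((2 * pi)^-1 * B * k `^ (a / 2) * Rint (spectral_dom (a / 2) (pi / 2))).
Proof.
move=> k0.
have lfk : L1C (fun y => f1 y * cis (k * y)) by apply: L1C_cis => //; mea.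
have m1 : mC (fun y => (\1_pos y)%:C : C) by mea.
have i1 y : normc ((\1_pos y)%:C : C) <= 1 by rewrite normcR; exact: indic_le1.
have l1 : L1C (fun y => (\1_pos y)%:C * (f1 y * cis (k * y))) by exact: (L1C_mul m1 lfk i1).
have e0 : (fun y => f1 y) = (fun y => f1 y * cis (0 * y)).
  by apply/funext => y; rewrite mul0r cis0 mulr1.
have l0 : L1C (fun y => (\1_pos y)%:C * (f1 y * cis (0 * y))).
  by rewrite -[X in L1C X](_ : (fun y => (\1_pos y)%:C * f1 y) = _);
    [exact: (L1C_mul m1 lf1 i1)|apply/funext => y; rewrite mul0r cis0 mulr1].
have -> : Cint (fun y => f1 y * cis (k * Num.min y 0)) =
   Cint (fun p => rp p * ('i%C * ((p + 0)^-1)%:C)) - Cint (fun p => rp p * ('i%C * ((p + k)^-1)%:C)).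
  rewrite -(half_lineD (lexx 0)) -(half_lineD (ltW k0)) -CintB//.
  (* The zero added here is the integral of [f1] exp (i k y) over the whole line. *)
  rewrite -[RHS]addr0 -(poisson_ext_negative (ltW k0)) -CintD//; last exact: L1CB.
  congr Cint; apply/funext => y; have [y0|y0] := leP 0 y.
    have -> : \1_pos y = 1 :> R by apply: indic_in; rewrite /= in_itv/= y0.
    by rewrite mulr0 mul0r cis0 rmorph1; ring.
  have -> : \1_pos y = 0 :> R by apply: indic_out; rewrite /= in_itv/= andbT leNgt y0.
  by rewrite rmorph0; ring.
have lb k' : 0 <= k' -> L1C (fun p => rp p * ('i%C * ((p + k')^-1)%:C)).
  move=> k'0; have := L1CZ 'i%C (ldk k'0).
  by congr (L1C _); apply/funext => p; ring.
rewrite -CintB; [|exact: lb|by apply: lb; exact: ltW].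
rewrite -RintZ; last by apply: L1_spectral_dom; rewrite ?divr_gt0 ?pi_gt0.
apply: normc_Cint_le.
- by apply: L1C_meas; apply: L1CB; apply: lb => //; exact: ltW.
- by apply: L1Z; apply: L1_spectral_dom; rewrite ?divr_gt0 ?pi_gt0.
- move=> p; have B0 := B_ge0 F_bnd.
  have K0 : 0 <= (2 * pi)^-1 * B * k `^ (a / 2) by rewrite !mulr_ge0 ?powR_ge0.
  have [p0|p0] := leP p 0.
    by rewrite rp_out// !mul0r subrr normc0 mulr_ge0// spectral_dom_ge0.
  have pk : 0 < p + k by rewrite addr_gt0.
  have -> : rp p * ('i%C * ((p + 0)^-1)%:C) - rp p * ('i%C * ((p + k)^-1)%:C) =
     c0 * (r p * ('i%C * (p^-1 * (k / (p + k)))%:C)).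
    rewrite addr0 /rp; have -> : p^-1 * (k / (p + k)) = p^-1 - (p + k)^-1.
      by field; rewrite !gt_eqF.
    by rewrite rmorphB/=; ring.
  have kk0 : 0 <= k / (p + k) by rewrite divr_ge0 ?(ltW k0)// ltW.
  rewrite (normcM c0) (normcM (r p)) (normcM 'i%C) normci mul1r !normcR (ger0_norm c0_ge0) normc_shifted_spectrum.
  rewrite ger0_norm; last by apply: mulr_ge0 => //; rewrite invr_ge0 ltW.
  have -> : \1_pos p = 1 :> R by apply: indic_in; rewrite /= in_itv/= (ltW p0).
  have a2 : a / 2 <= 1 by have := a_le1; lra.
  apply: le_trans (ler_wpM2l K0 (le_spectral_dom a2 (pihalf_gt0 R) p0)).
  have -> : p `^ (a / 2 - 1) = p `^ a * p `^ (- (a / 2)) * p^-1.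
    have -> : p^-1 = expR (- ln p) by rewrite expRN lnK.
    by rewrite !powR_exp// -!expRD; congr expR; field.
  rewrite mul1r -!mulrA; apply: ler_wpM2l => //.
  set e := expR _; have e0' : 0 <= e by exact: expR_ge0.
  have a20 : 0 < a / 2 by rewrite divr_gt0.
  have h1 := F_bnd p0; have h2 := powR_interp a20 a2 p0 k0.
  have h3 : normc (cFT F p) * (k / (p + k)) <= (B * p `^ a) * (k `^ (a / 2) * p `^ (- (a / 2))).
    by apply: ler_pM; rewrite ?normc_ge0.
  have -> : e * (normc (cFT F p) * (p^-1 * (k / (p + k)))) = (e * p^-1) * (normc (cFT F p) * (k / (p + k))) by ring.
  have -> : B * (k `^ (a / 2) * (p `^ a * (p `^ (- (a / 2)) * (p^-1 * e)))) =
    (e * p^-1) * (B * p `^ a * (k `^ (a / 2) * p `^ (- (a / 2)))) by ring.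
  by rewrite ler_wpM2l// mulr_ge0// invr_ge0 ltW.
Qed.

Lemma FX_small : exists K, forall k, 0 < k <= 1 -> normc (FX F k) <= K * k `^ (a / 2).
Proof.
(* [K1] is the cost of replacing the phase by exp (i k min (y, 0)), with 6 = 2 * 3 from
   [normc_Cint_le] and [phiX_small]; it multiplies k, which is at most k^(a/2). [K2] comes from
   [A_bound]. *)
pose K1 := 6 * (pi / 2 + 1) * Rint (fun y => normc (f1 y)).
pose K2 := 2 * ((2 * pi)^-1 * B * Rint (spectral_dom (a / 2) (pi / 2))).
exists (K1 + K2) => k /andP[k0 k1].
have mX : mC (phiX k (pi / 2)).
  apply: mC_continuous => y u uy.
  by apply: (@phiX_cvg R k (pi / 2) y (fun=> pi / 2) u (pihalf_itv R)) => //; exact: cvg_cst.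
have mn : measurable_fun setT (fun y : R => Num.min y 0) by exact: measurable_minr.
have l1 : L1C (fun y => f1 y * phiX k (pi / 2) y).
  by apply: (@L1C_bounded_mul R f1 lf1 _ 1 mX) => y; apply: phiX_le1 (pihalf_itv R); exact: ltW.
have l2 : L1C (fun y => f1 y * cis (k * Num.min y 0)).
  by apply: L1C_cis => //; apply: measurable_funM.
have close : normc (FX F k - Cint (fun y => f1 y * cis (k * Num.min y 0))) <= K1 * k.
  rewrite /FX (rotate_X (ltW k0) lF F_pos) -CintB//.
  have -> : K1 * k = 2 * Rint (fun y => 3 * (k * (pi / 2 + 1)) * normc (f1 y)).
    by rewrite RintZ; [rewrite /K1; ring|exact: L1C_norm].
  apply: normc_Cint_le.
  - by apply: L1C_meas; exact: L1CB.
  - by apply: L1Z; exact: L1C_norm.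
  - move=> y; rewrite -mulrBr normcM mulrC; apply: ler_wpM2r; first exact: normc_ge0.
    exact: phiX_small.
have hA := A_bound k0.
have -> : FX F k = (FX F k - Cint (fun y => f1 y * cis (k * Num.min y 0))) + Cint (fun y => f1 y * cis (k * Num.min y 0)).
  by rewrite subrK.
apply: (le_trans (ler_normcD _ _)); rewrite (mulrDl K1 K2); apply: lerD.
  apply: (le_trans close); apply: ler_wpM2l.
    rewrite /K1 mulr_ge0 ?Rint_ge0// ?mulr_ge0 ?addr_ge0 ?divr_ge0 ?pi_ge0//.
    by move=> y; exact: normc_ge0.
  rewrite powR_exp// -[leLHS]lnK ?posrE// ler_expR.
  by have := ln_le0 k1; have := a_le1; nra.
by apply: (le_trans hA); rewrite /K2 le_eqVlt; apply/orP; left; apply/eqP; ring.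
Qed.

(** For k = e^u and y = u + v, the damped factor exp (- k e^-y) is exp (- e^-v), a smoothed unit
    step. The sharp step produces the pole i / p of the spectrum; the gap between the two decays
    exponentially and has a bounded transform. *)
Definition step_gap (v : R) : R := expR (- expR (- v)) - \1_pos v.
Definition step_gap_hat (p : R) : C := Cint (fun v => (step_gap v)%:C * cis (p * v)).

Lemma measurable_step_gap : measurable_fun setT step_gap.
Proof. by rewrite /step_gap; mea. Qed.

Lemma step_gap_le v : `|step_gap v| <= expR (- (1 * `|v|)).
Proof.
rewrite mul1r /step_gap; have [v0|v0] := leP 0 v.
  have -> : \1_pos v = 1 :> R by apply: indic_in; rewrite /= in_itv/= v0.
  rewrite (ger0_norm v0) ler0_norm; last by rewrite subr_le0 expR_le1 oppr_le0 expR_ge0.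
  by have := expR_ge1Dx (- expR (- v)); lra.
have -> : \1_pos v = 0 :> R by apply: indic_out; rewrite /= in_itv/= andbT leNgt v0.
rewrite subr0 ger0_norm ?expR_ge0// ltr0_norm// opprK ler_expR.
by have := expR_ge1Dx (- v); lra.
Qed.

Lemma L1_step_gap : L1 step_gap.
Proof. exact: L1_le measurable_step_gap step_gap_le (L1_expN_abs ltr01). Qed.

Lemma normc_step_gap_hat p : normc (step_gap_hat p) <= 2 * Rint (fun v => `|step_gap v|).
Proof.
apply: normc_Cint_le.
- by have := measurable_step_gap => m; mea.
- exact: L1_norm L1_step_gap.
- by move=> v; rewrite normcM normc_cis mulr1 normcR.
Qed.

Lemma mC_step_gap_hat : mC step_gap_hat.
Proof.
have e : step_gap_hat = (fun p => cFT (fun v => (step_gap v)%:C) (- p)).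
  apply/funext => p; congr Cint; apply/funext => v; congr (_ * cis _); ring.
rewrite e; apply: (@mC_comp _ _ R _ _ (cFT (fun v => (step_gap v)%:C)) (fun p : R => - p)).
  by apply: mC_cFT; exact: (L1C_real L1_step_gap).
exact: oppr_measurable.
Qed.

(** In classical terms the factor i / p + [step_gap_hat p] is Gamma (- i p) for p > 0: it is the
    regularised transform of exp (- e^-v). *)
Definition thermal_spectrum (p : R) : C := c0 * (r p * ('i%C * (p^-1)%:C + step_gap_hat p)).

Lemma L1C_thermal_spectrum : L1C thermal_spectrum.
Proof.
rewrite (_ : thermal_spectrum = (fun p => 'i%C * (rp p * (p^-1)%:C) + step_gap_hat p * rp p)); last first.
  by apply/funext => p; rewrite /thermal_spectrum /rp; ring.
apply: L1CD; first exact: L1CZ.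
exact: (L1C_mul mC_step_gap_hat lrp normc_step_gap_hat).
Qed.

(** After the shift y = u + v the damped factor no longer depends on u, so u enters through [f1]
    alone and becomes a character in the spectral form. The step is handled by [half_line], the gap
    by Fubini. *)
Lemma FTh_fourier u : FTh F (expR u) = Cint (fun p => thermal_spectrum p * cis (p * u)).
Proof.
rewrite /FTh (rotate_Th (expR_ge0 u) lF F_pos).
pose ru p := rp p * cis (p * u).
have lru : L1C ru by apply: L1C_cis => //; mea.
have f1u v : f1 (u + 1 * v) = Cint (fun p => ru p * cis (p * v)).
  rewrite f1E; congr Cint; apply/funext => p.
  by rewrite /ru mul1r mulrDr cisD mulrA.
have lfu : L1C (fun v => f1 (u + 1 * v)) by exact: L1C_affine.
have mE : mC (fun y : R => (expR (- (expR u * expR (- y))))%:C : C) by mea.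
have lE : L1C (fun y => f1 y * (expR (- (expR u * expR (- y))))%:C).
  apply: (@L1C_bounded_mul R f1 lf1 _ 1 mE) => y; rewrite normcR (ger0_norm (expR_ge0 _)).
  by rewrite expR_le1 oppr_le0 mulr_ge0 ?expR_ge0.
rewrite (Cint_affine u ltr01 lE) rmorph1 mul1r.
have m1 : mC (fun y => (\1_pos y)%:C : C) by mea.
have i1 y : normc ((\1_pos y)%:C : C) <= 1 by rewrite normcR; exact: indic_le1.
have lA : L1C (fun v => (\1_pos v)%:C * f1 (u + 1 * v)) by exact: (L1C_mul m1 lfu i1).
have mg : mC (fun v => (step_gap v)%:C : C) by apply: mC_real; exact: measurable_step_gap.
have g1 v : normc ((step_gap v)%:C : C) <= 1.
  rewrite normcR (le_trans (step_gap_le v))// expR_le1 oppr_le0 mulr_ge0//.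
have lB : L1C (fun v => (step_gap v)%:C * f1 (u + 1 * v)) by exact: (L1C_mul mg lfu g1).
rewrite (_ : (fun v => _ * _) = (fun v => (\1_pos v)%:C * f1 (u + 1 * v) + (step_gap v)%:C * f1 (u + 1 * v))); last first.
  apply/funext => v; rewrite mul1r.
  have -> : expR u * expR (- (u + v)) = expR (- v) by rewrite -expRD; congr expR; ring.
  by rewrite /step_gap rmorphB/=; ring.
rewrite (CintD lA lB).
have ldu : L1C (fun p => ru p * (p^-1)%:C).
  have := L1C_cis ld (h := fun p => p * u); rewrite /ru.
  have mm : measurable_fun setT (fun p : R => p * u) by mea.
  by move=> /(_ mm); congr (L1C _); apply/funext => p; ring.
have h1 : Cint (fun v => (\1_pos v)%:C * f1 (u + 1 * v)) = Cint (fun p => ru p * ('i%C * (p^-1)%:C)).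
  rewrite -(@half_line R ru (fun p => p) lru).
  - by congr Cint; apply/funext => v; rewrite f1u.
  - exact: measurable_id.
  - by move=> p p0; rewrite /ru rp_out ?mul0r// p0.
  - exact: ldu.
  - by move: lfu; congr (L1C _); apply/funext => v; rewrite f1u.
have h2 : Cint (fun v => (step_gap v)%:C * f1 (u + 1 * v)) = Cint (fun p => step_gap_hat p * ru p).
  pose k v p := (step_gap v)%:C * (ru p * cis (p * v)).
  have mru := L1C_meas lru.
  have mru2 : mC (fun z : R * R => ru z.2) by apply: (mC_comp mru); exact: measurable_snd.
  have mg2 : measurable_fun setT (fun z : R * R => step_gap z.1).
    by apply: (measurableT_comp measurable_step_gap); exact: measurable_fst.
  have mk : mC (fun z : R * R => k z.1 z.2) by rewrite /k; mea.
  have [|_ _ h] := @fubini_Cint_prod R k _ _ mk (L1_norm L1_step_gap) (L1C_norm lru).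
    move=> v p; rewrite /k (normcM (step_gap v)%:C) (normcM (ru p)) normcR.
    by rewrite (normc_cis (p * v)) mulr1.
  have mv v : measurable_fun setT (fun p : R => p * v) by mea.
  have lv v : L1C (fun p => ru p * cis (p * v)) by exact: (L1C_cis lru (mv v)).
  transitivity (Cint (fun v => Cint (k v))).
    by congr Cint; apply/funext => v; rewrite /k (CintZ _ (lv v)) f1u.
  rewrite h; congr Cint; apply/funext => p; rewrite /step_gap_hat -CintZr.
    by congr Cint; apply/funext => v; rewrite /k; ring.
  apply: (@L1C_cis R (fun v => (step_gap v)%:C)); first exact: (L1C_real L1_step_gap).
  by mea.
rewrite h1 h2 -CintD; last 2 first.
- have := L1CZ 'i%C ldu; congr (L1C _); apply/funext => p; ring.
- exact: (L1C_mul mC_step_gap_hat lru normc_step_gap_hat).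
congr Cint; apply/funext => p; rewrite /thermal_spectrum /ru /rp; ring.
Qed.

End SpectralAsymptotics.

(** * Square integrability of Fourier transforms *)

Section SquareIntegrable.
Variable R : realType.
Local Notation mu := (@lebesgue_measure R).
Local Notation C := R[i].
Local Notation pos := (`[0, +oo[%classic : set R).

Definition cj (z : C) : C := re z +i* - im z.

Lemma cjM z w : cj (z * w) = cj z * cj w.
Proof. by apply: Cext; rewrite /cj !reimE; ring. Qed.

Lemma cj_cis (x : R) : cj (cis x) = cis (- x).
Proof. by rewrite /cj /cis cosN sinN. Qed.

Lemma mulcj z : z * cj z = (normc z ^+ 2)%:C.
Proof. by rewrite sqr_normc; apply: Cext; rewrite /cj !reimE; ring. Qed.

Lemma normc_cj z : normc (cj z) = normc z.
Proof. by rewrite !normcE /cj !reimE sqrrN. Qed.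

Lemma mC_cj (f : R -> C) : mC f -> mC (fun x => cj (f x)).
Proof. by move=> [a b]; split; rewrite /cj; [exact: a|exact: measurable_comp_opp b]. Qed.

Lemma L1C_cj (f : R -> C) : L1C f -> L1C (fun x => cj (f x)).
Proof. by move=> [a b]; split; rewrite /cj; [exact: a|exact: L1N b]. Qed.

Lemma Cint_cj (f : R -> C) : L1C f -> Cint (fun x => cj (f x)) = cj (Cint f).
Proof. by move=> [a b]; rewrite /cj /Cint /= (RintN b). Qed.


Lemma poissonN (e x : R) : 0 < e -> poisson e (- x) = poisson e x.
Proof.
move=> e0; have pe : pi / e != 0 by rewrite mulf_neq0 ?invr_neq0 ?gt_eqF ?pi_gt0.
by apply: (mulfI pe); rewrite -!inv_sqrD_poisson// sqrrN.
Qed.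

(* This is exp (- e |u|) off the origin, and 2 at the origin. *)
Definition two_sided_exp (e u : R) : R :=
  \1_pos u * expR (- (e * u)) + \1_pos (- u) * expR (- (e * - u)).

Lemma le_two_sided_exp e u : expR (- (e * `|u|)) <= two_sided_exp e u.
Proof.
have ip v : 0 <= v -> \1_pos v = 1 :> R by move=> v0; apply: indic_in; rewrite /= in_itv/= v0.
rewrite /two_sided_exp; have [u0|u0] := leP 0 u.
  by rewrite (ip _ u0) (ger0_norm u0) mul1r lerDl mulr_ge0 ?indic_ge0 ?expR_ge0.
rewrite (ip (- u)) ?oppr_ge0 ?(ltW u0)// (ltr0_norm u0) mul1r lerDr.
by rewrite mulr_ge0 ?indic_ge0 ?expR_ge0.
Qed.

Lemma two_sided_exp_ge0 e u : 0 <= two_sided_exp e u.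
Proof. exact: le_trans (expR_ge0 _) (le_two_sided_exp e u). Qed.

Lemma L1_two_sided_exp e : 0 < e -> L1 (two_sided_exp e).
Proof. by move=> e0; have l := L1_expN e0; exact: (L1D l (L1_opp l)). Qed.

Lemma two_sided_exp_hat (e x : R) : 0 < e ->
  Cint (fun u => (two_sided_exp e u)%:C * cis (x * u)) = (2 * pi * poisson e x)%:C.
Proof.
move=> e0.
have l y : L1C (fun u => (\1_pos u * expR (- (e * u)))%:C * cis (y * u)).
  by apply: (@L1C_cis R (fun u => (\1_pos u * expR (- (e * u)))%:C)); [exact: (L1C_real (L1_expN e0))|mea].
have l3 := L1C_opp (l (- x)).
rewrite (_ : (fun u => _) = (fun u => (\1_pos u * expR (- (e * u)))%:C * cis (x * u) +
            (\1_pos (- u) * expR (- (e * - u)))%:C * cis (- x * - u))); last first.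
  by apply/funext => u; rewrite mulrNN /two_sided_exp rmorphD mulrDl.
rewrite (CintD (l x) l3) -(Cint_opp (l (- x))) !Cint_halfline//.
have -> : (2 * pi * poisson e x)%:C = (2 * pi)%:C * (poisson e x)%:C :> C by exact: rmorphM.
rewrite (poissonE x e0) mulrA -rmorphM divff ?gt_eqF ?twopi_gt0// rmorph1 mul1r.
by rewrite rmorphN mulrN opprK.
Qed.

Variable Z : R -> C.
Hypothesis lZ : L1C Z.
Hypothesis lZ2 : L1 (fun p => normc (Z p) ^+ 2).
Local Notation G := (fun u => Cint (fun p => Z p * cis (p * u))).

Let mZ := L1C_meas lZ.

Let lZc u : L1C (fun p => Z p * cis (p * u)).
Proof. by apply: L1C_cis => //; mea. Qed.

Let normcG u : normc (G u) <= 2 * Rint (fun p => normc (Z p)).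
Proof.
apply: normc_Cint_le; [exact: L1C_meas|exact: L1C_norm|].
by move=> p; rewrite normcM normc_cis mulr1.
Qed.

Let mG : mC G.
Proof.
apply: mC_continuous => u v vu.
apply: (@cvgC_Cint_param R (fun u p => Z p * cis (p * u)) (fun p => normc (Z p))).
- by move=> w; exact: L1C_meas.
- exact: L1C_norm.
- by move=> w p; rewrite normcM normc_cis mulr1.
- move=> p; apply: cvgCM; first exact: cvgC_cst.
  by apply: cvgC_cis; apply: cvgM => //; exact: cvg_cst.
Qed.

(** Schur's test: |Z(p)| |Z(q)| is at most half the sum of the squares, and the Poisson kernel has
    mass 1 in either variable. [J] is the convolution of |Z|^2 with the kernel, which preserves the
    integral. *)
Let conv_bound (e : R) : 0 < e ->
  exists2 J : R -> R, L1 J /\ Rint J = Rint (fun p => normc (Z p) ^+ 2) &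
   forall p, L1 (fun q => normc (Z q) * poisson e (p - q)) /\
     normc (Z p) * Rint (fun q => normc (Z q) * poisson e (p - q)) <= (normc (Z p) ^+ 2 + J p) / 2.
Proof.
move=> e0.
have mz : measurable_fun setT (fun p => normc (Z p)) by exact: (m_normc mZ).
have mz2 : measurable_fun setT (fun z : R * R => normc (Z z.1)).
  by apply: (measurableT_comp mz); exact: measurable_fst.
have mp : measurable_fun setT (fun z : R * R => poisson e (z.2 - z.1)) by mea.
pose k q p := normc (Z q) ^+ 2 * poisson e (p - q).
have mk : measurable_fun setT (fun z : R * R => k z.1 z.2) by rewrite /k; mea.
have lk q : L1 (k q) by apply: L1Z; exact: (poisson_int q e0).1.
have ek q : Rint (k q) = normc (Z q) ^+ 2.
  by rewrite /k RintZ ?(poisson_int q e0).2 ?mulr1//; exact: (poisson_int q e0).1.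
have k0 q p : 0 <= k q p by rewrite mulr_ge0 ?sqr_ge0// poisson_ge0.
have [|_ lJ eJ] := @fubini_Rint R k (fun q => normc (Z q) ^+ 2) mk lZ2.
  move=> q; rewrite -(ek q) -(RintE (lk q)) le_eqVlt; apply/orP; left; apply/eqP.
  by apply: eq_integral => p _; rewrite ger0_norm.
exists (fun p => Rint (k^~ p)).
  by split => //; rewrite -eJ; congr Rint; apply/funext => q; rewrite ek.
move=> p.
have pl q : poisson e (p - q) <= poisson e 0 by exact: le_poisson0.
have p0 q : 0 <= poisson e (p - q) by exact: poisson_ge0.
have bl (h : R -> R) : L1 h -> L1 (fun q => h q * poisson e (p - q)).
  move=> lh; apply: (L1_le _ _ (L1Z (poisson e 0) (L1_norm lh))).
    by have := L1_meas lh => mh; mea.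
  by move=> q; rewrite normrM mulrC (ger0_norm (p0 q)) ler_wpM2r.
have l1 := bl _ (L1C_norm lZ); split => //.
have l2 := bl _ lZ2.
have lP : L1 (fun q => poisson e (p - q)).
  have := (poisson_int p e0).1; congr (is_true (L1 _)); apply/funext => q.
  by rewrite -(poissonN (q - p) e0) opprB.
have eP : Rint (fun q => poisson e (p - q)) = 1.
  rewrite -(poisson_int p e0).2; congr Rint; apply/funext => q.
  by rewrite -(poissonN (q - p) e0) opprB.
rewrite -(RintZ (normc (Z p)) l1).
have -> : (normc (Z p) ^+ 2 + Rint (k^~ p)) / 2 =
  Rint (fun q => 2^-1 * (normc (Z p) ^+ 2 * poisson e (p - q) + normc (Z q) ^+ 2 * poisson e (p - q))).
  rewrite (RintZ _ (L1D (L1Z _ lP) l2)).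
  rewrite (RintD (L1Z _ lP) l2).
  by rewrite (RintZ _ lP) eP mulr1 mulrC.
apply: le_Rint; [exact: (L1Z _ l1)|exact: (L1Z _ (L1D (L1Z _ lP) l2))|].
move=> q; rewrite -mulrDl (mulrA (normc (Z p))) (mulrA 2^-1); apply: ler_wpM2r; first exact: p0.
have := sqr_ge0 (normc (Z p) - normc (Z q)).
move: (normc (Z p)) (normc (Z q)) => x y h; rewrite -subr_ge0.
by have -> : 2^-1 * (x ^+ 2 + y ^+ 2) - x * y = (x - y) ^+ 2 / 2; [field|exact: divr_ge0].
Qed.

(** The weight makes Fubini applicable: |G|^2 = G conj(G) expands into a double integral of Z(p)
    conj(Z(q)) against 2 pi [poisson e (p - q)], the transform of the weight. The bound of
    [conv_bound] does not depend on [e]. The constant is the 2 pi of Plancherel times two factors 2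
    from [normc_Cint_le]. *)
Let regularized_bound (e : R) : 0 < e ->
  L1 (fun u => two_sided_exp e u * normc (G u) ^+ 2) /\
  Rint (fun u => two_sided_exp e u * normc (G u) ^+ 2) <= 8 * pi * Rint (fun p => normc (Z p) ^+ 2).
Proof.
move=> e0; set E := two_sided_exp e.
have lE : L1 E := L1_two_sided_exp e0; have mE := L1_meas lE.
have E0 u : 0 <= E u by exact: two_sided_exp_ge0.
pose M := 2 * Rint (fun p => normc (Z p)).
have lEG : L1C (fun u => (E u)%:C * (G u * cj (G u))).
  have := @L1C_mul R (fun u => G u * cj (G u)) (fun u => (E u)%:C) (M * M).
  have m2 : mC (fun u => G u * cj (G u)) by apply: mCM => //; exact: mC_cj.
  move=> /(_ m2 (L1C_real lE)).
  have b u : normc (G u * cj (G u)) <= M * M.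
    by rewrite normcM normc_cj ler_pM ?normc_ge0//; exact: normcG.
  by move=> /(_ b); congr (L1C _); apply/funext => u; rewrite mulrC.
have eEG : (fun u => (E u)%:C * (G u * cj (G u))) = (fun u => (E u * normc (G u) ^+ 2)%:C).
  by apply/funext => u; rewrite mulcj -rmorphM.
have lR : L1 (fun u => E u * normc (G u) ^+ 2) by move: lEG; rewrite eEG => -[+ _].
split => //.
have [J [lJ eJ] hJ] := conv_bound e0.
pose H p := Cint (fun u => (E u)%:C * cj (G u) * cis (p * u)).
have lEc : L1C (fun u => (E u)%:C * cj (G u)).
  have := @L1C_mul R (fun u => cj (G u)) (fun u => (E u)%:C) M (mC_cj mG) (L1C_real lE).
  have b u : normc (cj (G u)) <= M by rewrite normc_cj; exact: normcG.
  by move=> /(_ b); congr (L1C _); apply/funext => u; rewrite mulrC.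
have eI : Cint (fun u => (E u)%:C * (G u * cj (G u))) = Cint (fun p => Z p * H p) /\ L1C (fun p => Z p * H p).
  pose k u p := (E u)%:C * cj (G u) * (Z p * cis (p * u)).
  have mZ2 : mC (fun z : R * R => Z z.2) by apply: (mC_comp mZ); exact: measurable_snd.
  have mE2 : measurable_fun setT (fun z : R * R => E z.1).
    by apply: (measurableT_comp mE); exact: measurable_fst.
  have mG2 : mC (fun z : R * R => cj (G z.1)) by apply: (mC_comp (mC_cj mG)); exact: measurable_fst.
  have mk : mC (fun z : R * R => k z.1 z.2) by rewrite /k; mea.
  have [|_ lk h] := @fubini_Cint_prod R k _ _ mk (L1C_norm lEc) (L1C_norm lZ).
    by move=> u p; rewrite /k (normcM ((E u)%:C * cj (G u))) (normcM (Z p)) normc_cis mulr1.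
  have eH p : Cint (k^~ p) = Z p * H p.
    rewrite /H -CintZ; last by apply: L1C_cis => //; mea.
    by congr Cint; apply/funext => u; rewrite /k; ring.
  split; last by move: lk; congr (L1C _); apply/funext => p; rewrite eH.
  transitivity (Cint (fun u => Cint (k u))).
    congr Cint; apply/funext => u; rewrite /k (CintZ _ (lZc u)); ring.
  by rewrite h; congr Cint; apply/funext => p; rewrite eH.
(* The conjugate of [G] is opened as an integral over q; integrating in u before q produces the
   Poisson kernel. *)
have bH p : normc (H p) <= 4 * pi * Rint (fun q => normc (Z q) * poisson e (p - q)).
  pose k u q := (E u)%:C * cis (p * u) * (cj (Z q) * cis (- (q * u))).
  have mZ2 : mC (fun z : R * R => cj (Z z.2)) by apply: (mC_comp (mC_cj mZ)); exact: measurable_snd.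
  have mE2 : measurable_fun setT (fun z : R * R => E z.1).
    by apply: (measurableT_comp mE); exact: measurable_fst.
  have mk : mC (fun z : R * R => k z.1 z.2) by rewrite /k; mea.
  have [|_ _ h] := @fubini_Cint_prod R k E (fun q => normc (Z q)) mk lE (L1C_norm lZ).
    move=> u q; rewrite /k (normcM ((E u)%:C * cis (p * u))) (normcM (E u)%:C) (normcM (cj (Z q))).
    by rewrite !normc_cis !mulr1 normc_cj normcR (ger0_norm (E0 u)).
  have eH : H p = Cint (fun u => Cint (k u)).
    congr Cint; apply/funext => u; rewrite -(Cint_cj (lZc u)) /k.
    have l : L1C (fun q => cj (Z q) * cis (- (q * u))).
      by apply: L1C_cis; [exact: L1C_cj|mea].
    rewrite (CintZ _ l) mulrAC; congr (_ * _); congr Cint; apply/funext => q.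
    by rewrite cjM cj_cis.
  have eK q : Cint (k^~ q) = cj (Z q) * (2 * pi * poisson e (p - q))%:C.
    rewrite -(two_sided_exp_hat (p - q) e0) -CintZ; last first.
      by apply: (@L1C_cis R (fun u => (two_sided_exp e u)%:C)); [exact: (L1C_real lE)|mea].
    congr Cint; apply/funext => u; rewrite /k mulrBl cisD; ring.
  rewrite eH h.
  have -> : 4 * pi * Rint (fun q => normc (Z q) * poisson e (p - q)) =
     2 * Rint (fun q => 2 * pi * (normc (Z q) * poisson e (p - q))).
    by rewrite (RintZ _ (hJ p).1); ring.
  under [X in normc (Cint X)]eq_fun do rewrite eK.
  apply: normc_Cint_le.
  - have m1 : measurable_fun setT (fun q : R => 2 * pi * poisson e (p - q)) by mea.
    by apply: mCM; [exact: mC_cj|exact: mC_real].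
  - exact: (L1Z _ (hJ p).1).
  - move=> q; rewrite (normcM (cj (Z q))) normc_cj normcR.
    have k0 : 0 <= 2 * pi * poisson e (p - q).
      by apply: mulr_ge0; [exact: ltW (twopi_gt0 R)|exact: poisson_ge0].
    by rewrite (ger0_norm k0) (mulrCA (normc (Z q))).
have [eI1 lZH] := eI.
have -> : Rint (fun u => E u * normc (G u) ^+ 2) = re (Cint (fun p => Z p * H p)).
  by rewrite -eI1 eEG Cint_real.
apply: (le_trans (le_trans (ler_norm _) (normc_re _))).
have -> : 8 * pi * Rint (fun p => normc (Z p) ^+ 2) = 2 * Rint (fun p => 4 * pi * ((normc (Z p) ^+ 2 + J p) / 2)).
  rewrite (RintZ _ (_ : L1 (fun p => (normc (Z p) ^+ 2 + J p) / 2))); last first.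
    by have := L1Z 2^-1 (L1D lZ2 lJ); congr (is_true (L1 _)); apply/funext => p; rewrite mulrC.
  rewrite (_ : (fun p => _ / 2) = (fun p => 2^-1 * (normc (Z p) ^+ 2 + J p))); last first.
    by apply/funext => p; rewrite mulrC.
  by rewrite (RintZ _ (L1D lZ2 lJ)) (RintD lZ2 lJ) eJ; field.
apply: normc_Cint_le.
- exact: L1C_meas.
- apply: L1Z; have := L1Z 2^-1 (L1D lZ2 lJ); congr (is_true (L1 _)); apply/funext => p.
  by rewrite mulrC.
- move=> p; rewrite normcM.
  apply: (le_trans (ler_wpM2l (normc_ge0 _) (bH p))).
  rewrite mulrCA; apply: ler_wpM2l; first by rewrite mulr_ge0 ?pi_ge0.
  exact: (hJ p).2.
Qed.

Lemma square_integrable_transform : L1 (fun u => normc (G u) ^+ 2).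
Proof.
have mG2 : measurable_fun setT (fun u => normc (G u) ^+ 2).
  by apply: measurable_funX; exact: (m_normc mG).
apply/(L1P mG2).
pose ee n : R := n.+1%:R^-1.
(* This weight lies below [two_sided_exp] and increases to 1 at every point, the origin included. *)
pose g n u : \bar R := (expR (- (ee n * `|u|)) * normc (G u) ^+ 2)%:E.
have e0 n : 0 < ee n by rewrite invr_gt0.
have h : (\int[mu]_u (limn (g ^~ u)) = limn (fun n => \int[mu]_u (g n u)))%E.
  apply: monotone_convergence => //.
  - by move=> n; apply/measurable_EFinP; rewrite /ee; mea.
  - by move=> n u _; rewrite lee_fin mulr_ge0 ?expR_ge0 ?sqr_ge0.
  - move=> u _ m n mn; rewrite lee_fin ler_wpM2r ?sqr_ge0// ler_expR lerN2 ler_wpM2r//.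
    by rewrite lef_pV2 ?posrE// ler_nat.
have hl u : limn (g ^~ u) = (`|normc (G u) ^+ 2|)%:E.
  apply/cvg_lim => //; apply: cvg_EFin; first exact: nearW.
  rewrite ger0_norm ?sqr_ge0//.
  rewrite [X in _ --> X](_ : _ = expR 0 * normc (G u) ^+ 2); last by rewrite expR0 mul1r.
  rewrite /comp /=; apply: cvgM; last exact: cvg_cst.
  apply: continuous_cvg; first exact: continuous_expR.
  by rewrite -oppr0 -(mul0r `|u|); apply: cvgN; apply: cvgM; [exact: cvg_natSV|exact: cvg_cst].
under eq_integral do rewrite -hl.
rewrite h; apply: (@le_lt_trans _ _ (8 * pi * Rint (fun p => normc (Z p) ^+ 2))%:E); last exact: ltry.
apply: lime_le.
  apply: ereal_nondecreasing_is_cvgn => m n mn; apply: ge0_le_integral => //.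
  - by move=> u _; rewrite lee_fin mulr_ge0 ?expR_ge0 ?sqr_ge0.
  - by apply/measurable_EFinP; rewrite /ee; mea.
  - by apply/measurable_EFinP; rewrite /ee; mea.
  - move=> u _; rewrite lee_fin ler_wpM2r ?sqr_ge0// ler_expR lerN2 ler_wpM2r//.
    by rewrite lef_pV2 ?posrE// ler_nat.
apply: nearW => n.
have [lr br] := regularized_bound (e0 n).
apply: (@le_trans _ _ (\int[mu]_u (two_sided_exp (ee n) u * normc (G u) ^+ 2)%:E)%E).
  apply: ge0_le_integral => //.
  - by move=> u _; rewrite lee_fin mulr_ge0 ?expR_ge0 ?sqr_ge0.
  - by apply/measurable_EFinP; rewrite /ee; mea.
  - by apply/measurable_EFinP; exact: (L1_meas lr).
  - by move=> u _; rewrite lee_fin ler_wpM2r ?sqr_ge0// le_two_sided_exp.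
by rewrite (RintE lr) lee_fin.
Qed.

End SquareIntegrable.

(** * Failure of square integrability for a singular spectrum *)

Section SingularSpectrum.
Variable R : realType.
Local Notation mu := (@lebesgue_measure R).
Local Notation C := R[i].
Local Notation pos := (`[0, +oo[%classic : set R).
Local Notation unit01 := (`]0, 1]%classic : set R).
Variables (Z : R -> C) (a K delta e : R) (X0 : C).
Hypothesis lZ : L1C Z.
Hypothesis Z_neg : forall p, p <= 0 -> Z p = 0.
Hypothesis a_gt0 : 0 < a.
Hypothesis a_le : a <= 1 / 2.
Hypothesis delta_gt0 : 0 < delta.
Hypothesis delta_le1 : delta <= 1.
Hypothesis K_ge0 : 0 <= K.
Hypothesis X0_neq0 : X0 != 0.
Hypothesis Z_lead : forall p, 0 < p <= delta -> normc (Z p - (p `^ (a - 1))%:C * X0) <= K * p `^ a.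
Hypothesis e_sign : e ^+ 2 = 1.
Local Notation G := (fun u => Cint (fun p => Z p * cis (p * (e * u)))).

Let mZ := L1C_meas lZ.
Let lnZ := L1C_norm lZ.

Let x0_gt0 : 0 < normc X0.
Proof. by rewrite lt_neqAle normc_ge0 eq_sym andbT; apply: contra_neq X0_neq0; exact: normc_eq0. Qed.

Let lZc u : L1C (fun p => Z p * cis (p * (e * u))).
Proof. by apply: L1C_cis => //; mea. Qed.

Let mG : mC G.
Proof.
apply: mC_continuous => u v vu.
apply: (@cvgC_Cint_param R (fun u p => Z p * cis (p * (e * u))) (fun p => normc (Z p))).
- by move=> w; exact: L1C_meas.
- exact: lnZ.
- by move=> w p; rewrite normcM normc_cis mulr1.
- move=> p; apply: cvgCM; first exact: cvgC_cst.
  by apply: cvgC_cis; apply: cvgM; [exact: cvg_cst|apply: cvgM => //; exact: cvg_cst].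
Qed.

(** The sign [e] selects the half line on which the transform is taken. With s = q^2, a growth like
    s^(-1/2) means that q |laplace (q^2)| stays away from 0; square integrability would make it tend
    to 0. *)
Let laplace (s : R) := Cint (fun u => (\1_pos u * expR (- (s * u)))%:C * G u).

Let w (s p : R) : C := (s%:C - 'i%C * (e * p)%:C)^-1.

Let re_w s p : re (w s p) = s / (s ^+ 2 + p ^+ 2).
Proof.
rewrite /w reV !reimE !(mul0r,mul1r,mulr0,subr0,sub0r,addr0,add0r,oppr0) sqrrN exprMn e_sign mul1r.
by [].
Qed.

Let normc_w s p : 0 < p -> normc (w s p) <= p^-1.
Proof.
move=> p0; rewrite /w normcV.
have h : p <= normc (s%:C - 'i%C * (e * p)%:C).
  apply: le_trans (normc_im _); rewrite !reimE mul0r mul1r !add0r normrN normrM.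
  have -> : `|e| = 1 by apply/eqP; rewrite -sqrp_eq1// -normrX e_sign normr1.
  by rewrite mul1r ler_norm.
by rewrite lef_pV2 ?posrE// (lt_le_trans p0).
Qed.

Let laplaceE s : 0 < s -> laplace s = Cint (fun p => Z p * w s p) /\ L1C (fun p => Z p * w s p).
Proof.
move=> s0.
pose k u p := (\1_pos u * expR (- (s * u)))%:C * (Z p * cis (p * (e * u))).
have mZ2 : mC (fun z : R * R => Z z.2) by apply: (mC_comp mZ); exact: measurable_snd.
have mk : mC (fun z : R * R => k z.1 z.2) by rewrite /k; mea.
have [|_ lk h] := @fubini_Cint_prod R k _ _ mk (L1_expN s0) lnZ.
  move=> u p; rewrite /k !normcM normc_cis mulr1 normcR.
  by rewrite (ger0_norm (mulr_ge0 (indic_ge0 _ _) (expR_ge0 _))).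
have eH p : Cint (k^~ p) = Z p * w s p.
  rewrite /w -(Cint_halfline (e * p) s0) -CintZ; last first.
    by apply: (@L1C_cis R (fun u => (\1_pos u * expR (- (s * u)))%:C)); [exact: (L1C_real (L1_expN s0))|mea].
  congr Cint; apply/funext => u; rewrite /k mulrCA; congr (_ * (_ * cis _)); ring.
split; last by move: lk; congr (L1C _); apply/funext => p; rewrite eH.
transitivity (Cint (fun u => Cint (k u))).
  by congr Cint; apply/funext => u; rewrite /k (CintZ _ (lZc u)).
by rewrite h; congr Cint; apply/funext => p; rewrite eH.
Qed.

(** Total weight of the errors, as |w| <= 1/p: on ]0, delta] the remainder K p^a of [Z_lead] gives K
    p^(a - 1), and beyond delta the kernel is at most 1/delta. *)
Let C1 : R := K * Rint (fun p => \1_unit01 p * p `^ (a - 1)) + delta^-1 * Rint (fun p => normc (Z p)).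

(** Testing against the conjugate of [X0] makes the leading contribution |X0|^2 p^(a - 1) Re w
    nonnegative. On ]0, s] alone it is at least |X0|^2 s^(a - 1) / (2 s), as p^(a - 1) decreases and
    Re w = s / (s^2 + p^2), so its integral is at least |X0|^2 s^(a - 1) / 2. *)
Let laplace_lower q : 0 < q <= delta -> normc X0 / 2 - q * C1 <= q * normc (laplace (q ^+ 2)).
Proof.
move=> /andP[q0 qd]; set s := q ^+ 2.
have s0 : 0 < s by rewrite exprn_gt0.
have q1 : q <= 1 := le_trans qd delta_le1.
have sq : s <= q by rewrite /s expr2 ler_piMl// ltW.
have sd : s <= delta := le_trans sq qd.
have [-> lW] := laplaceE s0.
set x := normc X0; have x0 : 0 < x by exact: x0_gt0.
pose Ds := (`]0, s]%classic : set R).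
(* Pointwise minorant of Re (conj(X0) Z w): the leading term on ]0, s], minus both kinds of error on
   the whole line. *)
pose low p := x ^+ 2 * (s `^ (a - 1) / (2 * s)) * \1_Ds p -
   x * (K * (\1_unit01 p * p `^ (a - 1)) + delta^-1 * normc (Z p)).
have lI : L1 (\1_Ds : R -> R).
  have : L1 (fun x : R => \1_Ds x * 1).
    apply: (@L1_indicP R Ds (fun=> 1)); [exact: measurable_itv|exact: measurable_cst|].
    apply: (@le_lt_trans _ _ (\int[mu]_(x in Ds) (cst 1%E x)))%E.
      by rewrite le_eqVlt; apply/orP; left; apply/eqP; apply: eq_integral => x1 _; rewrite normr1.
    rewrite integral_cst/=; last exact: measurable_itv.
    by rewrite mul1e /Ds lebesgue_measure_itv/= lte_fin s0 oppr0 adde0 ltry.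
  by congr (is_true (L1 _)); apply/funext => x1; rewrite mulr1.
have eI : Rint (\1_Ds : R -> R) = s.
  apply: EFin_inj; rewrite -(RintE lI) integral_indic; [|exact: measurableT|exact: measurable_itv].
  by rewrite setIT /Ds/= lebesgue_measure_itv/= lte_fin s0 oppr0 adde0.
have lp := integral_pow01 a_gt0.
have lE : L1 (fun p => K * (\1_unit01 p * p `^ (a - 1)) + delta^-1 * normc (Z p)).
  by apply: L1D; apply: L1Z; [exact: lp|exact: lnZ].
have llow : L1 low by apply: L1B; apply: L1Z; [exact: lI|exact: lE].
have elow : Rint low = x ^+ 2 * (s `^ (a - 1) / 2) - x * C1.
  rewrite (RintB (L1Z _ lI) (L1Z _ lE)) (RintZ _ lI) (RintZ _ lE) eI.
  rewrite (RintD (L1Z _ lp) (L1Z _ lnZ)) (RintZ _ lp) (RintZ _ lnZ) /C1.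
  by congr (_ - _); field; rewrite gt_eqF.
have lc : L1C (fun p => cj X0 * (Z p * w s p)) by exact: L1CZ lW.
have hle : Rint low <= re (cj X0 * Cint (fun p => Z p * w s p)).
  rewrite -(CintZ _ lW) reC; apply: le_Rint; [exact: llow|exact: lc.1|].
  move=> p; rewrite /low.
  have i0 : 0 <= \1_unit01 p * p `^ (a - 1) by rewrite mulr_ge0 ?indic_ge0 ?powR_ge0.
  have n0 := normc_ge0 (Z p).
  have di : 0 <= delta^-1 by rewrite invr_ge0 ltW.
  have [p0|p0] := leP p 0.
    rewrite (Z_neg p0) normc0 mul0r mulr0 re0 (indic_out (_ : ~ Ds p)); last first.
      by rewrite /Ds /= in_itv/= => /andP[]; rewrite ltNge p0.
    by rewrite !mulr0 sub0r addr0 oppr_le0; apply: mulr_ge0; [exact: ltW|exact: mulr_ge0].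
  have [pd|pd] := leP p delta; last first.
    rewrite (indic_out (_ : ~ Ds p)); last first.
      by rewrite /Ds /= in_itv/= => /andP[_]; rewrite leNgt (le_lt_trans sd pd).
    rewrite mulr0 sub0r lerNl.
    apply: le_trans (le_trans (ler_norm _) _); first by rewrite -reN; exact: lexx.
    rewrite reN normrN; apply: (le_trans (normc_re _)).
    rewrite (normcM (cj X0)) normc_cj; apply: ler_wpM2l; first exact: ltW.
    rewrite normcM; apply: (@le_trans _ _ (delta^-1 * normc (Z p))).
      rewrite mulrC; apply: ler_wpM2r => //; apply: (le_trans (normc_w s p0)).
      by rewrite lef_pV2 ?posrE// ltW.
    by rewrite lerDr mulr_ge0.
  have p1 : p <= 1 := le_trans pd delta_le1.
  have e1 : \1_unit01 p = 1 :> R by apply: indic_in; rewrite /= in_itv/= p0.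
  have pw : p `^ a * p^-1 = p `^ (a - 1) by rewrite !powR_exp// mulrBl mul1r expRB lnK.
  set E := Z p - (p `^ (a - 1))%:C * X0.
  have -> : cj X0 * (Z p * w s p) = (p `^ (a - 1) * x ^+ 2)%:C * w s p + cj X0 * (E * w s p).
    have -> : (p `^ (a - 1) * x ^+ 2)%:C = (p `^ (a - 1))%:C * (X0 * cj X0) :> C by rewrite mulcj -rmorphM.
    by rewrite /E; ring.
  rewrite reD; apply: lerD.
    rewrite reM reR imR mul0r subr0 re_w.
    have sp0 : 0 < s ^+ 2 + p ^+ 2 by rewrite addr_gt0// exprn_gt0.
    have [ps|ps] := leP p s; last first.
      rewrite (indic_out (_ : ~ Ds p)); last by rewrite /Ds /= in_itv/= => /andP[_]; rewrite leNgt ps.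
      rewrite mulr0; apply: mulr_ge0; first by rewrite mulr_ge0 ?powR_ge0 ?sqr_ge0.
      by rewrite divr_ge0 ?(ltW s0) ?(ltW sp0).
    rewrite (indic_in (_ : Ds p)); last by rewrite /Ds /= in_itv/= p0.
    rewrite mulr1 [leLHS]mulrA; apply: ler_pM.
    + by apply: mulr_ge0; [exact: sqr_ge0|exact: powR_ge0].
    + by rewrite invr_ge0 mulr_ge0// ltW.
    + have t0 : 0 <= s `^ (a - 1) by exact: powR_ge0.
      rewrite mulrC; apply: ler_wpM2r; first exact: sqr_ge0.
      rewrite !powR_exp// ler_expR; have := a_le.
      by have := ler_ln; move=> /(_ R p s); rewrite !posrE p0 s0 ps => /(_ isT isT); nra.
    + have h2 : 2 * s * s = s ^+ 2 + s ^+ 2 by ring.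
      have -> : (2 * s)^-1 = s / (2 * s * s) by field; rewrite gt_eqF.
      apply: ler_wpM2l; first exact: ltW.
      rewrite lef_pV2 ?posrE// h2 ?addr_gt0 ?exprn_gt0// lerD2l.
      by rewrite !expr2 ler_pM// ltW.
  rewrite lerNl -reN; apply: (le_trans (ler_norm _)); rewrite reN normrN.
  apply: (le_trans (normc_re _)); rewrite (normcM (cj X0)) normc_cj; apply: ler_wpM2l; first exact: ltW.
  rewrite normcM e1 mul1r; apply: (@le_trans _ _ (K * p `^ a * p^-1)).
    by apply: ler_pM; rewrite ?normc_ge0 ?normc_w// Z_lead ?p0.
  by rewrite -mulrA pw lerDl mulr_ge0.
have hre : re (cj X0 * Cint (fun p => Z p * w s p)) <= x * normc (Cint (fun p => Z p * w s p)).
  by apply: (le_trans (ler_norm _)); apply: (le_trans (normc_re _)); rewrite (normcM (cj X0)) normc_cj.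
have := le_trans hle hre; rewrite elow.
(* This quantity is q^(2 a - 1): the bound a <= 1/2 makes the exponent nonpositive, and q <= 1. *)
have hs : 1 <= q * s `^ (a - 1).
  rewrite /s -powR_mulrn ?(ltW q0)// -powRrM (powR_exp _ q0).
  have eq : q = expR (ln q) by rewrite lnK.
  rewrite {1}eq -expRD -[leLHS]expR0 ler_expR.
  by have := ln_le0 q1; have := a_le; nra.
set n := normc _; have : 0 < x * 1 by rewrite mulr1.
move: (s `^ (a - 1)) hs => t hs _ h.
have h2 : x * (x * (q * t) / 2 - q * C1) <= x * (q * n).
  have -> : x * (x * (q * t) / 2 - q * C1) = q * (x ^+ 2 * (t / 2) - x * C1) by ring.
  have -> : x * (q * n) = q * (x * n) by ring.
  by apply: ler_wpM2l => //; exact: ltW.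
move: h2; rewrite ler_pM2l// => h2; apply: le_trans h2; apply: lerB => //.
by apply: ler_wpM2r => //; rewrite ler_peMr// ltW.
Qed.

(** Where q |G| <= lam |G|^2 the integrand is at most the minimum. Elsewhere |G| < q / lam, and the
    integral of (q^2 / lam) exp (- q^2 u) is 1 / lam. Unlike Cauchy-Schwarz, this leaves a term that
    tends to 0 with q for fixed [lam], plus one that is small for large [lam]. *)
Let laplace_upper lam q : 0 < lam -> 0 < q ->
  L1 (fun u => \1_pos u * normc (G u) ^+ 2) ->
  q * normc (laplace (q ^+ 2)) <=
    2 * Rint (fun u => \1_pos u * Num.min (lam * normc (G u) ^+ 2) (q * normc (G u))) + 2 / lam.
Proof.
move=> l0 q0 lG; set h := (fun u => _ * Num.min _ _).
have mnG : measurable_fun setT (fun u => normc (G u)) by exact: (m_normc mG).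
have s0 : 0 < q ^+ 2 by rewrite exprn_gt0.
have lh : L1 h.
  apply: (L1_le _ _ (L1Z lam lG)).
    rewrite /h; apply: measurable_funM; first by mea.
    by apply: measurable_minr; mea.
  move=> u; rewrite /h normrM (ger0_norm (indic_ge0 _ _)) [leRHS]mulrCA; apply: ler_wpM2l; first exact: indic_ge0.
  rewrite ger0_norm; first by rewrite ge_min lexx.
  by rewrite le_min !mulr_ge0 ?normc_ge0 ?sqr_ge0 ?(ltW l0) ?(ltW q0).
have lx := L1_expN s0.
have ex : Rint (fun u => \1_pos u * expR (- (q ^+ 2 * u))) = (q ^+ 2)^-1.
  have := Cint_halfline 0 s0; rewrite rmorph0 mulr0 subr0.
  rewrite (_ : (fun p => _) = (fun p => (\1_pos p * expR (- (q ^+ 2 * p)))%:C)); last first.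
    by apply/funext => p; rewrite mul0r cis0 mulr1.
  rewrite Cint_real -fmorphV => /(congr1 (@re R)); by rewrite !reR.
have eR : 2 * Rint h + 2 / lam = 2 * Rint (fun u => h u + q ^+ 2 / lam * (\1_pos u * expR (- (q ^+ 2 * u)))).
  rewrite (RintD lh (L1Z _ lx)) (RintZ _ lx) ex; field.
  by rewrite !gt_eqF.
rewrite eR.
have lGl : L1C (fun u => (\1_pos u * expR (- (q ^+ 2 * u)))%:C * G u).
  have b u : normc (G u) <= 2 * Rint (fun p => normc (Z p)).
    apply: normc_Cint_le; [exact: L1C_meas|exact: lnZ|].
    by move=> p; rewrite normcM normc_cis mulr1.
  have := L1C_mul mG (L1C_real lx) b; congr (L1C _); apply/funext => u; exact: mulrC.
have -> : q * normc (laplace (q ^+ 2)) = normc (Cint (fun u => q%:C * ((\1_pos u * expR (- (q ^+ 2 * u)))%:C * G u))).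
  by rewrite (CintZ _ lGl) (normcM q%:C) normcR gtr0_norm.
apply: normc_Cint_le.
- exact: (L1C_meas (L1CZ _ lGl)).
- exact: (L1D lh (L1Z _ lx)).
- move=> u; rewrite (normcM q%:C) (normcM (_)%:C) !normcR (gtr0_norm q0) /h.
  rewrite (ger0_norm (mulr_ge0 (indic_ge0 _ _) (expR_ge0 _))).
  have : 0 <= \1_pos u :> R by exact: indic_ge0.
  have [u0|u0] := pselect (pos u); last by rewrite (indic_out u0) !(mul0r, mulr0, addr0).
  rewrite (indic_in u0) !mul1r => _; set E := expR _; set n := normc _.
  have E0 : 0 <= E by exact: expR_ge0.
  have E1 : E <= 1.
    by rewrite /E expR_le1 oppr_le0 mulr_ge0 ?sqr_ge0//; move: u0; rewrite /= in_itv/= andbT.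
  have n0 : 0 <= n by exact: normc_ge0.
  have t0 : 0 <= q ^+ 2 / lam * E by rewrite mulr_ge0 ?divr_ge0 ?sqr_ge0 ?(ltW l0).
  have [hc|hc] := leP (q * n) (lam * n ^+ 2).
    by apply: ler_wpDr => //; rewrite mulrCA ler_piMl// mulr_ge0// ltW.
  apply: ler_wpDl; first by rewrite mulr_ge0 ?sqr_ge0 ?(ltW l0).
  rewrite mulrCA mulrC; apply: ler_wpM2r => //.
  have nn : 0 < n by rewrite lt_neqAle n0 andbT; apply: contraTneq hc => <-; rewrite expr0n/= !mulr0 ltxx.
  rewrite ler_pdivlMr// expr2 -mulrA; apply: ler_wpM2l; first exact: ltW.
  by move: hc; rewrite expr2 mulrA ltr_pM2r// mulrC => /ltW.
Qed.

Lemma not_square_integrable_transform : ~ L1 (fun u => \1_pos u * normc (G u) ^+ 2).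
Proof.
move=> lG; set x := normc X0; have x0 : 0 < x := x0_gt0.
(* Then 2 / lam = x / 4, half of the lower bound x / 2; as q -> 0 all other terms vanish, dominated
   by lam |G|^2. *)
pose lam := 8 / x; have l0 : 0 < lam by rewrite divr_gt0.
have mnG : measurable_fun setT (fun u => normc (G u)) by exact: (m_normc mG).
pose q n : R := delta / n.+1%:R.
have q0 n : 0 < q n by rewrite divr_gt0.
have qd n : q n <= delta by rewrite ler_pdivrMr// ler_peMr ?ler1n// ltW.
have cq : q n @[n --> \oo] --> 0.
  by rewrite -(mulr0 delta); apply: cvgM; [exact: cvg_cst|exact: cvg_natSV].
pose h n u := \1_pos u * Num.min (lam * normc (G u) ^+ 2) (q n * normc (G u)).
have m0 n u : 0 <= Num.min (lam * normc (G u) ^+ 2) (q n * normc (G u)).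
  by rewrite le_min (mulr_ge0 (ltW l0) (sqr_ge0 _)) (mulr_ge0 (ltW (q0 n)) (normc_ge0 _)).
have [||||_] := @dominated_Rint R h (fun=> 0) _ _ _ (L1Z lam lG).
- move=> n; rewrite /h; apply: measurable_funM; first by mea.
  by apply: measurable_minr; mea.
- exact: measurable_cst.
- move=> u; apply: (@squeeze_cvgr _ _ _ _ (fun=> 0) (fun n => q n * normc (G u))).
  + apply: nearW => n; apply/andP; split; first by apply: mulr_ge0; [exact: indic_ge0|exact: m0].
    apply: (@le_trans _ _ (Num.min (lam * normc (G u) ^+ 2) (q n * normc (G u)))).
      apply: ler_piMl; [exact: m0|exact: le_trans (ler_norm _) (indic_le1 _ _)].
    by rewrite ge_min lexx orbT.
  + exact: cvg_cst.
  + by rewrite -(mul0r (normc (G u))); apply: cvgM => //; exact: cvg_cst.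
- move=> n u; rewrite /h normrM (ger0_norm (indic_ge0 _ _)) (ger0_norm (m0 n u)) [leRHS]mulrCA.
  apply: ler_wpM2l; first exact: indic_ge0.
  by rewrite ge_min lexx.
have -> : Rint (fun _ : R => 0) = 0 :> R by rewrite /Rint /Rintegral integral0.
move=> ch.
have cl : 2 * Rint (h n) + q n * C1 @[n --> \oo] --> (0 : R).
  rewrite [X in _ --> X](_ : _ = 2 * 0 + 0 * C1); last by rewrite mulr0 mul0r addr0.
  by apply: cvgD; apply: cvgM => //; exact: cvg_cst.
have x4 : 0 < x / 4 by rewrite divr_gt0.
have [N _ /(_ N (leqnn N)) hN] := cvgr_lt _ cl _ x4.
have := le_trans (laplace_lower (_ : 0 < q N <= delta)) (laplace_upper l0 (q0 N) lG).
rewrite q0 qd => /(_ erefl).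
have -> : 2 / lam = x / 4 by rewrite /lam; field; rewrite gt_eqF.
by rewrite -/(h N) -/x; move: hN; lra.
Qed.

End SingularSpectrum.

(** * Particle numbers *)

Section PositiveIntegrals.
Variable R : realType.
Local Notation mu := (@lebesgue_measure R).
Implicit Types (D : set R) (f g h : R -> R).

Lemma integral_le_add D f g h : measurable D ->
  measurable_fun setT f -> measurable_fun setT g -> measurable_fun setT h ->
  (forall x, D x -> 0 <= f x) -> (forall x, D x -> 0 <= g x) -> (forall x, D x -> 0 <= h x) ->
  (forall x, D x -> f x <= g x + h x) ->
  (\int[mu]_(x in D) (f x)%:E <= \int[mu]_(x in D) (g x)%:E + \int[mu]_(x in D) (h x)%:E)%E.
Proof.
move=> mD mf mg mh f0 g0 h0 fgh.
have mE u : measurable_fun setT u -> measurable_fun D (fun x => (u x)%:E).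
  by move=> mu'; apply/measurable_EFinP; exact: measurable_funTS.
rewrite -ge0_integralD//; last 2 first.
- exact: mE.
- exact: mE.
apply: ge0_le_integral => //.
- exact: mE.
- by apply: emeasurable_funD; exact: mE.
Qed.

Lemma integral_add_lty D f g h : measurable D ->
  measurable_fun setT f -> measurable_fun setT g -> measurable_fun setT h ->
  (forall x, D x -> 0 <= f x) -> (forall x, D x -> 0 <= g x) -> (forall x, D x -> 0 <= h x) ->
  (forall x, D x -> f x <= g x + h x) ->
  (\int[mu]_(x in D) (g x)%:E < +oo)%E -> (\int[mu]_(x in D) (h x)%:E < +oo)%E ->
  (\int[mu]_(x in D) (f x)%:E < +oo)%E.
Proof.
move=> mD mf mg mh f0 g0 h0 fgh gy hy.
by apply: le_lt_trans (integral_le_add mD mf mg mh f0 g0 h0 fgh) _; rewrite lte_add_pinfty.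
Qed.

Lemma integral_le_lty D f g : measurable D ->
  measurable_fun setT f -> measurable_fun setT g ->
  (forall x, D x -> 0 <= f x) -> (forall x, D x -> f x <= g x) ->
  (\int[mu]_(x in D) (g x)%:E < +oo)%E -> (\int[mu]_(x in D) (f x)%:E < +oo)%E.
Proof.
move=> mD mf mg f0 fg gy.
apply: (integral_add_lty mD mf mg (measurable_cst (0 : R)) f0 _ _ _ gy) => //.
- by move=> x Dx; exact: le_trans (f0 x Dx) (fg x Dx).
- by move=> x Dx; rewrite addr0 fg.
- by rewrite integral0 ltry.
Qed.

Lemma integral_Ioy_lty f : measurable_fun setT f -> (forall x, 0 < x -> 0 <= f x) ->
  (\int[mu]_(x in `]0%R, +oo[) (f x)%:E < +oo)%E <->
  (\int[mu]_(x in `]0%R, 1%R]) (f x)%:E < +oo)%E /\ (\int[mu]_(x in `[1%R, +oo[) (f x)%:E < +oo)%E.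
Proof.
move=> mf f0.
have mE (D : set R) : measurable_fun D (fun x => (f x)%:E).
  by apply/measurable_EFinP; exact: measurable_funTS.
have f1 x : `]0, +oo[%classic x -> (0 <= (f x)%:E)%E.
  by rewrite /= in_itv/= andbT lee_fin; exact: f0.
split=> [h|[h1 h2]].
  split; apply: le_lt_trans h.
    apply: ge0_subset_integral; [exact: measurable_itv|exact: measurable_itv|exact: mE|exact: f1|].
    by move=> x; rewrite /= !in_itv/= !andbT => /andP[].
  apply: ge0_subset_integral; [exact: measurable_itv|exact: measurable_itv|exact: mE|exact: f1|].
  by move=> x; rewrite /= !in_itv/= !andbT; exact: lt_le_trans.
have -> : `]0, +oo[%classic = `]0, 1]%classic `|` `]1, +oo[%classic :> set R.
  apply/seteqP; split => x /=; rewrite !in_itv/= !andbT.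
    by move=> x0; have [x1|x1] := leP x 1; [left; rewrite x0|right].
  by move=> [/andP[]//|]; exact: lt_trans.
rewrite ge0_integral_setU; [|exact: measurable_itv|exact: measurable_itv|exact: mE| |].
- rewrite lte_add_pinfty//; apply: le_lt_trans h2.
  apply: ge0_subset_integral; [exact: measurable_itv|exact: measurable_itv|exact: mE| |].
  + by move=> x; rewrite /= !in_itv/= !andbT lee_fin => x1; apply: f0; exact: lt_le_trans x1.
  + by move=> x; rewrite /= !in_itv/= !andbT; exact: ltW.
- by move=> x /=; rewrite !in_itv/= !andbT lee_fin => -[/andP[x0 _]|x1]; apply: f0 => //; exact: lt_trans x1.
- apply/disj_setPLR => x /=; rewrite !in_itv/= !andbT => /andP[_ x1].
  by apply/negP; rewrite -leNgt.
Qed.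

Lemma integral_cst01 (c : R) : (\int[mu]_(x in `]0%R, 1%R]) c%:E < +oo)%E.
Proof.
rewrite (_ : (fun=> c%:E) = cst c%:E)// integral_cst//=.
by rewrite lebesgue_measure_itv/= lte_fin ltr01 oppr0 adde0 mule1 ltry.
Qed.

Lemma integral_powR01 (b c : R) : 0 < b ->
  (\int[mu]_(x in `]0%R, 1%R]) (c * x `^ (b - 1))%:E < +oo)%E.
Proof.
move=> b0; have := integral_pow01 b0 => /(L1Z c) l.
rewrite integral_indic_mul.
rewrite (_ : (fun x => _) = (fun x => (c * (\1_(`]0, 1]%classic) x * x `^ (b - 1)))%:E)); last first.
  by apply/funext => x; rewrite mulrCA.
by rewrite (RintE l) ltry.
Qed.

Lemma integral_invsqr (c : R) : 0 <= c -> (\int[mu]_(x in `[1%R, +oo[) (c / x / x)%:E < +oo)%E.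
Proof.
move=> c0; rewrite (@integral_log_large R (fun x => c / x)).
- have := L1_expN (@ltr01 R) => /(L1Z c) l; rewrite integral_indic_mul.
  rewrite (_ : (fun x => _) = (fun x => (c * (\1_(`[0, +oo[%classic) x * expR (- (1 * x))))%:E)); last first.
    by apply/funext => x; rewrite mulrCA mul1r expRN.
  by rewrite (RintE l) ltry.
- by move=> k k0; apply: continuousM; [exact: cvg_cst|apply: inv_continuous; rewrite gt_eqF].
- by move=> k k0; rewrite divr_ge0// ltW.
Qed.

End PositiveIntegrals.

Lemma smooth_lipschitz0 (R : realType) (g : R -> R) : smooth g ->
  exists2 K, 0 <= K & forall p, 0 <= p <= 1 -> `|g p - g 0| <= K * p.
Proof.
move=> sg.
have d0 x : derivable g x 1 by exact: (sg 0%N x).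
have c1 : continuous (derive1 g).
  move=> x; apply: differentiable_continuous; apply/derivable1_diffP; exact: (sg 1%N x).
have cn : continuous (fun x => `|derive1 g x|).
  by move=> x; apply: continuous_comp; [exact: c1|exact: norm_continuous].
have [c c01 hc] := EVT_max ler01 (continuous_subspaceT (A := [set` `[(0 : R), 1]]) cn).
exists (`|derive1 g c|) => // p /andP[]; rewrite le_eqVlt => /predU1P[<- _|p0 p1].
  by rewrite subrr normr0 mulr0.
have [x _||x] := @MVT_segment R g (derive1 g) 0 p (ltW p0).
- by rewrite derive1E; apply: DeriveDef.
- apply: continuous_subspaceT => x; apply: differentiable_continuous.
  by apply/derivable1_diffP; exact: d0.
rewrite in_itv/= => /andP[x0 xp] ->.
rewrite subr0 normrM (gtr0_norm p0); apply: ler_wpM2r; first exact: ltW.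
by apply: hc; rewrite in_itv/= x0 (le_trans xp).
Qed.

Section SpectralDominationSquare.
Variable R : realType.

(** Squaring turns p^(b - 1) into p^((2 b - 1) - 1), which is integrable at 0 when b > 1/2. *)
Lemma sqr_spectral_dom (b c p : R) :
  spectral_dom b c p ^+ 2 <= 2 * spectral_dom (2 * b - 1) (2 * c) p.
Proof.
rewrite /spectral_dom.
have h x y : (x + y) ^+ 2 <= 2 * (x ^+ 2 + y ^+ 2) :> R.
  rewrite -subr_ge0; have -> : 2 * (x ^+ 2 + y ^+ 2) - (x + y) ^+ 2 = (x - y) ^+ 2 by ring.
  exact: sqr_ge0.
apply: (le_trans (h _ _)); apply: ler_wpM2l => //; rewrite !exprMn.
have i2 (D : set R) x : \1_D x ^+ 2 = \1_D x :> R.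
  by rewrite indicE; case: (_ \in _); rewrite ?expr1n// expr0n.
rewrite !i2; apply: lerD; last first.
  apply: ler_wpM2l; first exact: indic_ge0.
  by rewrite expr2 -expRD ler_expR; lra.
have [p0|p0] := pselect (`]0, 1]%classic p); last by rewrite (indic_out p0) !mul0r.
apply: ler_wpM2l; first exact: indic_ge0.
have p0' : 0 < p by move: p0; rewrite /= in_itv/= => /andP[].
by rewrite !powR_exp// expr2 -expRD ler_expR; lra.
Qed.

End SpectralDominationSquare.

(** * Integrals of the two amplitudes near 0 and at infinity *)

Section ParticleIntegrals.
Variable R : realType.
Local Notation mu := (@lebesgue_measure R).
Local Notation C := R[i].
Local Notation pos := (`[0, +oo[%classic : set R).
Local Notation unit01 := (`]0, 1]%classic : set R).
Variables (F chi : R -> C) (alpha K : R).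
Hypothesis lF : L1C F.
Hypothesis F_pos : forall p, p <= 0 -> cFT F p = 0.
Hypothesis alpha_gt0 : 0 < alpha.
Hypothesis F_chi : forall p, 0 < p -> cFT F p = (p `^ alpha)%:C * chi p.
Hypothesis K_ge0 : 0 <= K.
Hypothesis chi_lip : forall p, 0 <= p <= 1 -> normc (chi p - chi 0) <= K * p.
Hypothesis chi0 : chi 0 != 0.

Let chi_le p : 0 <= p <= 1 -> normc (chi p) <= normc (chi 0) + K.
Proof.
move=> p01; have -> : chi p = chi 0 + (chi p - chi 0) by ring.
apply: (le_trans (ler_normcD _ _)); apply: lerD => //.
apply: (le_trans (chi_lip p01)); case/andP: p01 => _ p1.
by rewrite -[leRHS]mulr1 ler_wpM2l.
Qed.

(** For p <= 1 the power p^alpha is at most p^a; for p >= 1 the transform is bounded and p^a >= 1.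
    The exponent can thus be lowered to at most 1, as the spectral majorants require. *)
Lemma F_bnd_exists a : 0 < a -> a <= alpha ->
  exists B, forall p, 0 < p -> normc (cFT F p) <= B * p `^ a.
Proof.
move=> a0 aal; set B1 := normc (chi 0) + K; set B2 := 2 * Rint (fun t => normc (F t)).
have B10 : 0 <= B1 by rewrite addr_ge0 ?normc_ge0.
have B20 : 0 <= B2 := le_trans (normc_ge0 _) (normc_cFT 0 lF).
exists (B1 + B2) => p p0; have pa : 0 <= p `^ a by exact: powR_ge0.
have [p1|/ltW p1] := leP p 1.
  rewrite (F_chi p0) normcM normcR (ger0_norm (powR_ge0 _ _)).
  apply: (@le_trans _ _ (B1 * p `^ a)); last by apply: ler_wpM2r => //; rewrite lerDl.
  rewrite mulrC; apply: ler_pM; rewrite ?normc_ge0 ?powR_ge0//.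
    by apply: chi_le; rewrite p1 ltW.
  by rewrite !powR_exp// ler_expR; have := ln_le0 p1; nra.
apply: (le_trans (normc_cFT p lF)); apply: (@le_trans _ _ (B2 * p `^ a)).
  by rewrite -[leLHS]mulr1 ler_wpM2l// powR_exp// -expR0 ler_expR mulr_ge0 ?ln_ge0// ltW.
by apply: ler_wpM2r => //; rewrite lerDr.
Qed.

Let Bn := 2 * Rint (fun t => normc (F t)).

Lemma measurable_sqr_FX : measurable_fun setT (fun k => normc (FX F k) ^+ 2).
Proof.
apply: measurable_funX; apply: m_normc; apply: mC_continuous => k u uk.
apply: (@cvgC_Cint_param R (fun k t => F t * cis (k * xcoord t)) (fun t => normc (F t))).
- move=> w; apply: L1C_meas; apply: L1C_cis => //.
  by apply: measurable_funM => //; exact: measurable_xcoord.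
- exact: L1C_norm.
- by move=> w p; rewrite normcM normc_cis mulr1.
- move=> p; apply: cvgCM; first exact: cvgC_cst.
  by apply: cvgC_cis; apply: cvgM => //; exact: cvg_cst.
Qed.

Let cFTh k (u : nat -> R) : u n @[n --> \oo] --> k -> cvgC (fun n => FTh F (u n)) (FTh F k).
Proof.
move=> uk.
apply: (@cvgC_Cint_param R (fun k t => F t * cis (- (k * expR (- t)))) (fun t => normc (F t))).
- by move=> w; apply: L1C_meas; apply: L1C_cis => //; mea.
- exact: L1C_norm.
- by move=> w p; rewrite normcM normc_cis mulr1.
- move=> p; apply: cvgCM; first exact: cvgC_cst.
  by apply: cvgC_cis; apply: cvgN; apply: cvgM => //; exact: cvg_cst.
Qed.

Let cT : continuous (fun k => normc (FTh F k) ^+ 2).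
Proof.
have [a b] := cvgC_continuous cFTh.
rewrite (_ : (fun k => _) = (fun k => re (FTh F k) * re (FTh F k) + im (FTh F k) * im (FTh F k))).
  by move=> k; exact: (cvgD (cvgM (a k) (a k)) (cvgM (b k) (b k))).
by apply/funext => k; rewrite sqr_normc !expr2.
Qed.

Lemma measurable_sqr_FTh : measurable_fun setT (fun k => normc (FTh F k) ^+ 2).
Proof. exact: continuous_measurable_fun cT. Qed.

Let mdiv (h : R -> R) : measurable_fun setT h -> measurable_fun setT (fun k => h k / k).
Proof. by move=> mh; mea. Qed.

Lemma check_small_lty : (\int[mu]_(k in `]0%R, 1%R]) (normc (FX F k) ^+ 2 / k)%:E < +oo)%E.
Proof.
(* Any positive exponent suffices: [FX_small] bounds the square of the amplitude by a multiple of
   k^a, and k^(a - 1) is integrable on ]0, 1]. *)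
pose a := Num.min alpha 1.
have a0 : 0 < a by rewrite lt_min alpha_gt0/=.
have aal : a <= alpha by rewrite ge_min lexx.
have [B hB] := F_bnd_exists a0 aal.
have a1 : a <= 1 by rewrite ge_min lexx orbT.
have [K1 hK] := FX_small lF F_pos a0 a1 hB.
apply: (integral_le_lty _ _ _ _ _ (integral_powR01 (K1 ^+ 2) a0)) => //.
- exact: (mdiv measurable_sqr_FX).
- by apply: measurable_funM => //; exact: measurable_powR.
- by move=> k; rewrite /= in_itv/= => /andP[k0 _]; rewrite divr_ge0 ?sqr_ge0// ltW.
- move=> k; rewrite /= in_itv/= => k01; have k0 : 0 < k by case/andP: k01.
  rewrite (powR_exp (a - 1) k0) mulrBl mul1r expRB lnK ?posrE// mulrA.
  apply: ler_wpM2r; first by rewrite invr_ge0 ltW.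
  have -> : expR (a * ln k) = (k `^ (a / 2)) ^+ 2.
    by rewrite powR_exp// expr2 -expRD; congr expR; field.
  rewrite -exprMn; apply: lerXn2r; rewrite ?nnegrE ?normc_ge0 ?hK//.
  exact: le_trans (normc_ge0 _) (hK k k01).
Qed.

(** The amplitudes are bounded and differ by O(1/k), hence so do their squares, and dk / k^2
    converges at infinity. *)
Lemma check_Th_large_lty :
  (\int[mu]_(k in `[1%R, +oo[) (`|normc (FX F k) ^+ 2 - normc (FTh F k) ^+ 2| / k)%:E < +oo)%E.
Proof.
have [K1 hK] := FX_FTh_close lF F_pos.
have K10 : 0 <= K1 by have := le_trans (normc_ge0 _) (hK 1 ltr01); rewrite divr1.
have Bn0 : 0 <= Bn := le_trans (normc_ge0 _) (normc_FX lF 0).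
have c0 : 0 <= K1 * (Bn + Bn) by rewrite mulr_ge0 ?addr_ge0.
have md : measurable_fun setT (fun k => `|normc (FX F k) ^+ 2 - normc (FTh F k) ^+ 2|).
  by apply: measurable_comp_norm; exact: (measurable_funB measurable_sqr_FX measurable_sqr_FTh).
have memL k : `[1, +oo[%classic k -> 1 <= k by rewrite /= in_itv/= andbT.
apply: (integral_le_lty _ _ _ _ _ (integral_invsqr c0)) => //.
- exact: (mdiv md).
- by apply: mdiv; mea.
- by move=> k /memL k1; rewrite divr_ge0// (le_trans ler01).
- move=> k /memL k1; have k0 : 0 < k := lt_le_trans ltr01 k1.
  apply: ler_wpM2r; first by rewrite invr_ge0 ltW.
  apply: (le_trans (ler_dist_sqr_normc _ _)); rewrite mulrAC.
  apply: ler_pM; rewrite ?normc_ge0 ?addr_ge0 ?normc_ge0 ?hK//.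
  by apply: lerD; [exact: normc_FX|exact: normc_FTh].
Qed.

Section Thermal.
Variables (a B : R).
Hypothesis a_gt0 : 0 < a.
Hypothesis a_le1 : a <= 1.
Hypothesis F_bnd : forall p, 0 < p -> normc (cFT F p) <= B * p `^ a.
Local Notation Z := (thermal_spectrum F).
Local Notation G := (fun u => Cint (fun p => Z p * cis (p * u))).
Local Notation r := (shifted_spectrum F).

Let lZ : L1C Z := L1C_thermal_spectrum lF F_pos a_gt0 a_le1 F_bnd.
Let FThE u : FTh F (expR u) = G u := FTh_fourier lF F_pos a_gt0 a_le1 F_bnd u.

(** e = 1 is used for the momenta k >= 1 and e = -1 for k <= 1. *)
Lemma thermal_log e : e ^+ 2 = 1 ->
  (\int[mu]_(u in `[0%R, +oo[) (normc (FTh F (expR (e * u))) ^+ 2)%:E < +oo)%E <->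
  L1 (fun u => \1_pos u * normc (Cint (fun p => Z p * cis (p * (e * u)))) ^+ 2).
Proof.
move=> e2.
have mT : measurable_fun setT (fun u => normc (FTh F (expR (e * u))) ^+ 2).
  have me : measurable_fun setT (fun u : R => expR (e * u)) by mea.
  exact: (measurableT_comp measurable_sqr_FTh me).
have eT : (fun u => \1_pos u * normc (FTh F (expR (e * u))) ^+ 2) =
  (fun u => \1_pos u * normc (Cint (fun p => Z p * cis (p * (e * u)))) ^+ 2).
  by apply/funext => u; rewrite FThE.
rewrite -eT; split=> h.
  apply: L1_indicP => //; apply: le_lt_trans h.
  by rewrite le_eqVlt; apply/orP; left; apply/eqP; apply: eq_integral => u _; rewrite ger0_norm ?sqr_ge0.
by rewrite integral_indic_mul (RintE h) ltry.
Qed.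

(** The pole part is bounded by [spectral_dom a], whose square is integrable for a > 1/2; the gap
    part is a bounded function times a decaying exponential. *)
Lemma thermal_square_integrable : 1 / 2 < a -> L1 (fun p => normc (Z p) ^+ 2).
Proof.
move=> a2; pose M := 2 * Rint (fun v => `|step_gap v| : R).
have mZ := L1C_meas lZ.
pose c : R := (2 * pi)^-1.
have c_ge0 : 0 <= c by rewrite invr_ge0 ltW ?twopi_gt0.
have B0 := B_ge0 F_bnd.
have s0 := pihalf_gt0 R.
have ld : L1 (spectral_dom (2 * a - 1) (2 * (pi / 2) : R)).
  by apply: L1_spectral_dom; [lra|rewrite mulr_gt0].
have le : L1 (fun p : R => \1_pos p * expR (- (pi / 2 * p))) := L1_expN s0.
pose D p : R := c ^+ 2 * (4 * B ^+ 2 * spectral_dom (2 * a - 1) (2 * (pi / 2)) p +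
   2 * (M * Bn) ^+ 2 * (\1_pos p * expR (- (pi / 2 * p)))).
have lD : L1 D by apply: L1Z; apply: L1D; exact: L1Z.
apply: L1_le lD.
  by apply: measurable_funX; exact: (m_normc mZ).
move=> p; rewrite ger0_norm ?sqr_ge0//.
rewrite /thermal_spectrum (normcM (_)%:C) normcR (ger0_norm c_ge0) exprMn.
apply: ler_wpM2l; first exact: sqr_ge0.
have h x y : (x + y) ^+ 2 <= 2 * x ^+ 2 + 2 * y ^+ 2 :> R.
  rewrite -subr_ge0; have -> : 2 * x ^+ 2 + 2 * y ^+ 2 - (x + y) ^+ 2 = (x - y) ^+ 2 by ring.
  exact: sqr_ge0.
have n1 := normc_div_spectrum F_pos a_le1 F_bnd p.
have n2 : normc (r p * step_gap_hat p) <= \1_pos p * expR (- (pi / 2 * p)) * (M * Bn).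
  rewrite (normcM (r p)) normc_shifted_spectrum -(mulrA (\1_pos p * expR (- (pi / 2 * p)))).
  apply: ler_wpM2l; first by rewrite mulr_ge0 ?indic_ge0 ?expR_ge0.
  by rewrite mulrC; apply: ler_pM; [exact: normc_ge0|exact: normc_ge0|exact: normc_step_gap_hat|exact: normc_cFT].
have n3 : normc (r p * ('i%C * (p^-1)%:C + step_gap_hat p)) <=
  B * spectral_dom a (pi / 2) p + \1_pos p * expR (- (pi / 2 * p)) * (M * Bn).
  have -> : r p * ('i%C * (p^-1)%:C + step_gap_hat p) = 'i%C * (r p * (p^-1)%:C) + r p * step_gap_hat p by ring.
  apply: (le_trans (ler_normcD _ _)); apply: lerD => //.
  by rewrite (normcM 'i%C) normci mul1r.
have i0 : 0 <= \1_pos p * expR (- (pi / 2 * p)) by rewrite mulr_ge0 ?indic_ge0 ?expR_ge0.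
have n4 := le_trans (normc_ge0 _) n3.
apply: (le_trans (lerXn2r 2 (_ : _ \in Num.nneg) (_ : _ \in Num.nneg) n3)); rewrite ?nnegrE ?normc_ge0//.
apply: (le_trans (h _ _)); apply: lerD.
  rewrite exprMn; have -> : 4 * B ^+ 2 * spectral_dom (2 * a - 1) (2 * (pi / 2)) p =
    2 * (B ^+ 2 * (2 * spectral_dom (2 * a - 1) (2 * (pi / 2)) p)) by ring.
  by apply: ler_wpM2l => //; apply: ler_wpM2l; [exact: sqr_ge0|exact: sqr_spectral_dom].
rewrite exprMn; set m := (M * Bn) ^+ 2; rewrite -(mulrA 2 m); apply: ler_wpM2l => //.
rewrite mulrC; apply: ler_wpM2l; first exact: sqr_ge0.
rewrite expr2; apply: ler_piMl => //; have := indic_le1 pos p; rewrite ger0_norm ?indic_ge0// => i1.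
have [p0|p0] := pselect (pos p); last by rewrite (indic_out p0) !mul0r.
rewrite (indic_in p0) !mul1r expR_le1 oppr_le0 mulr_ge0 ?(ltW s0)//.
by move: p0; rewrite /= in_itv/= andbT.
Qed.

(** Near 0 the factors exp (- pi p / 2) and chi(p) differ from 1 and chi(0) by O(p), and the bounded
    gap term is O(p) relative to the pole, so p^(a - 1) is accompanied by an error of order p^a. *)
Lemma thermal_lead : a = alpha -> exists2 K1, 0 <= K1 & forall p, 0 < p <= 1 ->
  normc (Z p - (p `^ (a - 1))%:C * (((2 * pi)^-1)%:C * (chi 0 * 'i%C))) <= K1 * p `^ a.
Proof.
move=> aE; pose M := 2 * Rint (fun v => `|step_gap v| : R).
pose c : R := (2 * pi)^-1.
have c_ge0 : 0 <= c by rewrite invr_ge0 ltW ?twopi_gt0.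
have s0 := pihalf_gt0 R.
have M0 : 0 <= M := le_trans (normc_ge0 _) (normc_step_gap_hat 0).
set n := normc (chi 0); have n0 : 0 <= n by exact: normc_ge0.
(* In order: the variation of chi, the variation of the exponential, and the gap term, with n + K a
   bound of chi on [0, 1]. *)
exists (c * ((K + pi / 2 * n) + (n + K) * M)).
  apply: mulr_ge0 => //; apply: addr_ge0.
    by apply: addr_ge0 => //; apply: mulr_ge0 => //; exact: ltW.
  by apply: mulr_ge0 => //; exact: addr_ge0.
move=> p /andP[p0 p1].
have p01 : 0 <= p <= 1 by rewrite p1 ltW.
set E := expR (- (pi / 2 * p)).
have E0 : 0 <= E by exact: expR_ge0.
have E1 : E <= 1 by rewrite expR_le1 oppr_le0 mulr_ge0// ltW.
have E2 : 1 - E <= pi / 2 * p by have := expR_ge1Dx (- (pi / 2 * p)); rewrite -/E; lra.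
have pa : p `^ a = p `^ (a - 1) * p.
  by rewrite !powR_exp// mulrBl mul1r expRB lnK// divfK// gt_eqF.
have rE : r p = (E * (p `^ (a - 1) * p))%:C * chi p.
  rewrite /shifted_spectrum (F_chi p0) -aE pa.
  rewrite (indic_in (_ : pos p)); last by rewrite /= in_itv/= (ltW p0).
  by rewrite mul1r mulrA -rmorphM.
set q := p `^ (a - 1); have q0 : 0 <= q by exact: powR_ge0.
have -> : Z p - q%:C * (c%:C * (chi 0 * 'i%C)) =
  c%:C * (q%:C * ('i%C * (E%:C * (chi p - chi 0) - (1 - E)%:C * chi 0) + (E * p)%:C * chi p * step_gap_hat p)).
  rewrite /thermal_spectrum rE -/q.
  have -> : (E * (q * p))%:C = E%:C * q%:C * p%:C :> C by rewrite !rmorphM/=; ring.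
  have -> : (1 - E)%:C = 1 - E%:C :> C by rewrite rmorphB rmorph1.
  have -> : (E * p)%:C = E%:C * p%:C :> C by exact: rmorphM.
  have ip : p%:C * (p^-1)%:C = 1 :> C by rewrite -rmorphM divff ?gt_eqF// rmorph1.
  move: (p%:C) (p^-1)%:C ip => x y xy.
  have -> : E%:C * q%:C * x * chi p * ('i%C * y + step_gap_hat p) =
    E%:C * q%:C * chi p * ('i%C * (x * y)) + E%:C * q%:C * x * chi p * step_gap_hat p by ring.
  rewrite xy; ring.
rewrite (normcM c%:C) normcR (ger0_norm c_ge0) -(mulrA c); apply: ler_wpM2l => //.
rewrite (normcM q%:C) normcR (ger0_norm q0) pa -/q [leRHS]mulrCA; apply: ler_wpM2l => //.
apply: (le_trans (ler_normcD _ _)); rewrite mulrDl; apply: lerD.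
  rewrite (normcM 'i%C) normci mul1r mulrDl.
  apply: (le_trans (ler_normcB _ _)); apply: lerD.
    rewrite normcM normcR (ger0_norm E0); apply: le_trans (chi_lip p01).
    by rewrite ler_piMl// normc_ge0.
  rewrite normcM normcR ger0_norm ?subr_ge0// -/n mulrAC.
  by apply: ler_wpM2r.
rewrite (normcM ((E * p)%:C * chi p)) (normcM (E * p)%:C) normcR ger0_norm ?mulr_ge0 ?(ltW p0)//.
have h1 : E * p * normc (chi p) <= p * (n + K).
  by apply: ler_pM; rewrite ?mulr_ge0 ?normc_ge0 ?(ltW p0)// ?chi_le// ler_piMl// ltW.
apply: (@le_trans _ _ (p * (n + K) * M)).
  by apply: ler_pM; rewrite ?normc_ge0 ?normc_step_gap_hat// !mulr_ge0 ?normc_ge0// ltW.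
by rewrite -mulrA mulrC.
Qed.

End Thermal.

Let T_ge0 k : 0 < k -> 0 <= normc (FTh F k) ^+ 2.
Proof. by move=> _; exact: sqr_ge0. Qed.

Let sqN1 : (-1) ^+ 2 = 1 :> R.
Proof. by rewrite sqrrN expr1n. Qed.

Let cT_at (k : R) : 0 < k -> {for k, continuous (fun k => normc (FTh F k) ^+ 2)}.
Proof. by move=> _; exact: cT. Qed.

Let Th_largeE : (\int[mu]_(k in `[1%R, +oo[) (normc (FTh F k) ^+ 2 / k)%:E =
  \int[mu]_(u in `[0%R, +oo[) (normc (FTh F (expR (1 * u))) ^+ 2)%:E)%E.
Proof.
rewrite (@integral_log_large R (fun k => normc (FTh F k) ^+ 2) cT_at T_ge0).
by apply: eq_integral => u _; rewrite mul1r.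
Qed.

Let Th_smallE : (\int[mu]_(k in `]0%R, 1%R]) (normc (FTh F k) ^+ 2 / k)%:E =
  \int[mu]_(u in `[0%R, +oo[) (normc (FTh F (expR (-1 * u))) ^+ 2)%:E)%E.
Proof.
rewrite (@integral_log_small R (fun k => normc (FTh F k) ^+ 2) cT_at T_ge0).
by apply: eq_integral => u _; rewrite mulN1r.
Qed.

Lemma checkTh_lty : 1 / 2 < alpha ->
  (\int[mu]_(k in `]0%R, 1%R]) (normc (FTh F k) ^+ 2 / k)%:E < +oo)%E /\
  (\int[mu]_(k in `[1%R, +oo[) (normc (FTh F k) ^+ 2 / k)%:E < +oo)%E.
Proof.
move=> al; pose a := Num.min alpha 1.
have a2 : 1 / 2 < a by rewrite lt_min al/=; lra.
have a0 : 0 < a by apply: lt_trans a2; rewrite divr_gt0.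
have a1 : a <= 1 by rewrite ge_min lexx orbT.
have aal : a <= alpha by rewrite ge_min lexx.
have [B hB] := F_bnd_exists a0 aal.
have lZ := L1C_thermal_spectrum lF F_pos a0 a1 hB.
have l := square_integrable_transform lZ (thermal_square_integrable a0 a1 hB a2).
rewrite Th_smallE Th_largeE; split.
  apply/(thermal_log a0 a1 hB sqN1); apply: (L1_indic (measurable_itv _)).
  by have := L1_opp l; congr (is_true (L1 _)); apply/funext => u; rewrite mulN1r.
apply/(thermal_log a0 a1 hB (expr1n _ 2)); apply: (L1_indic (measurable_itv _)).
by have := l; congr (is_true (L1 _)); apply/funext => u; rewrite mul1r.
Qed.

Lemma checkTh_nlty : alpha <= 1 / 2 ->
  ~ (\int[mu]_(k in `]0%R, 1%R]) (normc (FTh F k) ^+ 2 / k)%:E < +oo)%E /\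
  ~ (\int[mu]_(k in `[1%R, +oo[) (normc (FTh F k) ^+ 2 / k)%:E < +oo)%E.
Proof.
move=> al; have a1 : alpha <= 1 by lra.
have [B hB] := F_bnd_exists alpha_gt0 (lexx _).
have lZ := L1C_thermal_spectrum lF F_pos alpha_gt0 a1 hB.
have [K1 K10 hK] := thermal_lead (erefl alpha).
have Zn p : p <= 0 -> thermal_spectrum F p = 0.
  by move=> p0; rewrite /thermal_spectrum shifted_spectrum_out// mul0r mulr0.
have X0 : ((2 * pi)^-1)%:C * (chi 0 * 'i%C) != 0 :> C.
  rewrite !mulf_neq0//.
    by apply/eqP => /(congr1 (@re R)); rewrite reR re0 => /eqP; rewrite invr_eq0 gt_eqF ?twopi_gt0.
  by apply/eqP => /(congr1 (@im R)); rewrite imi im0 => /eqP; rewrite oner_eq0.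
have ns e : e ^+ 2 = 1 -> ~ L1 (fun u => \1_pos u * normc (Cint (fun p => thermal_spectrum F p * cis (p * (e * u)))) ^+ 2).
  (* [delta] is 1, since [thermal_lead] holds on all of ]0, 1]. *)
  by move=> e2; exact: (not_square_integrable_transform lZ Zn alpha_gt0 al ltr01 (lexx 1) K10 X0 hK e2).
rewrite Th_smallE Th_largeE; split.
  by move/(thermal_log alpha_gt0 a1 hB sqN1); exact: ns sqN1.
by move/(thermal_log alpha_gt0 a1 hB (expr1n _ 2)); exact: ns (expr1n _ 2).
Qed.

End ParticleIntegrals.

(** * Convergence above the threshold, divergence below it *)

Section Dichotomy.
Variable R : realType.
Local Notation mu := (@lebesgue_measure R).
Local Notation C := R[i].
Variables (F chi : R -> C) (alpha K : R).
Hypothesis lF : L1C F.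
Hypothesis F_pos : forall p, p <= 0 -> cFT F p = 0.
Hypothesis alpha_gt0 : 0 < alpha.
Hypothesis F_chi : forall p, 0 < p -> cFT F p = (p `^ alpha)%:C * chi p.
Hypothesis K_ge0 : 0 <= K.
Hypothesis chi_lip : forall p, 0 <= p <= 1 -> normc (chi p - chi 0) <= K * p.
Hypothesis chi0 : chi 0 != 0.
Local Notation A := (fun k => normc (FX F k) ^+ 2 / k).
Local Notation T := (fun k => normc (FTh F k) ^+ 2 / k).
Local Notation dAT := (fun k => `|normc (FX F k) ^+ 2 - normc (FTh F k) ^+ 2| / k).
Local Notation N := (fun p => normc (cFT F p) ^+ 2 / p / (expR (2 * pi * p) - 1)).
Local Notation small := (`]0, 1]%classic : set R).
Local Notation large := (`[1, +oo[%classic : set R).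

Lemma integral_scale_lty D (c : R) (f : R -> R) : measurable D -> measurable_fun setT f ->
  (forall x, D x -> 0 <= f x) -> 0 <= c ->
  (\int[mu]_(x in D) (f x)%:E < +oo)%E -> (\int[mu]_(x in D) (c * f x)%:E < +oo)%E.
Proof.
move=> mD mf f0 c0 h.
under eq_integral do rewrite EFinM.
rewrite ge0_integralZl_EFin//; last by apply/measurable_EFinP; exact: measurable_funTS.
by rewrite lte_mul_pinfty// lee_fin.
Qed.

Let smallP k : small k -> 0 < k <= 1. Proof. by rewrite /= in_itv. Qed.
Let largeP k : large k -> 1 <= k. Proof. by rewrite /= in_itv/= andbT. Qed.
Let small_gt0 k : small k -> 0 < k. Proof. by move=> /smallP/andP[]. Qed.
Let large_gt0 k : large k -> 0 < k. Proof. by move=> /largeP; exact: lt_le_trans. Qed.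

Let mA : measurable_fun setT A.
Proof. by have h := measurable_sqr_FX lF; mea. Qed.
Let mT : measurable_fun setT T.
Proof. by have h := measurable_sqr_FTh lF; mea. Qed.
Let mdAT : measurable_fun setT dAT.
Proof. by have h := measurable_sqr_FX lF; have h' := measurable_sqr_FTh lF; mea. Qed.

Let A0 k : 0 < k -> 0 <= A k. Proof. by move=> k0; rewrite divr_ge0 ?sqr_ge0// ltW. Qed.
Let T0 k : 0 < k -> 0 <= T k. Proof. by move=> k0; rewrite divr_ge0 ?sqr_ge0// ltW. Qed.
Let dAT0 k : 0 < k -> 0 <= dAT k. Proof. by move=> k0; rewrite divr_ge0// ltW. Qed.

Let AE k : 0 < k -> A k <= T k + dAT k.
Proof.
move=> k0; rewrite -mulrDl; apply: ler_wpM2r; first by rewrite invr_ge0 ltW.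
by rewrite -lerBlDl ler_norm.
Qed.

Let TE k : 0 < k -> T k <= A k + dAT k.
Proof.
move=> k0; rewrite -mulrDl; apply: ler_wpM2r; first by rewrite invr_ge0 ltW.
by rewrite distrC -lerBlDl ler_norm.
Qed.

Let dATE k : 0 < k -> dAT k <= A k + T k.
Proof.
move=> k0; rewrite -mulrDl; apply: ler_wpM2r; first by rewrite invr_ge0 ltW.
apply: (le_trans (ler_normB _ _)).
by rewrite !ger0_norm ?sqr_ge0.
Qed.

(** The integrands [A], [T] and [dAT] satisfy all three triangle inequalities, so two finite
    integrals force the third: [T] and [dAT] for large momenta, [A] and [T] for small ones. *)
Lemma supercritical : 1 / 2 < alpha ->
  (\int[mu]_(k in large) (A k)%:E < +oo)%E /\ (\int[mu]_(k in small) (dAT k)%:E < +oo)%E.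
Proof.
move=> al.
have [T1 T2] := checkTh_lty lF F_pos F_chi K_ge0 chi_lip al.
have A1 := check_small_lty lF F_pos alpha_gt0 F_chi K_ge0 chi_lip.
have D2 := check_Th_large_lty lF F_pos.
split.
- apply: (integral_add_lty (measurable_itv _) mA mT mdAT _ _ _ _ T2 D2) => k /large_gt0; [exact: A0|exact: T0|exact: dAT0|exact: AE].
- apply: (integral_add_lty (measurable_itv _) mdAT mA mT _ _ _ _ A1 T1) => k /small_gt0; [exact: dAT0|exact: A0|exact: T0|exact: dATE].
Qed.

(** [T] diverges at both ends, while [dAT] converges for large momenta and [A] for small ones; the
    remaining integrand must diverge in each range. *)
Lemma subcritical : alpha <= 1 / 2 ->
  ~ (\int[mu]_(k in large) (A k)%:E < +oo)%E /\ ~ (\int[mu]_(k in small) (dAT k)%:E < +oo)%E.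
Proof.
move=> al.
have [T1 T2] := checkTh_nlty lF F_pos alpha_gt0 F_chi K_ge0 chi_lip chi0 al.
have A1 := check_small_lty lF F_pos alpha_gt0 F_chi K_ge0 chi_lip.
have D2 := check_Th_large_lty lF F_pos.
split=> h.
- apply: T2; apply: (integral_add_lty (measurable_itv _) mT mA mdAT _ _ _ _ h D2) => k /large_gt0; [exact: T0|exact: A0|exact: dAT0|exact: TE].
- apply: T1; apply: (integral_add_lty (measurable_itv _) mT mA mdAT _ _ _ _ A1 h) => k /small_gt0; [exact: T0|exact: A0|exact: dAT0|exact: TE].
Qed.

Let planck_ge (p : R) : 0 < p -> p <= expR (2 * pi * p) - 1.
Proof.
move=> p0; have := expR_ge1Dx (2 * pi * p); have := @pi_ge2 R; move: (pi) => q q2 h.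
have : p <= 2 * q * p by rewrite ler_peMl// ?(ltW p0)//; lra.
by move: h; lra.
Qed.

Lemma measurable_planck : measurable_fun setT N.
Proof.
have h : measurable_fun setT (fun p => normc (cFT F p)) by exact: (m_normc (mC_cFT lF)).
by mea.
Qed.

Lemma planck_ge0 p : 0 < p -> 0 <= N p.
Proof.
move=> p0; have h := planck_ge p0.
apply: divr_ge0; first by rewrite divr_ge0 ?sqr_ge0// ltW.
exact: le_trans (ltW p0) h.
Qed.

(** For p >= 1 the Planck denominator is at least p, hence at least 1, so the tail of the
    normalisation integral dominates. *)
Let planck_large :
  (\int[mu]_(p in large) (normc (cFT F p) ^+ 2 / p)%:E < +oo)%E ->
  (\int[mu]_(p in large) (N p)%:E < +oo)%E.
Proof.
have h : measurable_fun setT (fun p => normc (cFT F p)) by exact: (m_normc (mC_cFT lF)).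
apply: (integral_le_lty (measurable_itv _) measurable_planck _ _ _).
- by mea.
- by move=> p /large_gt0; exact: planck_ge0.
- move=> p pl; have p0 := large_gt0 pl; have p1 := largeP pl.
  have e1 := le_trans p1 (planck_ge p0).
  have q0 : 0 <= normc (cFT F p) ^+ 2 / p by rewrite divr_ge0 ?sqr_ge0// ltW.
  by apply: ler_piMr => //; rewrite invf_le1// (lt_le_trans ltr01).
Qed.

Let planck_small_lty : 1 / 2 < alpha -> (\int[mu]_(p in small) (N p)%:E < +oo)%E.
Proof.
move=> al; pose a := Num.min alpha 1.
have a2 : 1 / 2 < a by rewrite lt_min al/=; lra.
have a0 : 0 < a by apply: lt_trans a2; rewrite divr_gt0.
have aal : a <= alpha by rewrite ge_min lexx.
have [B hB] := F_bnd_exists lF F_chi K_ge0 chi_lip a0 aal.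
have b0 : 0 < 2 * a - 1 by lra.
apply: (integral_le_lty (measurable_itv _) measurable_planck _ _ _ (integral_powR01 (B ^+ 2) b0)).
- by apply: measurable_funM => //; exact: measurable_powR.
- by move=> p /small_gt0; exact: planck_ge0.
- move=> p /small_gt0 p0.
  have -> : B ^+ 2 * p `^ (2 * a - 1 - 1) = (B * p `^ a) ^+ 2 / p / p.
    have ip : p^-1 = expR (- ln p) by rewrite expRN lnK.
    have -> : p `^ (2 * a - 1 - 1) = p `^ a * p `^ a * p^-1 * p^-1.
      by rewrite ip !powR_exp// -!expRD; congr expR; ring.
    ring.
  have i0 : 0 <= p^-1 by rewrite invr_ge0 ltW.
  apply: ler_pM.
  + by rewrite divr_ge0 ?sqr_ge0// ltW.
  + by rewrite invr_ge0 (le_trans (ltW p0))// planck_ge.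
  + apply: ler_wpM2r => //; apply: lerXn2r; rewrite ?nnegrE ?normc_ge0 ?hB//.
    exact: le_trans (normc_ge0 _) (hB p p0).
  + by rewrite lef_pV2 ?posrE// ?planck_ge// (lt_le_trans p0)// planck_ge.
Qed.

(** On ]0, 1] the squared spectrum is at least p |chi(p)|^2 and the denominator at most M p, so [N]
    is at least |chi(p)|^2 / (M p). The Lipschitz bound gives |chi(p)|^2 >= |chi(0)|^2 / 2 - (K
    p)^2; thus c / p is at most [N] plus a constant, and 1 / p is not integrable at 0. *)
Let planck_small_nlty : alpha <= 1 / 2 -> ~ (\int[mu]_(p in small) (N p)%:E < +oo)%E.
Proof.
(* From e^x - 1 <= x e^x with x = 2 pi p <= 2 pi. *)
move=> al h; pose M : R := 2 * pi * expR (2 * pi).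
have t0 := twopi_gt0 R.
have M0 : 0 < M by rewrite mulr_gt0 ?expR_gt0.
set n := normc (chi 0).
have n0 : 0 < n.
  by rewrite lt_neqAle normc_ge0 eq_sym andbT; apply: contra_neq chi0; exact: normc_eq0.
pose c := n ^+ 2 / 2 / M.
have c0 : 0 < c by rewrite !divr_gt0// exprn_gt0.
have key p : small p -> c * p^-1 <= N p + K ^+ 2 / M.
  move=> /smallP/andP[p0 p1].
  have e0 : 0 < expR (2 * pi * p) - 1 := lt_le_trans p0 (planck_ge p0).
  have e1 : expR (2 * pi * p) - 1 <= M * p.
    have h1 := expR_ge1Dx (- (2 * pi * p)).
    have x0 : 0 <= 2 * pi * p by rewrite mulr_ge0// ltW.
    have h2 : expR (2 * pi * p) <= expR (2 * pi) by rewrite ler_expR -[leRHS]mulr1 ler_wpM2l// ltW.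
    have h3 : expR (2 * pi * p) * expR (- (2 * pi * p)) = 1 by rewrite -expRD subrr expR0.
    have h4 := expR_ge0 (2 * pi * p).
    rewrite /M; move: (expR (- _)) (expR (2 * pi * p)) (expR (2 * pi)) h1 h2 h3 h4 => u v w h1 h2 h3 h4.
    have : v * (1 - 2 * pi * p) <= v * u by apply: ler_wpM2l => //; lra.
    rewrite h3 => h5.
    have : v * (2 * pi * p) <= w * (2 * pi * p) by apply: ler_wpM2r.
    have -> : 2 * pi * w * p = w * (2 * pi * p) by ring.
    by move: h5; rewrite mulrBr mulr1; lra.
  have h1 : n ^+ 2 <= 2 * normc (chi p) ^+ 2 + 2 * (K * p) ^+ 2.
    have hl := chi_lip (_ : 0 <= p <= 1); have := hl; rewrite p1 ltW// => /(_ isT) {}hl.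
    have h2 : n <= normc (chi p) + K * p.
      have -> : n = normc (chi p - (chi p - chi 0)) by rewrite /n; congr normc; ring.
      by apply: (le_trans (ler_normcB _ _)); apply: lerD.
    apply: (@le_trans _ _ ((normc (chi p) + K * p) ^+ 2)).
      by apply: lerXn2r => //; rewrite ?nnegrE ?(ltW n0)// (le_trans (ltW n0)).
    rewrite -subr_ge0; move: (normc (chi p)) (K * p) => x y.
    by have -> : 2 * x ^+ 2 + 2 * y ^+ 2 - (x + y) ^+ 2 = (x - y) ^+ 2; [ring|exact: sqr_ge0].
  have h2 : p * normc (chi p) ^+ 2 <= normc (cFT F p) ^+ 2.
    rewrite (F_chi p0) normcM exprMn normcR (ger0_norm (powR_ge0 _ _)).
    apply: ler_wpM2r; first exact: sqr_ge0.
    rewrite powR_exp// expr2 -expRD -[leLHS]lnK ?posrE// ler_expR.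
    by have := ln_le0 p1; nra.
  have h3 : normc (chi p) ^+ 2 / (M * p) <= N p.
    apply: (@le_trans _ _ (p * normc (chi p) ^+ 2 / p / (M * p))).
      by rewrite (mulrC p) mulfK ?gt_eqF.
    apply: ler_pM.
    + by rewrite mulr_ge0 ?invr_ge0 ?(ltW p0)// mulr_ge0 ?sqr_ge0// ltW.
    + by rewrite invr_ge0 mulr_ge0// ltW.
    + by apply: ler_wpM2r => //; rewrite invr_ge0 ltW.
    + by rewrite lef_pV2 ?posrE// mulr_gt0.
  apply: (@le_trans _ _ (normc (chi p) ^+ 2 / (M * p) + (K * p) ^+ 2 / (M * p))).
    rewrite -mulrDl /c; have -> : n ^+ 2 / 2 / M * p^-1 = (n ^+ 2 / 2) / (M * p).
      by field; rewrite !gt_eqF.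
    by apply: ler_wpM2r; [rewrite invr_ge0 mulr_ge0// ltW|rewrite ler_pdivrMr//; lra].
  apply: lerD => //.
  have -> : (K * p) ^+ 2 / (M * p) = p * (K ^+ 2 / M) by field; rewrite !gt_eqF.
  by rewrite ler_piMl// divr_ge0 ?sqr_ge0// ltW.
have ci : (\int[mu]_(p in small) (c * p^-1)%:E < +oo)%E.
  apply: (integral_add_lty (measurable_itv _) _ measurable_planck (measurable_cst (K ^+ 2 / M)) _ _ _ key h (integral_cst01 _)).
  - by mea.
  - by move=> p /small_gt0 p0; apply: mulr_ge0; [exact: ltW|rewrite invr_ge0 ltW].
  - by move=> p /small_gt0; exact: planck_ge0.
  - by move=> p _; rewrite divr_ge0 ?sqr_ge0// ltW.
have : (\int[mu]_(p in small) (c^-1 * (c * p^-1))%:E < +oo)%E.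
  apply: integral_scale_lty ci; [exact: measurable_itv|by mea| |by rewrite invr_ge0 ltW].
  by move=> p /small_gt0 p0; apply: mulr_ge0; [exact: ltW|rewrite invr_ge0 ltW].
under eq_integral do rewrite mulKf ?gt_eqF//.
by rewrite integral_inv01 ltxx.
Qed.

Lemma planck_lty :
  (\int[mu]_(p in large) (normc (cFT F p) ^+ 2 / p)%:E < +oo)%E ->
  (\int[mu]_(p in `]0%R, +oo[) (N p)%:E < +oo)%E <-> 1 / 2 < alpha.
Proof.
move=> hl; rewrite (integral_Ioy_lty measurable_planck planck_ge0); split=> [[h _]|al].
  by rewrite ltNge; apply/negP => al; exact: planck_small_nlty al h.
by split; [exact: planck_small_lty|exact: planck_large].
Qed.

End Dichotomy.

(** * Translation from real and imaginary parts *)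

Section Twists.
Variable R : realType.
Local Notation C := R[i].
Variables fr fi : R -> R.
Hypothesis lfr : L1 fr.
Hypothesis lfi : L1 fi.

Definition cfun (t : R) : C := fr t +i* fi t.

Lemma L1C_cfun : L1C cfun.
Proof. by split. Qed.

Lemma twist_reE (phi : R -> R) :
  twist_re phi fr fi = (Num.sqrt (2 * pi))^-1 * re (Cint (fun t => cfun t * cis (phi t))).
Proof. by []. Qed.

Lemma twist_imE (phi : R -> R) :
  twist_im phi fr fi = (Num.sqrt (2 * pi))^-1 * im (Cint (fun t => cfun t * cis (phi t))).
Proof. by []. Qed.

Lemma twist_sqnorm (phi : R -> R) : twist_re phi fr fi ^+ 2 + twist_im phi fr fi ^+ 2 =
  (2 * pi)^-1 * normc (Cint (fun t => cfun t * cis (phi t))) ^+ 2.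
Proof.
rewrite twist_reE twist_imE !exprMn -mulrDr -sqr_normc; congr (_ * _).
by rewrite exprVn sqr_sqrtr// ltW ?twopi_gt0.
Qed.

Lemma check_sqnormE k : check_sqnorm fr fi k / (2 * k) =
  (2 * pi)^-1 / 2 * (normc (FX cfun k) ^+ 2 / k).
Proof. by rewrite /check_sqnorm twist_sqnorm (invfM 2 k) -/(FX cfun k); ring. Qed.

Lemma checkTh_sqnormE k : checkTh_sqnorm fr fi k / (2 * k) =
  (2 * pi)^-1 / 2 * (normc (FTh cfun k) ^+ 2 / k).
Proof. by rewrite /checkTh_sqnorm twist_sqnorm (invfM 2 k) -/(FTh cfun k); ring. Qed.

Lemma check_diffE k : `|check_sqnorm fr fi k - checkTh_sqnorm fr fi k| / (2 * k) =
  (2 * pi)^-1 / 2 * (`|normc (FX cfun k) ^+ 2 - normc (FTh cfun k) ^+ 2| / k).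
Proof.
rewrite /check_sqnorm /checkTh_sqnorm !twist_sqnorm -/(FX cfun k) -/(FTh cfun k) -mulrBr normrM.
by rewrite (ger0_norm (_ : 0 <= (2 * pi)^-1)) ?invr_ge0 ?ltW ?twopi_gt0// (invfM 2 k); ring.
Qed.

Lemma FT_sqnormE p : FT_sqnorm fr fi p = (2 * pi)^-1 * normc (cFT cfun p) ^+ 2.
Proof. by rewrite /FT_sqnorm /FT_re /FT_im twist_sqnorm. Qed.

Lemma cFT_cfunE p : cFT cfun p = (Num.sqrt (2 * pi))%:C * (FT_re fr fi p +i* FT_im fr fi p).
Proof.
have s0 : Num.sqrt (2 * pi) != 0 :> R by rewrite gt_eqF// sqrtr_gt0 twopi_gt0.
rewrite /FT_re /FT_im twist_reE twist_imE.
by apply: Cext; rewrite !reimE ?(mul0r, subr0, addr0) mulVKf.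
Qed.

End Twists.

Lemma integral_scale_ltyE (R : realType) (D : set R) (c : R) (f g : R -> R) : measurable D ->
  measurable_fun setT f -> (forall x, D x -> 0 <= f x) -> 0 < c -> (forall x, g x = c * f x) ->
  ((\int[@lebesgue_measure R]_(x in D) (g x)%:E < +oo)%E <->
   (\int[@lebesgue_measure R]_(x in D) (f x)%:E < +oo)%E).
Proof.
move=> mD mf f0 c0 gE; have -> : g = (fun x => c * f x) by exact/funext.
split=> h; last exact: integral_scale_lty (ltW c0) h.
have mg : measurable_fun setT (fun x => c * f x) by mea.
have ci : 0 <= c^-1 by rewrite invr_ge0 ltW.
have := integral_scale_lty mD mg (fun x Dx => mulr_ge0 (ltW c0) (f0 x Dx)) ci h.
by under eq_integral do rewrite mulKf ?gt_eqF//.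
Qed.

Theorem theorem1 (R : realType)
  (chir chii : R -> R)   (* chi = chir + i chii *)
  (chitr chiti : R -> R) (* its Fourier transform chi~ = chitr + i chiti *)
  (alpha : R) (fr fi : R -> R) (* f_alpha = fr + i fi *) :
  (@leb R).-integrable setT (EFin \o chir) ->
  (@leb R).-integrable setT (EFin \o chii) ->
  (forall p, FT_re chir chii p = chitr p /\ FT_im chir chii p = chiti p) ->
  smooth chitr -> smooth chiti ->
  (chitr 0 != 0 \/ chiti 0 != 0) ->
  derivs_vanish_at_0 chitr -> derivs_vanish_at_0 chiti ->
  derivs_vanish_at_infty chitr -> derivs_vanish_at_infty chiti ->
  0 < alpha ->
  (@leb R).-integrable setT (EFin \o fr) ->
  (@leb R).-integrable setT (EFin \o fi) ->
  (* f_alpha~(p) = theta(p) p^alpha chi~(p) *)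
  (forall p, 0 < p -> FT_re fr fi p = (p `^ alpha) * chitr p /\
                      FT_im fr fi p = (p `^ alpha) * chiti p) ->
  (forall p, p <= 0 -> FT_re fr fi p = 0 /\ FT_im fr fi p = 0) ->
  (* normalisation *)
  (\int[@leb R]_(p in [set` `]0, +oo[%R]) ((FT_sqnorm fr fi p / (2 * p))%:E))%E = 1%E ->
  [/\ (Nbar fr fi < +oo)%E <-> 1 / 2 < alpha,
      (NbarTh (2 * pi) fr fi < +oo)%E <-> 1 / 2 < alpha,
      (Ndiffabs [set` `]0, +oo[%R] fr fi < +oo)%E <-> 1 / 2 < alpha &
      (alpha <= 1 / 2 ->
       [/\ (Npart [set` `]0, 1]%R] fr fi < +oo)%E /\
             Npart [set` `[1, +oo[%R] fr fi = +oo%E,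
           NThpart [set` `]0, 1]%R] fr fi = +oo%E /\
             NThpart [set` `[1, +oo[%R] fr fi = +oo%E &
           (Ndiffabs [set` `[1, +oo[%R] fr fi < +oo)%E /\
             Ndiffabs [set` `]0, 1]%R] fr fi = +oo%E])].
Proof.
move=> _ _ _ schr schi chi0 _ _ _ _ al0 lfr lfi F_pos' F_neg norm1.
pose F := cfun fr fi; have lF : L1C F := L1C_cfun lfr lfi.
pose s : R := Num.sqrt (2 * pi).
have s0 : 0 < s by rewrite sqrtr_gt0 twopi_gt0.
(* The factor sqrt (2 pi) is absorbed here, so that the unnormalised transform of [F] is exactly
   p^alpha chi(p). *)
pose chi p : R[i] := s%:C * (chitr p +i* chiti p).
have F_neg' p : p <= 0 -> cFT F p = 0.
  by move=> p0; rewrite cFT_cfunE (F_neg p p0).1 (F_neg p p0).2; exact: mulr0.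
have F_chi p : 0 < p -> cFT F p = (p `^ alpha)%:C * chi p.
  move=> p0; rewrite cFT_cfunE (F_pos' p p0).1 (F_pos' p p0).2 /chi -/s.
  by apply: Cext; rewrite !reimE; ring.
have [Kr Kr0 hKr] := smooth_lipschitz0 schr.
have [Ki Ki0 hKi] := smooth_lipschitz0 schi.
pose K := s * (Kr + Ki).
have K0 : 0 <= K by rewrite mulr_ge0 ?addr_ge0// ltW.
have chi_lip p : 0 <= p <= 1 -> normc (chi p - chi 0) <= K * p.
  move=> p01; rewrite /chi -mulrBr normcM normcR (gtr0_norm s0) /K -mulrA.
  apply: ler_wpM2l; first exact: ltW.
  apply: (le_trans (normc_le _)); rewrite !reimE mulrDl.
  by apply: lerD; [exact: hKr|exact: hKi].
have chi0' : chi 0 != 0.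
  rewrite /chi mulf_neq0//.
    by apply/eqP => /(congr1 (@re R)); rewrite reR re0 => /eqP; rewrite gt_eqF.
  apply/eqP => h; have := congr1 (@re R) h; have := congr1 (@im R) h.
  rewrite reC imC re0 im0 => hi hr.
  by case: chi0; rewrite ?hr ?hi eqxx.
have d0 : 0 < (2 * pi)^-1 / 2 :> R by rewrite divr_gt0// invr_gt0 twopi_gt0.
have mX := measurable_sqr_FX lF; have mT := measurable_sqr_FTh lF.
have m1 : measurable_fun setT (fun k => normc (FX F k) ^+ 2 / k) by mea.
have m2 : measurable_fun setT (fun k => normc (FTh F k) ^+ 2 / k) by mea.
have m3 : measurable_fun setT (fun k => `|normc (FX F k) ^+ 2 - normc (FTh F k) ^+ 2| / k) by mea.
have mc : measurable_fun setT (fun p => normc (cFT F p)) by exact: (m_normc (mC_cFT lF)).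
have m4 : measurable_fun setT (fun p => normc (cFT F p) ^+ 2 / p) by mea.
have m5 := measurable_planck lF.
have g1 k : 0 < k -> 0 <= normc (FX F k) ^+ 2 / k by move=> k0; rewrite divr_ge0 ?sqr_ge0// ltW.
have g2 k : 0 < k -> 0 <= normc (FTh F k) ^+ 2 / k by move=> k0; rewrite divr_ge0 ?sqr_ge0// ltW.
have g3 k : 0 < k -> 0 <= `|normc (FX F k) ^+ 2 - normc (FTh F k) ^+ 2| / k.
  by move=> k0; rewrite divr_ge0// ltW.
have g4 k : 0 < k -> 0 <= normc (cFT F k) ^+ 2 / k by move=> k0; rewrite divr_ge0 ?sqr_ge0// ltW.
have iS k : [set` `]0 : R, 1]] k -> 0 < k by rewrite /= in_itv/= => /andP[].
have iL k : [set` `[1 : R, +oo[] k -> 0 < k by rewrite /= in_itv/= andbT; exact: lt_le_trans.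
have iP k : [set` `]0 : R, +oo[] k -> 0 < k by rewrite /= in_itv/= andbT.
have sc (D : set R) (f g : R -> R) : measurable D -> measurable_fun setT f -> (forall x, D x -> 0 < x) ->
    (forall x, 0 < x -> 0 <= f x) -> (forall x, g x = (2 * pi)^-1 / 2 * f x) ->
  ((\int[@leb R]_(x in D) (g x)%:E < +oo)%E <-> (\int[@leb R]_(x in D) (f x)%:E < +oo)%E).
  by move=> mD mf Dp f0 gE; apply: (integral_scale_ltyE mD mf _ d0 gE) => x /Dp; exact: f0.
have mS : measurable ([set` `]0 : R, 1]] : set R) := measurable_itv _.
have mL : measurable ([set` `[1 : R, +oo[] : set R) := measurable_itv _.
have mP : measurable ([set` `]0 : R, +oo[] : set R) := measurable_itv _.
have XS := sc _ _ _ mS m1 iS g1 (check_sqnormE fr fi).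
have XL := sc _ _ _ mL m1 iL g1 (check_sqnormE fr fi).
have XP := sc _ _ _ mP m1 iP g1 (check_sqnormE fr fi).
have TS := sc _ _ _ mS m2 iS g2 (checkTh_sqnormE fr fi).
have TL := sc _ _ _ mL m2 iL g2 (checkTh_sqnormE fr fi).
have DS := sc _ _ _ mS m3 iS g3 (check_diffE fr fi).
have DL := sc _ _ _ mL m3 iL g3 (check_diffE fr fi).
have DP := sc _ _ _ mP m3 iP g3 (check_diffE fr fi).
have A1 := check_small_lty lF F_neg' al0 F_chi K0 chi_lip.
have D2 := check_Th_large_lty lF F_neg'.
have up := supercritical lF F_neg' al0 F_chi K0 chi_lip.
have lo := subcritical lF F_neg' al0 F_chi K0 chi_lip chi0'.
have loT := checkTh_nlty lF F_neg' al0 F_chi K0 chi_lip chi0'.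
have nlt (x : \bar R) : ~ (x < +oo)%E -> x = +oo%E.
  by move=> h; apply/eqP; rewrite -leye_eq leNgt; apply/negP.
split.
- apply: (iff_trans XP); apply: (iff_trans (integral_Ioy_lty m1 g1)); split=> [[_ h]|al].
    by rewrite ltNge; apply/negP => al; exact: (lo al).1 h.
  by split; [exact: A1|exact: (up al).1].
(* The normalisation enters here: it makes the Planck integral converge for large p, so that only
   the behaviour at 0 decides. *)
- have N1 : (\int[@leb R]_(p in `]0%R, +oo[) (normc (cFT F p) ^+ 2 / p)%:E < +oo)%E.
    apply/(sc _ _ (fun p => FT_sqnorm fr fi p / (2 * p)) mP m4 iP g4).
      by move=> p; rewrite FT_sqnormE (invfM 2 p); ring.
    by rewrite norm1 ltry.
  have [_ N2] := (integral_Ioy_lty m4 g4).1 N1.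
  have PL := planck_lty lF F_chi K0 chi_lip chi0' N2.
  apply: (iff_trans _ PL).
  apply: (sc _ _ _ mP m5 iP (planck_ge0 _)).
  by move=> p; rewrite FT_sqnormE (invfM 2 p); ring.
- apply: (iff_trans DP); apply: (iff_trans (integral_Ioy_lty m3 g3)); split=> [[h _]|al].
    by rewrite ltNge; apply/negP => al; exact: (lo al).2 h.
  by split; [exact: (up al).2|exact: D2].
- move=> al; have [a1 a2] := lo al; have [t1 t2] := loT al; split; split.
  + exact: XS.2 A1.
  + by apply: nlt => h; exact: a1 (XL.1 h).
  + by apply: nlt => h; exact: t1 (TS.1 h).
  + by apply: nlt => h; exact: t2 (TL.1 h).
  + exact: DL.2 D2.
  + by apply: nlt => h; exact: a2 (DS.1 h).
Qed.
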